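(* Let $n\ge1$, $\alpha>-1$, and let $\Phi\in \mathscr{L}_p\cup \mathscr{U}^q$ (for some $0<p\le1$, $q\ge1$), $\Phi$ not identically zero. Let $g$ be a holomorphic function on $\mathbb{B}^n$ with $g(0)=0$. Then the operator $T_g$ is bounded on $\mathcal{A}_\alpha^\Phi(\mathbb{B}^n)$ if and only if $$M:=\sup_{z\in \mathbb{B}^n}(1-|z|^2)|\mathcal{R}g(z)|<\infty.$$ Moreover, if $\|T_g\|$ denotes the operator norm of $T_g$ on $\mathcal{A}_\alpha^\Phi(\mathbb{B}^n)$, then $\|T_g\|\simeq M$, i.e. there are constants $c,C>0$ independent of $g$ such that $cM\le\|T_g\|\le CM$.
   Context: A growth function is a continuous non-decreasing function $\Phi:[0,\infty)\to[0,\infty)$. It is of upper type $q\ge 1$ if there is $C>0$ with $\Phi(st)\le Ct^q\Phi(s)$ for all $s>0$, $t\ge 1$; it is of lower type $p>0$ if there is $C>0$ with $\Phi(st)\le Ct^p\Phi(s)$ for all $s>0$, $0<t\le 1$. For $q\ge 1$, $\mathscr{U}^q$ is the set of growth functions of upper type $q$ such that $t\mapsto \Phi(t)/t$ is non-decreasing. For $0<p\le 1$, $\mathscr{L}_p$ is the set of growth functions of lower type $p$ such that $t\mapsto\Phi(t)/t$ is non-increasing. $\mathbb{B}^n$ is the unit ball of $\mathbb{C}^n$, $d\nu$ is Lebesgue measure, $d\nu_\alpha(z)=c_\alpha(1-|z|^2)^\alpha d\nu(z)$ with $\nu_\alpha(\mathbb{B}^n)=1$. $\mathcal{A}_\alpha^\Phi(\mathbb{B}^n)$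 is the space of holomorphic $f$ on $\mathbb{B}^n$ with $\int_{\mathbb{B}^n}\Phi(|f|)\,d\nu_\alpha<\infty$, with the (quasi-)norm $\|f\|^{lux}_{\alpha,\Phi}=\inf\{\lambda>0:\int_{\mathbb{B}^n}\Phi(|f(z)|/\lambda)\,d\nu_\alpha(z)\le1\}$. Boundedness and the operator norm $\|T\|=\sup_{f\ne0}\|Tf\|^{lux}_{\alpha,\Phi}/\|f\|^{lux}_{\alpha,\Phi}$ are with respect to this (quasi-)norm. The radial derivative is $\mathcal{R}g(z)=\sum_{j=1}^n z_j\frac{\partial g}{\partial z_j}(z)$. For $g$ holomorphic on $\mathbb{B}^n$ with $g(0)=0$, the operator $T_g$ is defined on holomorphic functions $f$ on $\mathbb{B}^n$ by $T_gf(z)=\int_0^1f(tz)\,\mathcal{R}g(tz)\,\frac{dt}{t}$. *)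

(* Defs.v *)
From HB Require Import structures.
From mathcomp Require Import all_boot all_order all_algebra.
From mathcomp Require Import complex.
From mathcomp Require Import all_classical all_reals all_analysis.

Set Implicit Arguments.
Unset Strict Implicit.
Unset Printing Implicit Defensive.

Import Order.TTheory GRing.Theory Num.Theory.
Import numFieldNormedType.Exports.

Local Open Scope classical_set_scope.
Local Open Scope ring_scope.

(* The library's sigma-finite structure on m1 \x m2 is masked by its
   subprobability structure; this alias of m1 \x m2 carries it. *)
Section prod_sigma_finite.
Context d1 d2 (T1 : measurableType d1) (T2 : measurableType d2) (R : realType).
Variable m1 : {sigma_finite_measure set T1 -> \bar R}.
Variable m2 : {sigma_finite_measure set T2 -> \bar R}.

Definition prod_sf : set (T1 * T2) -> \bar R := (m1 \x m2)%E.

HB.instance Definition _ := Measure.on prod_sf.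

Let prod_sf_sigma_finite : sigma_finite setT prod_sf.
Proof.
have /sigma_finiteP[F [TF ndF Foo]] := sigma_finiteT m1.
have /sigma_finiteP[G [TG ndG Goo]] := sigma_finiteT m2.
exists (fun n => F n `*` G n).
  rewrite -setXTT TF TG predeqE => -[x y]; split.
    move=> [/= [n _ Fnx] [k _ Gky]]; exists (maxn n k) => //; split.
    - by move: x Fnx; exact/subsetPset/ndF/leq_maxl.
    - by move: y Gky; exact/subsetPset/ndG/leq_maxr.
  by move=> [n _ []/= ? ?]; split; exists n.
move=> k; have [? ?] := Foo k; have [? ?] := Goo k.
split; first exact: measurableX.
by rewrite /prod_sf product_measure1E// lte_mul_pinfty// ge0_fin_numE.
Qed.

HB.instance Definition _ := Measure_isSigmaFinite.Build _ _ _ prod_sf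
  prod_sf_sigma_finite.

End prod_sigma_finite.

(* Product of n copies of a sigma-finite measure, as a measure on n-tuples:
   the image of mu \x mu^n under (x, t) |-> x :: t. *)
Section tuple_measure.
Context d (T : measurableType d) (R : realType).
Variable mu : {sigma_finite_measure set T -> \bar R}.

Definition tcons n (p : T * n.-tuple T) : n.+1.-tuple T := [tuple of p.1 :: p.2].

Lemma measurable_tcons n : measurable_fun [set: T * n.-tuple T] (@tcons n).
Proof. exact: (measurable_cons (f := fst) (g := snd)). Qed.

Section step.
Variables (n : nat) (m : {sigma_finite_measure set (n.-tuple T) -> \bar R}).

Definition tuple_measureS : set (n.+1.-tuple T) -> \bar R :=
  pushforward (prod_sf mu m) (@tcons n).

Let tuple_measureS0 : tuple_measureS set0 = 0%E.
Proof. by rewrite /tuple_measureS /pushforward preimage_set0 measure0. Qed.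

Let tuple_measureS_ge0 A : (0 <= tuple_measureS A)%E.
Proof. by rewrite /tuple_measureS /pushforward; exact: measure_ge0. Qed.

Let mpre A : measurable A -> measurable (@tcons n @^-1` A).
Proof.
by move=> mA; rewrite -[X in measurable X]setTI; exact: measurable_tcons.
Qed.

Let tuple_measureS_sigma_additive : semi_sigma_additive tuple_measureS.
Proof.
move=> F mF tF mUF; rewrite /tuple_measureS /pushforward preimage_bigcup.
apply: measure_semi_sigma_additive.
- by move=> k; exact: mpre.
- apply/trivIsetP => /= i j _ _ ij; rewrite -preimage_setI.
  by move/trivIsetP : tF => /(_ _ _ _ _ ij) ->//; rewrite preimage_set0.
- by rewrite -preimage_bigcup; exact: mpre.
Qed.

HB.instance Definition _ := isMeasure.Build _ _ _ tuple_measureS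
  tuple_measureS0 tuple_measureS_ge0 tuple_measureS_sigma_additive.

Let tuple_measureS_sigma_finite : sigma_finite setT tuple_measureS.
Proof.
have /sigma_finiteP[F [TF _ Foo]] := sigma_finiteT (prod_sf mu m).
pose u (t : n.+1.-tuple T) := (thead t, [tuple of behead t]).
have uK (t : n.+1.-tuple T) : tcons (u t) = t.
  by rewrite [RHS]tuple_eta; apply/val_inj.
have Ku p : u (@tcons n p) = p.
  by case: p => x t; rewrite /u /tcons/=; congr pair; apply/val_inj.
have mu_ : measurable_fun setT u.
  by apply: measurable_fun_pair => /=; [exact: measurable_tnth|exact: measurable_behead].
exists (fun k => u @^-1` F k).
  by rewrite -preimage_bigcup -TF preimage_setT.
move=> k; have [mF Fk] := Foo k; split.
  by rewrite -[X in measurable X]setTI; exact: mu_.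
rewrite /tuple_measureS /pushforward -comp_preimage.
by rewrite (_ : u \o _ = id) ?preimage_id//; apply/funext => p /=.
Qed.

HB.instance Definition _ := Measure_isSigmaFinite.Build _ _ _ tuple_measureS
  tuple_measureS_sigma_finite.

End step.

Fixpoint tuple_measure n : {sigma_finite_measure set (n.-tuple T) -> \bar R} :=
  if n is k.+1 then tuple_measureS (tuple_measure k) else \d_([tuple] : 0.-tuple T).

Lemma tuple_measureE n (A : 'I_n -> set T) : (forall i, measurable (A i)) ->
  tuple_measure n [set t | forall i, A i (tnth t i)] = (\prod_(i < n) mu (A i))%E.
Proof.
elim: n A => [|n IH] A mA.
  by rewrite big_ord0 /= diracE mem_set// => -[].
rewrite big_ord_recl -IH//=.
have mB : measurable [set t : n.-tuple T | forall i, A (lift ord0 i) (tnth t i)].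
  rewrite [X in measurable X](_ : _ =
    \bigcap_(i in [set: 'I_n]) ((tnth (T:=T))^~ i @^-1` A (lift ord0 i))).
    apply: fin_bigcap_measurable => // i _.
    by rewrite -[X in measurable X]setTI; exact: measurable_tnth.
  by apply/seteqP; split => t /= H i; [move=> _|]; apply: H.
rewrite -product_measure1E// -/(prod_sf _ _).
rewrite /tuple_measureS /pushforward; congr (prod_sf mu (tuple_measure n) _).
apply/seteqP; split => -[x t] /=.
  move=> H; split; first exact: (H ord0).
  by move=> i /=; have := H (lift ord0 i); rewrite tnthS.
move=> [H0 H] i; case: (unliftP ord0 i) => [j ->|->]//.
by rewrite tnthS; exact: H.
Qed.

End tuple_measure.

Definition C (R : realType) : numClosedFieldType := R[i].

Section defs.
Variable R : realType.
Local Notation normc := (@Normc.normc R).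

Section space.
Variable n : nat.
Local Notation Cn := 'rV[C R]_n.

Definition sqnorm (z : Cn) : R := \sum_(j < n) normc (z 0 j) ^+ 2.

Definition Bn : set Cn := [set z | sqnorm z < 1].

Definition holomorphic (f : Cn -> C R) : Prop :=
  forall z, Bn z -> differentiable f z.

Definition radial (g : Cn -> C R) (z : Cn) : C R :=
  \sum_(j < n) z 0 j * 'D_(delta_mx 0 j) g z.

(* Lebesgue measure on C^n is carried by the real coordinates
   ((x_1, y_1), ..., (x_n, y_n)) of z_j = x_j + i y_j. *)
Definition lebesgueC :
    {sigma_finite_measure set (n.-tuple (measurableTypeR R * measurableTypeR R))
     -> \bar R} :=
  tuple_measure (prod_sf (@lebesgue_measure R) (@lebesgue_measure R)) n.

Definition of_coords (t : n.-tuple (measurableTypeR R * measurableTypeR R)) : Cn :=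
  \row_(j < n) ((tnth t j).1 +i* (tnth t j).2)%C.

Definition integral_Bn (F : Cn -> R) : \bar R :=
  (\int[lebesgueC]_(t in of_coords @^-1` Bn) (F (of_coords t))%:E)%E.

(* Normalization making nu_alpha(B^n) = 1. *)
Definition calpha (alpha : R) : R :=
  (fine (integral_Bn (fun z => (1 - sqnorm z) `^ alpha)))^-1.

(* Integral against d nu_alpha = c_alpha (1 - |z|^2)^alpha d nu. *)
Definition integral_alpha (alpha : R) (F : Cn -> R) : \bar R :=
  integral_Bn (fun z => calpha alpha * (1 - sqnorm z) `^ alpha * F z).

Definition bergman_orlicz (alpha : R) (Phi : R -> R) : set (Cn -> C R) :=
  [set f | holomorphic f /\
           (integral_alpha alpha (fun z => Phi (normc (f z))) < +oo)%E].

(* The infimum is taken in \bar R, so that it is +oo when no l qualifies. *)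
Definition lux (alpha : R) (Phi : R -> R) (f : Cn -> C R) : \bar R :=
  ereal_inf [set l%:E | l in [set l : R | 0 < l /\
    (integral_alpha alpha (fun z => Phi (normc (f z) / l)%R) <= 1)%E]].

Definition bounded_op (alpha : R) (Phi : R -> R)
    (T : (Cn -> C R) -> (Cn -> C R)) : Prop :=
  (forall f, bergman_orlicz alpha Phi f -> bergman_orlicz alpha Phi (T f)) /\
  exists K : R, forall f, bergman_orlicz alpha Phi f ->
    (lux alpha Phi (T f) <= K%:E * lux alpha Phi f)%E.

(* Elements of the space are functions on the ball, so "f <> 0" means that
   f does not vanish identically there. *)
Definition op_norm (alpha : R) (Phi : R -> R)
    (T : (Cn -> C R) -> (Cn -> C R)) : \bar R :=
  ereal_sup [set (lux alpha Phi (T f) / lux alpha Phi f)%E | f in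
    [set f | bergman_orlicz alpha Phi f /\ exists2 z, Bn z & f z != 0]].

Definition integralC01 (h : R -> C R) : C R :=
  ((Rintegral (@lebesgue_measure R) `[0, 1] (fun t => complex.Re (h t))) +i*
   (Rintegral (@lebesgue_measure R) `[0, 1] (fun t => complex.Im (h t))))%C.

Definition Tg (g f : Cn -> C R) (z : Cn) : C R :=
  integralC01 (fun t => let tz := (t%:C)%C *: z in
    f tz * radial g tz / (t%:C)%C).

Definition bloch_seminorm (g : Cn -> C R) : \bar R :=
  ereal_sup [set ((1 - sqnorm z) * normc (radial g z))%:E | z in Bn].

End space.

(* Growth functions on [0, +oo[; values of Phi at negative reals are
   irrelevant. *)
Definition growth_function (Phi : R -> R) : Prop :=
  [/\ forall t, 0 <= t -> 0 <= Phi t,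
      {within `[0, +oo[, continuous Phi} &
      forall s t, 0 <= s -> s <= t -> Phi s <= Phi t].

Definition upper_type (q : R) (Phi : R -> R) : Prop :=
  exists2 K : R, 0 < K &
    forall s t, 0 < s -> 1 <= t -> Phi (s * t) <= K * t `^ q * Phi s.

Definition lower_type (p : R) (Phi : R -> R) : Prop :=
  exists2 K : R, 0 < K &
    forall s t, 0 < s -> 0 < t -> t <= 1 -> Phi (s * t) <= K * t `^ p * Phi s.

Definition classU (q : R) : set (R -> R) := [set Phi |
  [/\ growth_function Phi, upper_type q Phi &
      forall s t, 0 < s -> s <= t -> Phi s / s <= Phi t / t]].

Definition classL (p : R) : set (R -> R) := [set Phi |
  [/\ growth_function Phi, lower_type p Phi &
      forall s t, 0 < s -> s <= t -> Phi t / t <= Phi s / s]].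

End defs.

(* Main.v *)
(* Write N z for the Euclidean norm, so that 1 - (N z)^2 is comparable with 1 - N z, and M for the supremum of (1 - N z) |Rg z|.

Upper bound. Since |Rg(tz)| / t <= C M / (1 - t N z), integrating along the ray from 0 to z gives |Tg f(z)| <= C M B with B = sup_t |f(tz)| ((1 - t N z) / (1 - N z))^e for any e > 0. Upper type turns this into a bound of Phi(|Tg f(z)| / M) by ((1 - t N z) / (1 - N z))^(eq) Phi(|f(tz)|) for some t. The sub-mean value property of Phi(|f|) bounds the latter by an average of Phi(|f|) over the ball of centre tz and radius (1 - t N z) / 2, every point w of which satisfies N (w - z) < 3 (1 - N w); for e q < alpha + 1 Tonelli's theorem then bounds the modular of Tg f / M by a constant times that of f, and lower type converts this into a bound on norms.

Lower bound. The identity R(Tg f) = f Rg gives access to Rg(a). Let E(a) be the supremum of |f(a)| over the f of modular at most 1. Then E(l a) <= C E(a) for |l - 1| <= (1 - N a) / 2, and Cauchy's estimate for l |-> Tg f(l a) on this circle, with f almost extremal at a, yields (1 - N a) E(a) |Rg(a)| <= C ||Tg|| E(a). *)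
From HB Require Import structures.
Require Import Defs.
From mathcomp Require Import all_boot all_order all_algebra.
From mathcomp Require Import complex.
From mathcomp Require Import all_classical all_reals all_analysis.
From mathcomp Require Import measurable_realfun.
From mathcomp Require Import ring lra.
Set Implicit Arguments.
Unset Strict Implicit.
Unset Printing Implicit Defensive.
Import Order.TTheory GRing.Theory Num.Theory.
Import numFieldNormedType.Exports.
Local Open Scope classical_set_scope.
Local Open Scope ring_scope.


(** * Norms on C and C^n *)

(** Holomorphy is given only as complex differentiability at the points of the ball, so Cauchy's
    theory starts from Goursat's bisection and reaches C^n by slicing along complex lines. Neither
    Phi(t) nor Phi(e^s) is assumed convex, so subharmonicity of Phi(|f|) is not at hand: the
    sub-mean value property is derived separately for each class, by comparing Phi with a linear
    function on the values of |f|, after which both classes are treated alike. The types stand in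
    for homogeneity: a constant in front of a modular becomes, through lower type, a factor of the
    norm. The exponent e is there because the integral of 1 / (1 - t N z) grows logarithmically at
    the boundary. The t that nearly attains B depends on z; the averages are therefore dominated by
    integrals over regions described by w and z alone, which is what allows Tonelli. In the lower
    bound the size of E(a) is never computed: it occurs on both sides and cancels, and only its slow
    variation along circles l a matters. *)

Section complex_basics.
Context {R : realType}.
Local Notation nc := (@Normc.normc R).
Implicit Types z w : C R.

Lemma normC_nc z : `|z| = (nc z)%:C%C.
Proof. by []. Qed.

Lemma nc_ge0 z : 0 <= nc z.
Proof. by case: z => a b; rewrite sqrtr_ge0. Qed.

Lemma nc0 : nc 0 = 0. Proof. exact: Normc.normc0. Qed.
Lemma nc1 : nc 1 = 1. Proof. exact: Normc.normc1. Qed.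

Lemma ncM z w : nc (z * w) = nc z * nc w.
Proof. exact: Normc.normcM. Qed.

Lemma ncN z : nc (- z) = nc z. Proof. exact: normcN. Qed.

Lemma ncB z w : nc (z - w) = nc (w - z).
Proof. by rewrite -ncN opprB. Qed.

Lemma ncD z w : nc (z + w) <= nc z + nc w.
Proof. exact: le_normcD. Qed.

Lemma ncV z : nc z^-1 = (nc z)^-1.
Proof. exact: Normc.normcV. Qed.

Lemma ncR (x : R) : nc (x%:C)%C = `|x|.
Proof. by rewrite /= expr0n/= addr0 sqrtr_sqr. Qed.

Lemma nc_eq0 z : (nc z == 0) = (z == 0).
Proof.
apply/eqP/eqP => [/Normc.eq0_normc//|->]; exact: nc0.
Qed.

Lemma nc_gt0 z : (0 < nc z) = (z != 0).
Proof. by rewrite lt_def nc_eq0 nc_ge0 andbT. Qed.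

Lemma nc_Re z : `|complex.Re z| <= nc z.
Proof.
by case: z => a b /=; rewrite -sqrtr_sqr ler_wsqrtr// lerDl sqr_ge0.
Qed.

Lemma nc_Im z : `|complex.Im z| <= nc z.
Proof.
by case: z => a b /=; rewrite -sqrtr_sqr ler_wsqrtr// lerDr sqr_ge0.
Qed.

Lemma nc_sqr z : nc z ^+ 2 = complex.Re z ^+ 2 + complex.Im z ^+ 2.
Proof. by case: z => a b /=; rewrite sqr_sqrtr// addr_ge0 ?sqr_ge0. Qed.

Lemma nc_le_ReIm z : nc z <= `|complex.Re z| + `|complex.Im z|.
Proof.
rewrite -(@ler_pXn2r _ 2)// ?nnegrE ?addr_ge0 ?nc_ge0//.
rewrite nc_sqr sqrrD !real_normK ?num_real// lerD2r lerDl.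
by rewrite mulrn_wge0// mulr_ge0.
Qed.

Lemma nc_sum I (r : seq I) (P : pred I) (F : I -> C R) :
  nc (\sum_(i <- r | P i) F i) <= \sum_(i <- r | P i) nc (F i).
Proof.
elim/big_ind2 : _ => [|x y u v xy uv|//]; first by rewrite nc0.
by rewrite (le_trans (ncD _ _))// lerD.
Qed.

Lemma ReD z w : complex.Re (z + w) = complex.Re z + complex.Re w.
Proof. by case: z w => [? ?] [? ?]. Qed.
Lemma ImD z w : complex.Im (z + w) = complex.Im z + complex.Im w.
Proof. by case: z w => [? ?] [? ?]. Qed.
Lemma ReN z : complex.Re (- z) = - complex.Re z. Proof. by case: z. Qed.
Lemma ImN z : complex.Im (- z) = - complex.Im z. Proof. by case: z. Qed.
Lemma ReB z w : complex.Re (z - w) = complex.Re z - complex.Re w.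
Proof. by rewrite ReD ReN. Qed.
Lemma ImB z w : complex.Im (z - w) = complex.Im z - complex.Im w.
Proof. by rewrite ImD ImN. Qed.
Lemma ReM z w : complex.Re (z * w) =
  complex.Re z * complex.Re w - complex.Im z * complex.Im w.
Proof. by case: z w => [? ?] [? ?]. Qed.
Lemma ImM z w : complex.Im (z * w) =
  complex.Re z * complex.Im w + complex.Im z * complex.Re w.
Proof. by case: z w => [? ?] [? ?]. Qed.

(** Balls of a normed module over C have radii that are positive elements of C, that is, embedded
    positive reals; they are exchanged here for real radii. *)
Lemma nearC (V : normedModType (C R)) (a : V) (P : V -> Prop) :
  (\forall x \near a, P x) <->
  exists2 e : R, 0 < e & forall x, `|x - a| < (e%:C)%C -> P x.
Proof.
split.
  move=> /nbhs_normP[e /= e0 eP].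
  have /andP[/eqP Ime Ree] : (complex.Im e == 0) && (0 < complex.Re e).
    by move: e0; rewrite ltcE /=.
  exists (complex.Re e) => // x xa; apply: eP => /=.
  rewrite /ball_/= distrC (lt_le_trans xa)//.
  by rewrite lecE/= Ime eqxx lexx.
move=> [e e0 eP]; apply/nbhs_normP; exists (e%:C)%C; first by rewrite /= ltcR.
by move=> x /=; rewrite /ball_/= distrC; exact: eP.
Qed.

Lemma real_contP (f : R -> R) (x : R) :
  (forall e : R, 0 < e ->
    exists2 d : R, 0 < d & forall h, `|h| < d -> `|f (x + h) - f x| <= e) ->
  {for x, continuous f}.
Proof.
move=> H; apply/cvgrPdist_le => /= e e0.
have [d d0 dP] := H e e0.
apply/nbhs_normP; exists d => //= y; rewrite /ball_/= => xy.
have -> : f y = f (x + (y - x)) by rewrite addrC subrK.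
by rewrite distrC; apply: dP; rewrite distrC.
Qed.

End complex_basics.

Section vectors.
Context {R : realType} {n : nat}.
Local Notation nc := (@Normc.normc R).
Local Notation Cn := 'rV[C R]_n.
Implicit Types z w : Cn.

Definition norm2 z : R := Num.sqrt (sqnorm z).

Lemma sqnorm_ge0 z : 0 <= sqnorm z.
Proof. by apply: sumr_ge0 => i _; exact: sqr_ge0. Qed.

Lemma norm2_ge0 z : 0 <= norm2 z. Proof. exact: sqrtr_ge0. Qed.

Lemma norm2_sqr z : norm2 z ^+ 2 = sqnorm z.
Proof. by rewrite sqr_sqrtr// sqnorm_ge0. Qed.

Lemma norm2_coord z j : nc (z 0 j) <= norm2 z.
Proof.
rewrite -(@ler_pXn2r _ 2)// ?nnegrE ?nc_ge0 ?norm2_ge0// norm2_sqr.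
rewrite /sqnorm (bigD1 j)//= lerDl.
by apply: sumr_ge0 => i _; exact: sqr_ge0.
Qed.

Lemma norm2_le_sum z : norm2 z <= \sum_(j < n) nc (z 0 j).
Proof.
have s0 : 0 <= \sum_(j < n) nc (z 0 j) by apply: sumr_ge0 => *; exact: nc_ge0.
rewrite -(@ler_pXn2r _ 2)// ?nnegrE ?norm2_ge0// norm2_sqr /sqnorm.
rewrite [leRHS]expr2 mulr_suml; apply: ler_sum => i _.
rewrite expr2 ler_wpM2l ?nc_ge0// (bigD1 i)//= lerDl.
by apply: sumr_ge0 => *; exact: nc_ge0.
Qed.

Lemma norm2Z (a : C R) z : norm2 (a *: z) = nc a * norm2 z.
Proof.
rewrite /norm2 /sqnorm; under eq_bigr do rewrite mxE ncM exprMn.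
by rewrite -mulr_sumr sqrtrM ?sqr_ge0// sqrtr_sqr ger0_norm ?nc_ge0.
Qed.

Lemma norm20 : norm2 (0 : Cn) = 0.
Proof.
by rewrite /norm2 /sqnorm big1 ?sqrtr0// => i _; rewrite mxE nc0 expr0n.
Qed.

Lemma norm2N z : norm2 (- z) = norm2 z.
Proof. by rewrite -scaleN1r norm2Z ncN nc1 mul1r. Qed.

Lemma norm2B z w : norm2 (z - w) = norm2 (w - z).
Proof. by rewrite -norm2N opprB. Qed.

Lemma norm2D z w : norm2 (z + w) <= norm2 z + norm2 w.
Proof.
have CS (x y : 'I_n -> R) : (forall i, 0 <= x i) -> (forall i, 0 <= y i) ->
  \sum_i x i * y i <= Num.sqrt (\sum_i x i ^+ 2) * Num.sqrt (\sum_i y i ^+ 2).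
  move=> x0 y0; set a := \sum_i x i ^+ 2; set b := \sum_i y i ^+ 2.
  set c := \sum_i x i * y i.
  have a0 : 0 <= a by apply: sumr_ge0 => *; exact: sqr_ge0.
  have b0 : 0 <= b by apply: sumr_ge0 => *; exact: sqr_ge0.
  have c0 : 0 <= c by apply: sumr_ge0 => *; exact: mulr_ge0.
  rewrite -sqrtrM// -(@ger0_norm _ c)// -sqrtr_sqr ler_sqrt ?mulr_ge0//.
  (* Cauchy-Schwarz by the discriminant: at t = c / b this sum of squares equals (a b - c^2) / b. *)
  have key t : 0 <= a - (c * t) *+ 2 + b * t ^+ 2.
    rewrite (_ : _ + _ = \sum_i (x i - t * y i) ^+ 2).
      by apply: sumr_ge0 => *; exact: sqr_ge0.
    rewrite /a /b /c -mulrnAr !mulr_suml -sumrB -big_split/=.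
    by apply: eq_bigr => i _; ring.
  have [b00|b00] := eqVneq b 0.
    suff -> : c = 0 by rewrite expr0n/= b00 mulr0.
    apply: big1 => i _; suff /eqP : y i ^+ 2 = 0.
      by rewrite sqrf_eq0 => /eqP ->; rewrite mulr0.
    move/eqP: b00; rewrite psumr_eq0// => [/allP/(_ i)|]; last first.
      by move=> ? _; exact: sqr_ge0.
    by rewrite mem_index_enum => /(_ isT)/eqP.
  have bp : 0 < b by rewrite lt_def b00.
  have := key (c / b).
  rewrite (_ : _ + _ = (a * b - c ^+ 2) / b); last by field.
  by rewrite pmulr_lge0 ?invr_gt0// subr_ge0.
rewrite -(@ler_pXn2r _ 2)// ?nnegrE ?addr_ge0 ?norm2_ge0// sqrrD !norm2_sqr.
apply: (@le_trans _ _ (\sum_i (nc (z 0 i) + nc (w 0 i)) ^+ 2)).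
  apply: ler_sum => i _; rewrite mxE ler_pXn2r ?ncD//
    nnegrE ?addr_ge0 ?nc_ge0//.
under eq_bigr do rewrite sqrrD.
rewrite !big_split/= /sqnorm lerD2r lerD2l -mulr2n lerMn2r/=.
by apply: CS => i; exact: nc_ge0.
Qed.

Lemma BnE z : Bn z <-> norm2 z < 1.
Proof.
by rewrite /Bn/= -norm2_sqr expr_lt1// norm2_ge0.
Qed.

Lemma norm2_normr z : `|z| <= ((norm2 z)%:C)%C.
Proof.
rewrite [`|z|]mx_normE; set B := (norm2 z)%:C%C.
have B0 : 0 <= B by rewrite /B lecR norm2_ge0.
apply: (@le_trans _ _ (NngNum B0)%:num) => //; rewrite num_le; apply/bigmax_leP; split => //= i _.
by rewrite -num_le/= ord1 normC_nc lecR norm2_coord.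
Qed.

Lemma normr_norm2 z : ((norm2 z)%:C)%C <= n%:R * `|z|.
Proof.
apply: (@le_trans _ _ (((\sum_(j < n) nc (z 0 j))%:C)%C)).
  by rewrite lecR norm2_le_sum.
rewrite rmorph_sum/= mulr_natl.
rewrite [leRHS](_ : _ = \sum_(j < n) `|z|); last by rewrite sumr_const card_ord.
apply: ler_sum => i _; rewrite [leRHS]mx_normE -normC_nc.
apply: (@le_trans _ _ ((`|z 0 i|%:nng)%:num)) => //; rewrite num_le.
exact: (le_bigmax _ (fun ij : 'I_1 * 'I_n => `|z ij.1 ij.2|%:nng) (0, i)).
Qed.

(** The topology of row vectors comes from the maximum norm, and [norm2] lies between it and n times
    it; dividing by n + 1 keeps the divisor positive. *)
Lemma near_norm2 z (P : Cn -> Prop) :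
  (\forall x \near z, P x) <->
  exists2 e : R, 0 < e & forall x, norm2 (x - z) < e -> P x.
Proof.
rewrite nearC; split => -[e e0 eP].
  exists e => // x xz; apply: eP; rewrite (le_lt_trans (norm2_normr _))//.
  by rewrite ltcR.
have n1 : 0 < n%:R + 1 :> R by rewrite ltr_wpDl.
exists (e / (n%:R + 1)) => [|x xz]; first by rewrite divr_gt0.
apply: eP; rewrite -ltcR (le_lt_trans (normr_norm2 _))//.
apply: (@le_lt_trans _ _ (((n%:R + 1)%:C)%C * `|x - z|)).
  by rewrite ler_wpM2r// rmorphD/= rmorph_nat lerDl lecR.
rewrite (_ : (e%:C)%C = ((n%:R + 1)%:C)%C * ((e / (n%:R + 1))%:C)%C).
  by rewrite ltr_pM2l// ltcR.
by rewrite -rmorphM/= mulrCA divff ?mulr1// gt_eqF.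
Qed.

End vectors.

(** * Complex differentiability in one and several variables, with real epsilons *)

Section differentiability.
Context {R : realType}.
Local Notation nc := (@Normc.normc R).

(** [differentiable] speaks of the chosen map ['d f x]. The expansion with the candidate [df] is
    turned into a little-o, and [df] is then handed to the choice operator as a witness. *)
Lemma differentiable_intro (V W : normedModType (C R)) (f : V -> W) (x : V)
    (df : {linear V -> W}) : continuous df ->
  (forall e : R, 0 < e -> exists2 d : R, 0 < d & forall h : V,
     `|h| < (d%:C)%C -> `|f (x + h) - f x - df h| <= (e%:C)%C * `|h|) ->
  differentiable f x.
Proof.
move=> dfc H.
have dxf : f \o shift x = cst (f x) + df +o_ 0 id.
  apply/eqaddoP => e e0.
  have /andP[/eqP Ime Ree] : (complex.Im e == 0) && (0 < complex.Re e).
    by move: e0; rewrite ltcE /=.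
  have [d d0 dP] := H _ Ree.
  apply/nearC; exists d => // h; rewrite subr0 => hd.
  have ReE : ((complex.Re e)%:C)%C = e by rewrite RRe_real// realE (ltW e0).
  have := dP _ hd; rewrite ReE => {}dP.
  suff -> : (f \o shift x - (cst (f x) + df)) h = f (x + h) - f x - df h by [].
  by rewrite -[LHS]/(f (h + x) - (f x + df h)) [h + x]addrC opprD addrA.
have hdf h : (f \o shift x = cst (f x) + h +o_ 0 id) ->
    h = f \o shift x - cst (f x) +o_ 0 id.
  move=> hdf; apply: eqaddoE.
  rewrite hdf addrAC -!addrA addrC !addrA subrK.
  rewrite -[LHS]addr0 -addrA; congr (_ + _).
  by apply/eqP; rewrite eq_sym addrC addr_eq0 oppo.
apply/diffP => /=.
apply: (@getPex _ (fun (df : {linear V -> W}) => continuous df /\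
  forall y, f y = f (lim (nbhs x)) + df (y - lim (nbhs x))
                  +o_(y \near x) (y - lim (nbhs x)))).
exists df; split=> //; apply: eqaddoEx => z.
rewrite (hdf _ dxf) !addrA lim_id // /(_ \o _) /= subrK [f _ + _]addrC addrK.
rewrite -addrA -[LHS]addr0; congr (_ + _).
apply/eqP; rewrite eq_sym addrC addr_eq0 oppox; apply/eqP.
rewrite [in LHS]littleo_center0 (comp_centerK x id).
by rewrite -[- _ in RHS](comp_centerK x).
Qed.

Lemma differentiable_elim (V W : normedModType (C R)) (f : V -> W) (x : V) :
  differentiable f x ->
  forall e : R, 0 < e -> exists2 d : R, 0 < d & forall h : V,
     `|h| < (d%:C)%C -> `|f (x + h) - f x - 'd f x h| <= (e%:C)%C * `|h|.
Proof.
move=> /diff_locally/eqaddoP dxf e e0.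
have /nearC[d d0 dP] := dxf (e%:C)%C ltac:(by rewrite ltcR).
exists d => // h hd; have := dP h; rewrite subr0 => /(_ hd).
suff -> : (f \o shift x - (cst (f x) + 'd f x)) h = f (x + h) - f x - 'd f x h.
  by [].
by rewrite -[LHS]/(f (h + x) - (f x + 'd f x h)) [h + x]addrC opprD addrA.
Qed.

Section one_variable.
Implicit Types k l : C R -> C R.

Definition cdiff k (a d : C R) := forall e : R, 0 < e ->
  exists2 r : R, 0 < r & forall h, nc h < r ->
    nc (k (a + h) - k a - h * d) <= e * nc h.

Lemma differentiable_cdiff k a : differentiable k a -> cdiff k a ('d k a 1).
Proof.
move=> /differentiable_elim H e e0; have [d d0 dP] := H e e0.
exists d => // h hd; have := dP h; rewrite !normC_nc ltcR => /(_ hd).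
rewrite -rmorphM/= lecR; suff -> : 'd k a h = h * 'd k a 1 by [].
by rewrite -[in LHS](mulr1 h) -[h * 1]/(h *: (1 : C R)) linearZ.
Qed.

Lemma cdiff_differentiable k a d : cdiff k a d -> differentiable k a.
Proof.
move=> H.
have dc : continuous (d \*: (@idfun (C R)) : C R -> C R).
  exact: (@mulrl_continuous (C R) d).
apply: (@differentiable_intro _ _ k a (d \*: (@idfun (C R)))) => // e e0.
have [r r0 rP] := H e e0; exists r => // h; rewrite !normC_nc ltcR => hr.
by have := rP _ hr; rewrite [h * d]mulrC -rmorphM lecR.
Qed.

Lemma cdiff_unique k a d d' : cdiff k a d -> cdiff k a d' -> d = d'.
Proof.
move=> H H'; apply/eqP; rewrite -subr_eq0 -nc_eq0 eq_le nc_ge0 andbT.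
apply/ler_addgt0Pr => e e0; rewrite add0r.
have e2 : 0 < e / 2 by rewrite divr_gt0.
have [r r0 rP] := H _ e2; have [r' r0' rP'] := H' _ e2.
pose m := Num.min r r' / 2.
have m0 : 0 < m by rewrite divr_gt0// lt_min r0 r0'.
have mr : m < Num.min r r' by rewrite ltr_pdivrMr// ltr_pMr ?ltr1n// lt_min r0 r0'.
have hm : nc (m%:C)%C = m by rewrite ncR gtr0_norm.
have /rP : nc (m%:C)%C < r by rewrite hm (lt_le_trans mr)// ge_min lexx.
have /rP' : nc (m%:C)%C < r' by rewrite hm (lt_le_trans mr)// ge_min lexx orbT.
rewrite hm => h1 h2; rewrite -(ler_pM2r m0) -{1}hm -ncM.
rewrite (_ : (d - d') * _ = (k (a + (m%:C)%C) - k a - (m%:C)%C * d') -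
  (k (a + (m%:C)%C) - k a - (m%:C)%C * d)); last by ring.
rewrite (le_trans (ncD _ _))// ncN (le_trans (lerD h1 h2))//.
by rewrite -mulrDl -splitr.
Qed.

End one_variable.

Section several_variables.
Variable n : nat.
Local Notation Cn := 'rV[C R]_n.
Implicit Types (f : Cn -> C R) (z h c : Cn).

(** Bilinear, without conjugation: [lform c] is the complex differential of a function whose partial
    derivatives are the entries of c. *)
Definition lform c h : C R := \sum_(j < n) h 0 j * c 0 j.

Lemma lform_is_linear c : linear (lform c).
Proof.
move=> a u v; rewrite /lform scaler_sumr -big_split/=; apply: eq_bigr => i _.
by rewrite !mxE mulrDl -mulrA.
Qed.
HB.instance Definition _ c :=
  GRing.isLinear.Build (C R) Cn (C R) _ (lform c) (lform_is_linear c).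

Lemma nc_lform c h : nc (lform c h) <= n%:R * (norm2 c * norm2 h).
Proof.
rewrite (le_trans (nc_sum _ _ _))// mulr_natl.
rewrite [leRHS](_ : _ = \sum_(j < n) (norm2 c * norm2 h)); last first.
  by rewrite sumr_const card_ord.
apply: ler_sum => i _; by rewrite ncM mulrC ler_pM ?nc_ge0// norm2_coord.
Qed.

Definition fdiff f z c := forall e : R, 0 < e ->
  exists2 r : R, 0 < r & forall h, norm2 h < r ->
    nc (f (z + h) - f z - lform c h) <= e * norm2 h.

Lemma fdiff_differentiable f z c : fdiff f z c -> differentiable f z.
Proof.
move=> H; apply: (@differentiable_intro _ _ f z (lform c)).
  move=> x; apply/(@cvgrPdist_le _ _ _ (nbhs x) (nbhs_filter x)) => e e0.
  apply/near_norm2.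
  have /andP[/eqP Ime Ree] : (complex.Im e == 0) && (0 < complex.Re e).
    by move: e0; rewrite ltcE /=.
  have K0 : 0 < n%:R * norm2 c + 1 by rewrite ltr_wpDl ?mulr_ge0 ?norm2_ge0.
  exists (complex.Re e / (n%:R * norm2 c + 1)); first by rewrite divr_gt0.
  move=> y yx; rewrite -linearB normC_nc /=.
  have -> : e = ((complex.Re e)%:C)%C by rewrite RRe_real// realE (ltW e0).
  rewrite lecR (le_trans (nc_lform _ _))//.
  rewrite norm2B mulrA -[leRHS](divfK (lt0r_neq0 K0)) [leRHS]mulrC.
  apply: ler_pM; rewrite ?norm2_ge0 ?mulr_ge0 ?norm2_ge0 ?(ltW yx)//.
  by rewrite lerDl.
move=> e e0; have e1 : 0 < e / (n%:R + 1) by rewrite divr_gt0 ?ltr_wpDl.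
have [r r0 rP] := H _ e1.
have /nearC[d d0 dP] : \forall h \near (0 : Cn), norm2 h < r.
  by apply/near_norm2; exists r => // h; rewrite subr0.
exists d => // h hd; have := dP h; rewrite subr0 => /(_ hd)/rP.
rewrite -lecR -normC_nc rmorphM/= => /le_trans; apply.
rewrite rmorphM/= -mulrA ler_pM2l ?ltcR//.
rewrite fmorphV ler_pdivrMl ?ltcR ?ltr_wpDl//.
apply: (le_trans (normr_norm2 _)).
by rewrite ler_wpM2r// rmorphD/= rmorph_nat lerDl lecR.
Qed.

Lemma differentiable_fdiff f z : differentiable f z ->
  fdiff f z (\row_(j < n) 'D_(delta_mx 0 j) f z).
Proof.
move=> df e e0; have [d d0 dP] := differentiable_elim df e0.
exists d => // h hd.
have hd' : `|h| < (d%:C)%C by rewrite (le_lt_trans (norm2_normr _))// ltcR.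
have := dP h hd'; rewrite normC_nc.
have -> : 'd f z h = lform (\row_(j < n) 'D_(delta_mx 0 j) f z) h.
  rewrite {1}(row_sum_delta h) linear_sum/=; apply: eq_bigr => j _.
  by rewrite linearZ/= mxE deriveE.
move=> H; rewrite -lecR rmorphM/=; apply: (le_trans H).
by rewrite ler_wpM2l ?lecR ?(ltW e0)// norm2_normr.
Qed.

Lemma radialE f z : radial f z = lform (\row_(j < n) 'D_(delta_mx 0 j) f z) z.
Proof. by apply: eq_bigr => j _; rewrite mxE. Qed.

(** The chain rule along the complex line z + l v, through which one-variable results reach C^n. *)
Lemma fdiff_slice f z c v : fdiff f z c ->
  cdiff (fun l => f (z + l *: v)) 0 (lform c v).
Proof.
move=> H e e0.
have e1 : 0 < e / (norm2 v + 1) by rewrite divr_gt0// ltr_wpDl// norm2_ge0.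
have [r r0 rP] := H _ e1.
have v1 : 0 < norm2 v + 1 by rewrite ltr_wpDl// norm2_ge0.
exists (r / (norm2 v + 1)) => [|h hr]; first by rewrite divr_gt0.
have hv : norm2 (h *: v) <= nc h * (norm2 v + 1).
  by rewrite norm2Z ler_wpM2l ?nc_ge0// lerDl.
rewrite scale0r addr0 add0r; have := rP (h *: v).
rewrite linearZ/= => /(_ _)/le_trans; apply.
  by rewrite (le_lt_trans hv)// -ltr_pdivlMr.
by rewrite mulrAC ler_pdivrMr// -mulrA ler_wpM2l ?(ltW e0).
Qed.

End several_variables.

End differentiability.

(** * Goursat's theorem for closed 1-forms *)

Section interval_integral.
Context {R : realType}.
Local Notation mu := (@lebesgue_measure R).
Implicit Types (a b c x : R) (f g : R -> R).

Definition itvint a b f : R := Rintegral mu `[a, b] f.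

Definition ctson a b f := forall x, a <= x -> x <= b -> {for x, continuous f}.

Lemma ctson_within a b f : ctson a b f -> {within `[a, b], continuous f}.
Proof.
move=> H; apply: continuous_in_subspaceT => x; rewrite inE/= in_itv/= => /andP[].
exact: H.
Qed.

Lemma ctson_integrable a b f : ctson a b f ->
  mu.-integrable `[a, b] (EFin \o f).
Proof.
move=> H; apply: continuous_compact_integrable; first exact: segment_compact.
exact: ctson_within.
Qed.

Lemma itvint_split a m b f : a <= m -> m <= b -> ctson a b f ->
  itvint a b f = itvint a m f + itvint m b f.
Proof.
move=> am mb cf; have int_ := ctson_integrable cf.
have [->|mb'] := eqVneq m b.
  rewrite /itvint set_itv1 Rintegral_set1 addr0//.
have ltmb : m < b by rewrite lt_neqAle mb' mb.
apply/eqP; rewrite addrC -subr_eq; apply/eqP.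
rewrite /itvint Rintegral_itvB ?bnd_simp//.
apply: Rintegral_itv_obnd_cbnd.
apply: integrableS int_ => //.
apply: subset_itv => //=; rewrite bnd_simp//.
Qed.

Lemma itvintB a b f g : ctson a b f -> ctson a b g ->
  itvint a b (fun x => f x - g x) = itvint a b f - itvint a b g.
Proof. by move=> cf cg; apply: RintegralB => //; exact: ctson_integrable. Qed.

Lemma itvint_cst a b (k : R) : a <= b -> itvint a b (fun=> k) = k * (b - a).
Proof.
move=> ab; rewrite /itvint Rintegral_cst//= lebesgue_measure_itv/= lte_fin.
case: ltP => [//|ba]; have -> : a = b by apply/eqP; rewrite eq_le ab ba.
by rewrite subrr.
Qed.

Lemma itvint_bound a b f K : a <= b -> ctson a b f ->
  (forall x, a <= x -> x <= b -> `|f x| <= K) -> `|itvint a b f| <= K * (b - a).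
Proof.
move=> ab cf fK; rewrite -(itvint_cst K ab).
apply: (le_trans (le_normr_Rintegral _ (ctson_integrable cf))) => //.
apply: le_Rintegral => //.
- exact: (integrable_norm (ctson_integrable cf)).
- by apply: ctson_integrable => x _ _; exact: cvg_cst.
- by move=> x; rewrite /= in_itv/= => /andP[? ?]; exact: fK.
Qed.

End interval_integral.

Section goursat.
Context {R : realType}.
Variables P Q : R -> R -> R.

(** Real differentiability of P and Q at the point, with the same B serving as P_y and as Q_x: the
    form P dx + Q dy is closed there. Nothing is asked about continuity of the partial
    derivatives. *)
Definition closed_at (x y : R) := exists A B D : R, forall e : R, 0 < e ->
  exists2 r : R, 0 < r & forall h k, `|h| < r -> `|k| < r ->
    `|P (x + h) (y + k) - P x y - (A * h + B * k)| <= e * (`|h| + `|k|) /\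
    `|Q (x + h) (y + k) - Q x y - (B * h + D * k)| <= e * (`|h| + `|k|).

(** The integral of P dx + Q dy along the boundary of [a, b] x [c, d], counterclockwise. *)
Definition circulation (r : R * R * (R * R)) : R :=
  let: (a, b, (c, d)) := r in
  itvint a b (P ^~ c) + itvint c d (Q b) - itvint a b (P ^~ d) - itvint c d (Q a).

Lemma lin_small (A B e : R) : 0 < e ->
  exists2 r : R, 0 < r & forall h k : R, `|h| < r -> `|k| < r ->
    `|A * h + B * k| <= e.
Proof.
move=> e0; have K0 : 0 < `|A| + `|B| + 1 by rewrite ltr_wpDl ?addr_ge0.
exists (e / (`|A| + `|B| + 1)); first by rewrite divr_gt0.
move=> h k hr kr; apply: (le_trans (ler_normD _ _)); rewrite !normrM.
apply: (@le_trans _ _ ((`|A| + `|B|) * (e / (`|A| + `|B| + 1)))).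
  by rewrite mulrDl lerD// ler_wpM2l// ltW.
by rewrite mulrA ler_pdivrMr// mulrC ler_wpM2l ?(ltW e0)// lerDl.
Qed.

Lemma closed_at_cont x y : closed_at x y ->
  {for x, continuous (P ^~ y)} /\ {for y, continuous (Q x)}.
Proof.
move=> [A [B [D H]]].
have [r1 r10 H1] := H 1 ltr01.
split; apply: real_contP => e e0.
- have [r2 r20 H2] := @lin_small A 0 _ (divr_gt0 e0 (@ltr0n R 2)).
  exists (Num.min r1 (Num.min r2 (e / 2))).
    by rewrite !lt_min r10 r20 divr_gt0.
  move=> h; rewrite !lt_min => /and3P[hr1 hr2 he].
  have [] := H1 h 0 hr1; rewrite !(normr0, addr0, add0r, mulr0, mul1r)// => + _.
  have := H2 h 0 hr2; rewrite normr0 mulr0 addr0 => /(_ r20) h2 h1.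
  rewrite -[X in `|X|](subrK (A * h)) (le_trans (ler_normD _ _))//.
  by rewrite [leRHS]splitr lerD// (le_trans h1)// ltW.
- have [r2 r20 H2] := @lin_small 0 D _ (divr_gt0 e0 (@ltr0n R 2)).
  exists (Num.min r1 (Num.min r2 (e / 2))).
    by rewrite !lt_min r10 r20 divr_gt0.
  move=> h; rewrite !lt_min => /and3P[hr1 hr2 he].
  have [] := H1 0 h _ hr1; rewrite !(normr0, addr0, add0r, mulr0, mul1r)// => _.
  have := H2 0 h; rewrite normr0 mulr0 add0r => /(_ r20 hr2) h2 h1.
  rewrite -[X in `|X|](subrK (D * h)) (le_trans (ler_normD _ _))//.
  by rewrite [leRHS]splitr lerD// (le_trans h1)// ltW.
Qed.

Definition closed_on (r : R * R * (R * R)) := let: (a, b, (c, d)) := r in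
  [/\ a <= b, c <= d & forall x y, a <= x <= b -> c <= y <= d -> closed_at x y].

Lemma closed_on_cts a b c d : closed_on (a, b, (c, d)) ->
  (forall y, c <= y <= d -> ctson a b (P ^~ y)) /\
  (forall x, a <= x <= b -> ctson c d (Q x)).
Proof.
move=> [ab cd H]; split=> [y cyd x ax xb|x axb y cy yd].
  by have [] := closed_at_cont (H x y _ cyd); rewrite ?ax.
by have [] := closed_at_cont (H x y axb _); rewrite ?cy.
Qed.

(** The affine parts of P and Q at (x, y) contribute -B (d - c) (b - a) on the horizontal sides and
    B (b - a) (d - c) on the vertical ones, which cancel. Only remainders of size e times the
    half-perimeter are left on each side. *)
Lemma circulation_le a b c d x y (A B D e r : R) :
  closed_on (a, b, (c, d)) -> 0 < e ->
  (forall h k, `|h| < r -> `|k| < r ->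
    `|P (x + h) (y + k) - P x y - (A * h + B * k)| <= e * (`|h| + `|k|) /\
    `|Q (x + h) (y + k) - Q x y - (B * h + D * k)| <= e * (`|h| + `|k|)) ->
  a <= x <= b -> c <= y <= d -> b - a < r -> d - c < r ->
  `|circulation (a, b, (c, d))| <= 2 * e * (b - a + (d - c)) ^+ 2.
Proof.
move=> H e0 He /andP[ax xb] /andP[cy yd] bar dcr.
have [cP cQ] := closed_on_cts H; case: H => ab cd _.
have cc : c <= c <= d by rewrite lexx.
have dd : c <= d <= d by rewrite lexx andbT.
have aa : a <= a <= b by rewrite lexx.
have bb : a <= b <= b by rewrite lexx andbT.
have nx t : a <= t -> t <= b -> `|t - x| <= b - a.
  by move=> at_ tb; rewrite ler_norml; apply/andP; split; lra.
have ny t : c <= t -> t <= d -> `|t - y| <= d - c.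
  by move=> at_ tb; rewrite ler_norml; apply/andP; split; lra.
have E1 s t : a <= s -> s <= b -> c <= t -> t <= d ->
  `|P s t - P x y - (A * (s - x) + B * (t - y))| <= e * (b - a + (d - c)) /\
  `|Q s t - Q x y - (B * (s - x) + D * (t - y))| <= e * (b - a + (d - c)).
  move=> as_ sb ct td; have := He (s - x) (t - y).
  rewrite (le_lt_trans (nx _ as_ sb) bar) (le_lt_trans (ny _ ct td) dcr).
  move=> /(_ isT isT).
  have K (u v : R) : u + (v - u) = v by rewrite addrC subrK.
  rewrite !K => -[h1 h2].
  by split; [apply: (le_trans h1)|apply: (le_trans h2)];
    rewrite ler_wpM2l ?(ltW e0)// lerD ?nx ?ny.
rewrite /circulation.
have k1 : `|itvint a b (fun s => P s c - P s d - (- B * (d - c)))|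
    <= (2 * e * (b - a + (d - c))) * (b - a).
  apply: itvint_bound => //.
    move=> s as_ sb; apply: cvgB; last exact: cvg_cst.
    by apply: cvgB; [exact: cP|exact: cP].
  move=> s as_ sb; have [+ _] := E1 s c as_ sb (lexx _) cd.
  have [+ _] := E1 s d as_ sb cd (lexx _).
  rewrite !ler_norml => /andP[h1 h2] /andP[h3 h4].
  by apply/andP; split; lra.
have k2 : `|itvint c d (fun t => Q b t - Q a t - (B * (b - a)))|
    <= (2 * e * (b - a + (d - c))) * (d - c).
  apply: itvint_bound => //.
    move=> s as_ sb; apply: cvgB; last exact: cvg_cst.
    by apply: cvgB; [exact: cQ|exact: cQ].
  move=> t ct td; have [_ +] := E1 b t ab (lexx _) ct td.
  have [_ +] := E1 a t (lexx _) ab ct td.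
  rewrite !ler_norml => /andP[h1 h2] /andP[h3 h4].
  by apply/andP; split; lra.
rewrite !itvintB ?itvint_cst// in k1; last 4 first.
- exact: cP.
- exact: cP.
- by move=> s as_ sb; apply: cvgB; [exact: cP|exact: cP].
- by move=> s _ _; exact: cvg_cst.
rewrite !itvintB ?itvint_cst// in k2; last 4 first.
- exact: cQ.
- exact: cQ.
- by move=> s as_ sb; apply: cvgB; [exact: cQ|exact: cQ].
- by move=> s _ _; exact: cvg_cst.
move: k1 k2; rewrite !ler_norml => /andP[h1 h2] /andP[h3 h4].
by apply/andP; split; nra.
Qed.

(** The circulations of the four quarters add up to that of the rectangle, since inner sides are run
    through in both directions; so one quarter keeps at least a fourth of the modulus. *)
Lemma circulation_quarter r : closed_on r -> exists r',
  let: (a, b, (c, d)) := r in let: (a', b', (c', d')) := r' in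
  [/\ closed_on r', `|circulation r| / 4 <= `|circulation r'| &
   [/\ a <= a', b' <= b, c <= c' & d' <= d] /\
    (b' - a' = (b - a) / 2 /\ d' - c' = (d - c) / 2)].
Proof.
case: r => -[a b] [c d] H; have [cP cQ] := closed_on_cts H.
case: (H) => ab cd Hc.
pose m := (a + b) / 2; pose p := (c + d) / 2.
have am : a <= m by rewrite /m; lra.
have mb : m <= b by rewrite /m; lra.
have cp : c <= p by rewrite /p; lra.
have pd : p <= d by rewrite /p; lra.
have cl a' b' c' d' : a <= a' -> a' <= b' -> b' <= b -> c <= c' -> c' <= d' ->
    d' <= d -> closed_on (a', b', (c', d')).
  move=> ? ? ? ? ? ?; split => // x y /andP[? ?] /andP[? ?].
  by apply: Hc; apply/andP; split; lra.
have J : circulation (a, b, (c, d)) =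
  circulation (a, m, (c, p)) + circulation (m, b, (c, p)) +
  circulation (a, m, (p, d)) + circulation (m, b, (p, d)).
  rewrite /circulation.
  rewrite (itvint_split am mb (cP c _)) ?lexx//.
  rewrite (itvint_split am mb (cP d _)) ?lexx ?andbT//.
  rewrite (itvint_split cp pd (cQ a _)) ?lexx//.
  rewrite (itvint_split cp pd (cQ b _)) ?lexx ?andbT//.
  ring.
have [h1|h1] := leP (`|circulation (a, b, (c, d))| / 4) `|circulation (a, m, (c, p))|.
  exists (a, m, (c, p)); split => //; first by apply: cl.
  by do 2!split => //; rewrite /m /p; field.
have [h2|h2] := leP (`|circulation (a, b, (c, d))| / 4) `|circulation (m, b, (c, p))|.
  exists (m, b, (c, p)); split => //; first by apply: cl.
  by do 2!split => //; rewrite /m /p; field.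
have [h3|h3] := leP (`|circulation (a, b, (c, d))| / 4) `|circulation (a, m, (p, d))|.
  exists (a, m, (p, d)); split => //; first by apply: cl.
  by do 2!split => //; rewrite /m /p; field.
have [h4|h4] := leP (`|circulation (a, b, (c, d))| / 4) `|circulation (m, b, (p, d))|.
  exists (m, b, (p, d)); split => //; first by apply: cl.
  by do 2!split => //; rewrite /m /p; field.
exfalso; have := ler_normD (circulation (a, m, (c, p)) + circulation (m, b, (c, p)) +
  circulation (a, m, (p, d))) (circulation (m, b, (p, d))).
have := ler_normD (circulation (a, m, (c, p)) + circulation (m, b, (c, p)))
  (circulation (a, m, (p, d))).
have := ler_normD (circulation (a, m, (c, p))) (circulation (m, b, (c, p))).
rewrite -J; lra.
Qed.

(** Bisection: a non-zero circulation eta would leave at least eta / 4^k on nested rectangles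
    shrinking to a point, whereas differentiability at that point makes the circulation there an
    arbitrarily small multiple of 4^-k. *)
Lemma goursat a b c d : closed_on (a, b, (c, d)) -> circulation (a, b, (c, d)) = 0.
Proof.
move=> H0; apply/eqP; rewrite -normr_eq0; apply/negPn/negP => J0.
set eta := `|_| in J0; have eta0 : 0 < eta by rewrite lt_def J0 normr_ge0.
pose rT := {r : R * R * (R * R) | closed_on r}.
have step_ (r : rT) : exists r' : rT,
  let: (a, b, (c, d)) := sval r in let: (a', b', (c', d')) := sval r' in
  `|circulation (sval r)| / 4 <= `|circulation (sval r')| /\
   [/\ a <= a', b' <= b, c <= c' & d' <= d] /\
    (b' - a' = (b - a) / 2 /\ d' - c' = (d - c) / 2).
  case: r => -[[a0 b0] [c0 d0]] Hr.
  have [[[a1 b1] [c1 d1]] [h1 h2 h3]] := circulation_quarter Hr.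
  by exists (exist closed_on (a1, b1, (c1, d1)) h1).
have [step stepP] := choice step_.
pose s k := iter k step (exist _ (a, b, (c, d)) H0).
pose ak k := (sval (s k)).1.1; pose bk k := (sval (s k)).1.2.
pose ck k := (sval (s k)).2.1; pose dk k := (sval (s k)).2.2.
have sE k : sval (s k) = (ak k, bk k, (ck k, dk k)).
  by rewrite /ak /bk /ck /dk; case: (sval _) => -[? ?] [? ?].
have sS k : `|circulation (sval (s k))| / 4 <= `|circulation (sval (s k.+1))| /\
   ([/\ ak k <= ak k.+1, bk k.+1 <= bk k, ck k <= ck k.+1 & dk k.+1 <= dk k] /\
    (bk k.+1 - ak k.+1 = (bk k - ak k) / 2 /\ dk k.+1 - ck k.+1 = (dk k - ck k) / 2)).
  have := stepP (s k); rewrite -/(s k.+1) !sE//.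
have Jk k : eta / 4 ^+ k <= `|circulation (sval (s k))|.
  elim: k => [|k IH]; first by rewrite expr0 divr1.
  have [+ _] := sS k; apply: le_trans.
  by rewrite exprS invfM [4^-1 * _]mulrC mulrA ler_wpM2r// invr_ge0.
have wk k : bk k - ak k = (b - a) / 2 ^+ k /\ dk k - ck k = (d - c) / 2 ^+ k.
  elim: k => [|k [IH1 IH2]]; first by rewrite expr0 !divr1.
  have [_ [_ [-> ->]]] := sS k.
  by rewrite IH1 IH2 exprS; split; field; rewrite expf_neq0.
have abk k : ak k <= bk k /\ ck k <= dk k.
  by have := svalP (s k); rewrite sE => -[].
have mono (u v : nat -> R) : (forall k, u k <= u k.+1) ->
    (forall k, v k.+1 <= v k) -> (forall k, u k <= v k) ->
    exists x, forall k, u k <= x <= v k.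
  move=> uS vS uv.
  have hu i j : (i <= j)%N -> u i <= u j.
    by move=> ij; exact: (homo_leq (@lexx _ _) (@le_trans _ _) uS).
  have hv i j : (i <= j)%N -> v j <= v i.
    move=> /subnKC <-; elim: (j - i)%N => [|m IH]; first by rewrite addn0.
    by rewrite addnS (le_trans (vS _)).
  have ub k : ubound (range u) (v k).
    move=> _ [j _ <-]; apply: (le_trans (hu j (maxn j k) _)); first exact: leq_maxl.
    by apply: (le_trans (uv _)); apply: hv; exact: leq_maxr.
  exists (sup (range u)) => k; apply/andP; split.
    by apply: ub_le_sup; [exists (v 0%N)|exists k].
  by apply: ge_sup; [exists (u 0%N), 0%N|exact: ub].
have [x xP] : exists x, forall k, ak k <= x <= bk k.
  by apply: mono => k; [case: (sS k) => _ [[]]..|case: (abk k)].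
have [y yP] : exists y, forall k, ck k <= y <= dk k.
  by apply: mono => k; [case: (sS k) => _ [[]]..|case: (abk k)].
have [ab cd Hc] := H0.
have [A [B [D HD]]] := Hc x y (xP 0%N) (yP 0%N).
pose S := b - a + (d - c).
have S0 : 0 <= S by rewrite /S; lra.
have S20 : 0 < 4 * S ^+ 2 + 1 by rewrite ltr_wpDl// mulr_ge0// sqr_ge0.
(* For this e the bound 2 e (S / 2^k)^2 of [circulation_le] stays below eta / 4^k, because 2 S^2 < 4
   S^2 + 1. *)
have e0 : 0 < eta / (4 * S ^+ 2 + 1) by rewrite divr_gt0.
have [r r0 rP] := HD _ e0.
have [k kP] : exists k, S / 2 ^+ k < r.
  have [k Sk] : exists k : nat, S / r < k%:R.
    exists (Num.bound (S / r)).
    by apply: archi_boundP; rewrite divr_ge0// ltW.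
  exists k; rewrite ltr_pdivrMr ?exprn_gt0// mulrC -ltr_pdivrMr//.
  by rewrite (lt_le_trans Sk)// -natrX ler_nat ltnW// ltn_expl.
have [w1 w2] := wk k.
have ba_r : bk k - ak k < r.
  rewrite w1 (le_lt_trans _ kP)// ler_wpM2r ?invr_ge0 ?exprn_ge0//.
  by rewrite /S; lra.
have dc_r : dk k - ck k < r.
  rewrite w2 (le_lt_trans _ kP)// ler_wpM2r ?invr_ge0 ?exprn_ge0//.
  by rewrite /S; lra.
have Hk : closed_on (ak k, bk k, (ck k, dk k)) by rewrite -sE; exact: svalP (s k).
have := circulation_le Hk e0 rP (xP k) (yP k) ba_r dc_r.
rewrite -sE => /(le_trans (Jk k)); rewrite w1 w2 -mulrDl -/S.
have -> : (S / 2 ^+ k) ^+ 2 = S ^+ 2 / 4 ^+ k.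
  rewrite expr_div_n -!exprM mulnC exprM; congr (_ / _ ^+ k).
  by rewrite expr2; ring.
rewrite mulrA ler_pM2r ?invr_gt0 ?exprn_gt0//.
have := divfK (lt0r_neq0 S20) eta; set q := eta / _ in e0 *.
have := sqr_ge0 S; nra.
Qed.

End goursat.

(** * Complex integrals on the unit interval *)

Section complex_integral.
Context {R : realType}.
Local Notation nc := (@Normc.normc R).
Local Notation mu := (@lebesgue_measure R).
Local Notation I01 := (`[(0 : R), (1 : R)]%classic).
Implicit Types (h g : R -> C R) (z : C R).

(** Bounded measurable functions rather than continuous ones: the integrand of [Tg] takes a default
    value at t = 0, and derivatives in a parameter will appear as pointwise limits. *)
Definition bmeas h := [/\ measurable_fun I01 (fun t => complex.Re (h t)),
  measurable_fun I01 (fun t => complex.Im (h t)) &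
  exists M : R, forall t, 0 <= t <= 1 -> nc (h t) <= M].

Lemma bounded01_integrable (f : R -> R) (M : R) : measurable_fun I01 f ->
  (forall t, 0 <= t <= 1 -> `|f t| <= M) -> mu.-integrable I01 (EFin \o f).
Proof.
move=> mf fM; apply: measurable_bounded_integrable => //.
  by rewrite /= lebesgue_measure_itv/= lte_fin ltr01 oppr0 adde0 ltry.
exists M; split; first exact: num_real.
by move=> x Mx t; rewrite /= in_itv/= => /fM /le_trans; apply; exact: ltW.
Qed.

Lemma bmeas_Re h : bmeas h -> mu.-integrable I01 (EFin \o (fun t => complex.Re (h t))).
Proof.
move=> [mr _ [M hM]]; apply: (@bounded01_integrable _ M) => // t /hM.
by apply: le_trans; exact: nc_Re.
Qed.

Lemma bmeas_Im h : bmeas h -> mu.-integrable I01 (EFin \o (fun t => complex.Im (h t))).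
Proof.
move=> [_ mr [M hM]]; apply: (@bounded01_integrable _ M) => // t /hM.
by apply: le_trans; exact: nc_Im.
Qed.

Lemma bmeasD h g : bmeas h -> bmeas g -> bmeas (fun t => h t + g t).
Proof.
move=> [h1 h2 [M hM]] [g1 g2 [N gN]]; split.
- apply: (eq_measurable_fun (fun t => complex.Re (h t) + complex.Re (g t))).
    by move=> t _; rewrite ReD.
  exact: measurable_funD.
- apply: (eq_measurable_fun (fun t => complex.Im (h t) + complex.Im (g t))).
    by move=> t _; rewrite ImD.
  exact: measurable_funD.
- by exists (M + N) => t t01; rewrite (le_trans (ncD _ _))// lerD ?hM ?gN.
Qed.

Lemma bmeasM h g : bmeas h -> bmeas g -> bmeas (fun t => h t * g t).
Proof.
move=> [h1 h2 [M hM]] [g1 g2 [N gN]]; split.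
- apply: (eq_measurable_fun (fun t => complex.Re (h t) * complex.Re (g t) -
    complex.Im (h t) * complex.Im (g t))); first by move=> t _; rewrite ReM.
  by apply: measurable_funB; exact: measurable_funM.
- apply: (eq_measurable_fun (fun t => complex.Re (h t) * complex.Im (g t) +
    complex.Im (h t) * complex.Re (g t))); first by move=> t _; rewrite ImM.
  by apply: measurable_funD; exact: measurable_funM.
- by exists (M * N) => t t01; rewrite ncM ler_pM ?nc_ge0 ?hM ?gN.
Qed.

Lemma bmeas_cst z : bmeas (fun=> z).
Proof. by split => //; exists (nc z). Qed.

Lemma bmeasZ z h : bmeas h -> bmeas (fun t => z * h t).
Proof. exact: bmeasM (bmeas_cst z). Qed.

Lemma bmeasB h g : bmeas h -> bmeas g -> bmeas (fun t => h t - g t).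
Proof.
move=> bh bg; rewrite (_ : (fun _ => _) = fun t => h t + (-1) * g t).
  by apply: bmeasD => //; exact: bmeasZ.
by apply/funext => t; rewrite mulN1r.
Qed.

Lemma bmeas_sum n (F : 'I_n -> R -> C R) :
  (forall i, bmeas (F i)) -> bmeas (fun t => \sum_(i < n) F i t).
Proof.
elim: n F => [F _|n IH F bF].
  rewrite (_ : (fun _ => _) = fun=> 0); first exact: bmeas_cst.
  by apply/funext => t; rewrite big_ord0.
rewrite (_ : (fun _ => _) = fun t => \sum_(i < n) F (widen_ord (leqnSn n) i) t +
  F ord_max t); first by apply: bmeasD => //; apply: IH.
by apply/funext => t; rewrite big_ord_recr.
Qed.

Lemma Re_IC h : complex.Re (integralC01 h) = Rintegral mu I01 (fun t => complex.Re (h t)).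
Proof. by []. Qed.

Lemma Im_IC h : complex.Im (integralC01 h) = Rintegral mu I01 (fun t => complex.Im (h t)).
Proof. by []. Qed.

Lemma eq_ReIm (z w : C R) : complex.Re z = complex.Re w ->
  complex.Im z = complex.Im w -> z = w.
Proof. by case: z w => [? ?] [? ?] /= -> ->. Qed.

Lemma eq_IC h g : (forall t, 0 <= t <= 1 -> h t = g t) ->
  integralC01 h = integralC01 g.
Proof.
move=> hg; apply: eq_ReIm; rewrite ?Re_IC ?Im_IC; apply: eq_Rintegral => t;
  by rewrite inE/= in_itv/= => /hg ->.
Qed.

Lemma ICD h g : bmeas h -> bmeas g ->
  integralC01 (fun t => h t + g t) = integralC01 h + integralC01 g.
Proof.
move=> bh bg; apply: eq_ReIm.
- rewrite ReD !Re_IC -RintegralD//; [|exact: bmeas_Re|exact: bmeas_Re].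
  by apply: eq_Rintegral => t _; rewrite ReD.
- rewrite ImD !Im_IC -RintegralD//; [|exact: bmeas_Im|exact: bmeas_Im].
  by apply: eq_Rintegral => t _; rewrite ImD.
Qed.

Lemma ICZ z h : bmeas h -> integralC01 (fun t => z * h t) = z * integralC01 h.
Proof.
move=> bh; have [iR iI] := (bmeas_Re bh, bmeas_Im bh); apply: eq_ReIm.
- rewrite ReM !Re_IC !Im_IC -!RintegralZl// -RintegralB//.
  + by apply: eq_Rintegral => t _; rewrite ReM.
  + exact: (@integrableZl _ _ _ mu _ _ (complex.Re z) _ iR).
  + exact: (@integrableZl _ _ _ mu _ _ (complex.Im z) _ iI).
- rewrite ImM !Re_IC !Im_IC -!RintegralZl// -RintegralD//.
  + by apply: eq_Rintegral => t _; rewrite ImM.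
  + exact: (@integrableZl _ _ _ mu _ _ (complex.Re z) _ iI).
  + exact: (@integrableZl _ _ _ mu _ _ (complex.Im z) _ iR).
Qed.

Lemma ICB h g : bmeas h -> bmeas g ->
  integralC01 (fun t => h t - g t) = integralC01 h - integralC01 g.
Proof.
move=> bh bg; rewrite (_ : (fun _ => _) = fun t => h t + (-1) * g t).
  by rewrite ICD ?ICZ ?mulN1r//; exact: bmeasZ.
by apply/funext => t; rewrite mulN1r.
Qed.

Lemma IC_sum n (F : 'I_n -> R -> C R) : (forall i, bmeas (F i)) ->
  integralC01 (fun t => \sum_(i < n) F i t) = \sum_(i < n) integralC01 (F i).
Proof.
elim: n F => [F _|n IH F bF].
  rewrite big_ord0 (@eq_IC _ (fun=> 0)) => [|t _]; last by rewrite big_ord0.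
  by apply: eq_ReIm; rewrite ?Re_IC ?Im_IC Rintegral_cst// mul0r.
rewrite (@eq_IC _ (fun t => \sum_(i < n) F (widen_ord (leqnSn n) i) t +
  F ord_max t)) => [|t _]; last by rewrite big_ord_recr.
by rewrite ICD ?IH ?big_ord_recr//; exact: bmeas_sum.
Qed.

Lemma conjc_mul z : conjc z * z = ((nc z ^+ 2)%:C)%C.
Proof.
rewrite nc_sqr; case: z => a b; apply: eq_ReIm; rewrite !(ReM, ImM)/=; ring.
Qed.

Lemma lebesgue01 : fine (mu I01) = 1.
Proof. by rewrite lebesgue_measure_itv/= lte_fin ltr01/= oppr0 addr0. Qed.

Lemma IC_cst z : integralC01 (fun=> z) = z.
Proof.
by apply: eq_ReIm; rewrite ?Re_IC ?Im_IC Rintegral_cst// lebesgue01 mulr1.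
Qed.

(** Multiplication by the unimodular u = conj(w) / |w| makes the integral w equal to its modulus,
    and the real inequality Re(u h) <= |h| <= f is then integrated. *)
Lemma nc_IC_le_int h (f : R -> R) : bmeas h ->
  mu.-integrable I01 (EFin \o f) ->
  (forall t, 0 <= t <= 1 -> nc (h t) <= f t) ->
  nc (integralC01 h) <= Rintegral mu I01 f.
Proof.
move=> bh fi hf; set w := integralC01 h.
have [w0|w0] := eqVneq w 0.
  rewrite w0 nc0; apply: Rintegral_ge0 => t /=; rewrite in_itv/= => /hf.
  by apply: le_trans; exact: nc_ge0.
pose u : C R := (conjc w * ((nc w)^-1%:C)%C).
have ncw : 0 < nc w by rewrite nc_gt0.
have uw : u * w = ((nc w)%:C)%C.
  by rewrite /u mulrAC conjc_mul -rmorphM/= expr2 mulfK// gt_eqF.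
have nu : nc u = 1.
  have := congr1 nc uw; rewrite ncM ncR gtr0_norm// => H.
  by apply: (mulIf (lt0r_neq0 ncw)); rewrite mul1r.
have -> : nc w = complex.Re (integralC01 (fun t => u * h t)).
  by rewrite ICZ// -/w uw.
rewrite Re_IC; apply: le_Rintegral => //; first exact: bmeas_Re (bmeasZ u bh).
move=> t; rewrite /= in_itv/= => /hf; apply: le_trans.
by rewrite (le_trans (ler_norm _))// (le_trans (nc_Re _))// ncM nu mul1r.
Qed.

Lemma nc_IC_le h M : bmeas h -> (forall t, 0 <= t <= 1 -> nc (h t) <= M) ->
  nc (integralC01 h) <= M.
Proof.
move=> bh hM; rewrite -[leRHS]mulr1 -lebesgue01 -Rintegral_cst//.
by apply: nc_IC_le_int => //; apply: (@bounded01_integrable _ `|M|).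
Qed.

Definition ccont h t := forall e : R, 0 < e ->
  exists2 d : R, 0 < d & forall s, `|s| < d -> nc (h (t + s) - h t) <= e.

Lemma ccont_ReIm h t : ccont h t ->
  {for t, continuous (fun t => complex.Re (h t))} /\
  {for t, continuous (fun t => complex.Im (h t))}.
Proof.
move=> H; split; apply: real_contP => e /H[d d0 dP]; exists d => // s /dP;
  by apply: le_trans; rewrite -?ReB -?ImB ?nc_Re ?nc_Im.
Qed.

Lemma ccont_bmeas h : (forall t, 0 <= t <= 1 -> ccont h t) -> bmeas h.
Proof.
move=> H.
have cR : ctson 0 1 (fun t => complex.Re (h t)).
  by move=> t t0 t1; apply: (ccont_ReIm (H t _)).1; rewrite t0.
have cI : ctson 0 1 (fun t => complex.Im (h t)).
  by move=> t t0 t1; apply: (ccont_ReIm (H t _)).2; rewrite t0.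
have bd f : ctson 0 1 f -> exists M : R, forall t, 0 <= t <= 1 -> `|f t| <= M.
  move=> cf; have cf' : {within I01, continuous (fun t : R => `|f t|)}.
    apply: ctson_within => t t0 t1; apply: cvg_norm; exact: cf.
  have [c c01 cP] := EVT_max ler01 cf'.
  by exists `|f c| => t t01; apply: cP; rewrite in_itv.
have [M MP] := bd _ cR; have [N NP] := bd _ cI.
split.
- by apply: subspace_continuous_measurable_fun => //; exact: ctson_within.
- by apply: subspace_continuous_measurable_fun => //; exact: ctson_within.
- exists (M + N) => t t01; rewrite (le_trans (nc_le_ReIm _))//.
  by rewrite lerD ?MP ?NP.
Qed.

End complex_integral.

(** * The complex exponential *)

Section complex_exponential.
Context {R : realType}.
Local Notation nc := (@Normc.normc R).

Lemma is_derive_eps (f : R -> R) (x d : R) : is_derive x 1 f d ->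
  forall e : R, 0 < e -> exists2 r : R, 0 < r & forall h, `|h| < r ->
    `|f (x + h) - f x - d * h| <= e * `|h|.
Proof.
move=> df e e0; have dv := @derive_val _ _ _ _ _ _ _ df.
have := @ex_derive _ _ _ _ _ _ _ df.
move=> /cvg_ex[l /= Hl].
have ld : l = d by rewrite -dv /derive; exact/esym/cvg_lim.
move/cvgrPdist_le : Hl => /(_ e e0); rewrite ld near_withinE => /nbhs_normP[r /= r0 rP].
exists r => // h hr; have [->|h0] := eqVneq h 0.
  by rewrite addr0 mulr0 subr0 subrr normr0 mulr0.
have := rP h; rewrite /ball_/= sub0r normrN => /(_ hr h0).
have -> : h^-1 *: (f (h *: 1 + x) - f x) = (f (x + h) - f x) / h.
  by rewrite [_ *: 1]mulr1 [h + x]addrC [_ *: _]mulrC.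
move=> H; rewrite (_ : _ - d * h = - ((d - (f (x + h) - f x) / h) * h)).
  by rewrite normrN normrM ler_wpM2r.
by field.
Qed.

Definition cexp (w : C R) : C R :=
  ((expR (complex.Re w) * cos (complex.Im w)) +i*
   (expR (complex.Re w) * sin (complex.Im w)))%C.

Lemma cexp0 : cexp 0 = 1.
Proof. by rewrite /cexp/= expR0 cos0 sin0 mul1r mul1r. Qed.

Lemma cexpD z w : cexp (z + w) = cexp z * cexp w.
Proof.
apply: eq_ReIm; rewrite ?ReM ?ImM /cexp/= ReD ImD expRD ?cosD ?sinD; ring.
Qed.

Lemma nc_cexp w : nc (cexp w) = expR (complex.Re w).
Proof.
by rewrite /= !exprMn -mulrDr cos2Dsin2 mulr1 sqrtr_sqr ger0_norm// expR_ge0.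
Qed.

Lemma cdiff_cexp w : cdiff cexp w (cexp w).
Proof.
suff H0 : cdiff cexp 0 1.
  move=> e e0.
  have [r r0 rP] := H0 (e / nc (cexp w)) ltac:(by rewrite divr_gt0// nc_cexp expR_gt0).
  exists r => // h hr; have := rP h hr; rewrite add0r cexp0 cexpD mulr1.
  rewrite mulrAC ler_pdivlMr ?nc_cexp ?expR_gt0// -nc_cexp -ncM.
  by apply: le_trans; rewrite le_eqVlt; apply/orP; left; apply/eqP; congr nc; ring.
(* The errors of the real and imaginary parts will be 3 e' |h| and 4 e' |h|, in total below 8 e'
   |h|; e' <= 1 / 2 also gives |exp x| <= 2. *)
move=> e e0; pose e' := Num.min (e / 8) (1 / 2).
have e'0 : 0 < e' by rewrite lt_min; apply/andP; split; lra.
have e'8 : e' <= e / 8 by rewrite ge_min lexx.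
have e'1 : e' <= 1 / 2 by rewrite ge_min lexx orbT.
clearbody e'.
have [r1 r10 H1] := is_derive_eps (is_derive_expR 0) e'0.
have [r2 r20 H2] := is_derive_eps (is_derive_cos 0) e'0.
have [r3 r30 H3] := is_derive_eps (is_derive_sin 0) e'0.
exists (Num.min (Num.min r1 r2) (Num.min r3 e')).
  by rewrite !lt_min r10 r20 r30 e'0.
move=> [x y]; set h := (x +i* y)%C; rewrite !lt_min.
move=> /andP[/andP[hr1 hr2] /andP[hr3 he]].
have hx := nc_Re h; have hy := nc_Im h; rewrite /= in hx hy.
have := H1 x (le_lt_trans hx hr1); have := H2 y (le_lt_trans hy hr2).
have := H3 y (le_lt_trans hy hr3).
rewrite !add0r expR0 sin0 cos0 oppr0 !mul0r !mul1r !subr0 ?addr0 => s3 s2 s1.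
set N := nc h in hx hy he *; have N0 : 0 <= N by exact: nc_ge0.
set E := expR x in s1 *; set c := cos y in s2 *; set s := sin y in s3 *.
have xe : `|x| <= e' by rewrite (le_trans hx)// ltW.
have t1 : `|E - 1| <= 2 * `|x|.
  rewrite (_ : E - 1 = E - 1 - x + x); last by ring.
  rewrite (le_trans (ler_normD _ _))// mulrDl mul1r lerD2r (le_trans s1)//.
  by rewrite ler_piMl//; lra.
have E2 : `|E| <= 2.
  rewrite (_ : E = E - 1 + 1); last by ring.
  by rewrite (le_trans (ler_normD _ _))// normr1; lra.
have q1 : `|E * c - 1 - x| <= 3 * e' * N.
  rewrite (_ : _ - x = E * (c - 1) + (E - 1 - x)); last by ring.
  rewrite (le_trans (ler_normD _ _))// normrM.
  have : `|E| * `|c - 1| <= 2 * (e' * N).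
    by apply: ler_pM => //; rewrite (le_trans s2)// ler_wpM2l// ltW.
  have : `|E - 1 - x| <= e' * N by rewrite (le_trans s1)// ler_wpM2l// ltW.
  lra.
have q2 : `|E * s - y| <= 4 * e' * N.
  rewrite (_ : _ - y = E * (s - y) + (E - 1) * y); last by ring.
  rewrite (le_trans (ler_normD _ _))// !normrM.
  have : `|E| * `|s - y| <= 2 * (e' * N).
    by apply: ler_pM => //; rewrite (le_trans s3)// ler_wpM2l// ltW.
  have : `|E - 1| * `|y| <= (2 * e') * N by apply: ler_pM => //; lra.
  lra.
have k1 : e' * N <= e / 8 * N by rewrite ler_wpM2r.
have k2 : 0 <= e * N by rewrite mulr_ge0// ltW.
rewrite cexp0 mulr1 (le_trans (nc_le_ReIm _))// !ReB !ImB.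
rewrite -[complex.Re (cexp h)]/(E * c) -[complex.Im (cexp h)]/(E * s).
rewrite -[complex.Re h]/x -[complex.Im h]/y -[complex.Re 1]/(1 : R).
rewrite -[complex.Im 1]/(0 : R) subr0; lra.
Qed.

(** Normalized to period 1, so that circles are parametrized by the interval of [integralC01]. *)
Definition cis (t : R) : C R := cexp (0 +i* (2 * pi * t))%C.

Lemma nc_cis t : nc (cis t) = 1.
Proof. by rewrite nc_cexp expR0. Qed.

Lemma cisN t : cis t * cis (- t) = 1.
Proof.
rewrite -cexpD -cexp0; congr cexp.
by apply: eq_ReIm; rewrite ?ReD ?ImD/= ?addr0// mulrN subrr.
Qed.

End complex_exponential.

(** * Cauchy's formula on a circle *)

Section cauchy.
Context {R : realType}.
Local Notation nc := (@Normc.normc R).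
Implicit Types (k h : C R -> C R) (a l : C R).

(** Cauchy-Riemann: with h = u + i v, the real and imaginary parts of h dz are u dx - v dy and v dx
    + u dy, and complex differentiability makes both closed. *)
Lemma cdiff_closed_at h x y d : cdiff h (x +i* y)%C d ->
  closed_at (fun s t => complex.Re (h (s +i* t)%C))
            (fun s t => - complex.Im (h (s +i* t)%C)) x y /\
  closed_at (fun s t => complex.Im (h (s +i* t)%C))
            (fun s t => complex.Re (h (s +i* t)%C)) x y.
Proof.
move=> H.
have key e : 0 < e -> exists2 r : R, 0 < r & forall p q, `|p| < r -> `|q| < r ->
  `|complex.Re (h ((x + p) +i* (y + q))%C) - complex.Re (h (x +i* y)%C)
    - (complex.Re d * p + - complex.Im d * q)| <= e * (`|p| + `|q|) /\
  `|complex.Im (h ((x + p) +i* (y + q))%C) - complex.Im (h (x +i* y)%C)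
    - (complex.Im d * p + complex.Re d * q)| <= e * (`|p| + `|q|).
  move=> e0; have [r r0 rP] := H e e0.
  exists (r / 2) => [|p q pr qr]; first by rewrite divr_gt0.
  have npq : nc (p +i* q)%C <= `|p| + `|q| by exact: nc_le_ReIm.
  have := rP (p +i* q)%C; rewrite (le_lt_trans npq); last by lra.
  move=> /(_ isT) H1.
  have {}H1 := le_trans H1 (ler_wpM2l (ltW e0) npq).
  split.
  - apply: le_trans H1; apply: le_trans (nc_Re _); rewrite !ReB ReM/=.
    by rewrite le_eqVlt; apply/orP; left; apply/eqP; congr (`|_|); ring.
  - apply: le_trans H1; apply: le_trans (nc_Im _); rewrite !ImB ImM/=.
    by rewrite le_eqVlt; apply/orP; left; apply/eqP; congr (`|_|); ring.
split.
- exists (complex.Re d), (- complex.Im d), (- complex.Re d) => e e0.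
  have [r r0 rP] := key e e0; exists r => // p q pr qr.
  have [h1 h2] := rP p q pr qr; split; first exact: h1.
  by rewrite (_ : _ - _ = - (complex.Im (h ((x + p) +i* (y + q))%C) -
    complex.Im (h (x +i* y)%C) - (complex.Im d * p + complex.Re d * q)));
    [rewrite normrN|ring].
- exists (complex.Im d), (complex.Re d), (- complex.Im d) => e e0.
  have [r r0 rP] := key e e0; exists r => // p q pr qr.
  by have [h1 h2] := rP p q pr qr; split.
Qed.

Lemma cdiff_ccont h x y d : cdiff h (x +i* y)%C d ->
  ccont (fun t => h (x +i* t)%C) y.
Proof.
move=> H e e0; have [r r0 rP] := H 1 ltr01.
have K0 : 0 < nc d + 1 by rewrite ltr_wpDl// nc_ge0.
exists (Num.min r (e / (nc d + 1))); first by rewrite lt_min r0 divr_gt0.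
move=> s; rewrite lt_min => /andP[sr se].
have ns : nc (0 +i* s)%C = `|s| by rewrite /= expr0n/= add0r sqrtr_sqr.
have := rP (0 +i* s)%C; rewrite ns => /(_ sr).
have -> : (x +i* y)%C + (0 +i* s)%C = (x +i* (y + s))%C :> C R.
  by apply: eq_ReIm; rewrite ?ReD ?ImD/= ?addr0.
move=> H1; rewrite -[X in nc X](subrK ((0 +i* s)%C * d)).
rewrite (le_trans (ncD _ _))// ncM ns (le_trans (lerD H1 (lexx _)))//.
by rewrite mul1r -[X in X + _]mulr1 -mulrDr addrC -ler_pdivlMr// ltW.
Qed.

(** Goursat for Im(h dz) on [s0, s1] x [0, 1]: periodicity cancels the horizontal sides, and the
    vertical ones are the two means of Re h. *)
Let periodic_mean_Re h (s0 s1 : R) : s0 <= s1 ->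
  (forall s t, s <= s1 -> differentiable h ((s +i* t)%C : C R)) ->
  (forall s, h (s +i* 1)%C = h (s +i* 0)%C) ->
  complex.Re (integralC01 (fun t => h (s0 +i* t)%C)) =
  complex.Re (integralC01 (fun t => h (s1 +i* t)%C)).
Proof.
move=> s01 dh per.
have cl s t : s0 <= s <= s1 -> 0 <= t <= 1 -> exists d, cdiff h (s +i* t)%C d.
  by move=> /andP[_ ss] _; eexists; apply: differentiable_cdiff; exact: dh.
have := @goursat R (fun s t => complex.Im (h (s +i* t)%C))
    (fun s t => complex.Re (h (s +i* t)%C)) s0 s1 0 1.
rewrite /circulation.
have -> : (fun s => complex.Im (h (s +i* 1)%C)) = (fun s => complex.Im (h (s +i* 0)%C)).
  by apply/funext => s; rewrite per.
move=> H; apply/eqP; rewrite eq_sym -subr_eq0; apply/eqP.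
rewrite -[RHS]H; first by rewrite /itvint !Re_IC; ring.
by split => // s t ss tt; have [d /cdiff_closed_at[]] := cl s t ss tt.
Qed.

Lemma periodic_mean h (s0 s1 : R) : s0 <= s1 ->
  (forall s t, s <= s1 -> differentiable h ((s +i* t)%C : C R)) ->
  (forall s, h (s +i* 1)%C = h (s +i* 0)%C) ->
  integralC01 (fun t => h (s0 +i* t)%C) = integralC01 (fun t => h (s1 +i* t)%C).
Proof.
move=> s01 dh per; apply: eq_ReIm; first exact: periodic_mean_Re.
have bh s : s <= s1 -> bmeas (fun t => h (s +i* t)%C).
  move=> ss; apply: ccont_bmeas => t _.
  exact: (cdiff_ccont (differentiable_cdiff (dh s t ss))).
(* This is -i, chosen because Re(-i w) = Im w: the result for real parts, applied to -i h, gives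
   imaginary parts. *)
pose i : C R := (0 +i* (-1))%C.
have Ei z : complex.Re (i * z) = complex.Im z by rewrite ReM/=; ring.
have dih s t : s <= s1 -> differentiable (fun w => i * h w) ((s +i* t)%C : C R).
  by move=> ss; exact: (differentiableZ i (dh s t ss)).
have := periodic_mean_Re s01 dih (fun s => congr1 ( *%R i) (per s)).
by rewrite !ICZ; [rewrite !Ei|exact: bh|exact: bh].
Qed.

Lemma cexp_2pi (s : R) : cexp (s +i* (2 * pi))%C = cexp (s +i* 0)%C.
Proof.
by rewrite /cexp/= cos0 sin0 mulr_natl -[_ *+ 2]add0r cosD2pi sinD2pi cos0 sin0.
Qed.

Lemma differentiable_cexp_lin (c w : C R) : differentiable (fun w => cexp (c * w)) w.
Proof.
apply: (@differentiable_comp _ _ _ _ (fun w => c * w) cexp).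
  exact: (@differentiableZ (C R) (C R) (C R) idfun c w).
exact: cdiff_differentiable (cdiff_cexp _).
Qed.

Lemma differentiable_circle_map k (a r c w : C R) :
  differentiable k (a + r * cexp (c * w)) ->
  differentiable (fun w => k (a + r * cexp (c * w))) w.
Proof.
move=> dk.
have dl : differentiable (fun w : C R => a + r * cexp (c * w)) w.
  apply: differentiableD; first exact: differentiable_cst.
  exact: (differentiableZ r (differentiable_cexp_lin c w)).
exact: (differentiable_comp dl dk).
Qed.

Lemma differentiable_ccont k a (r t : R) : 0 < r ->
  differentiable k (a + (r%:C)%C * cis t) ->
  ccont (fun t => k (a + (r%:C)%C * cis t)) t.
Proof.
move=> r0 dk.
pose c : C R := ((2 * pi)%:C)%C.
have E x : cexp (c * (0 +i* x)%C) = cis x.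
  by congr cexp; apply: eq_ReIm; rewrite ?ReM ?ImM/=; ring.
have dh := @differentiable_circle_map k a (r%:C)%C c (0 +i* t)%C.
rewrite E in dh.
have := cdiff_ccont (differentiable_cdiff (dh dk)).
by under [X in ccont X]eq_fun do rewrite E.
Qed.

(* With the substitution l = a + r exp(2 pi (s + i t)) the difference quotient becomes a periodic holomorphic function of s + i t; let s tend to -oo. *)
Lemma cauchy_circle k a (r : R) : 0 < r ->
  (forall l, nc (l - a) <= r -> differentiable k l) ->
  integralC01 (fun t => (k (a + (r%:C)%C * cis t) - k a) * cis (- t)) =
  (r%:C)%C * 'd k a 1.
Proof.
move=> r0 dk; set D := 'd k a 1.
have Dk : cdiff k a D by apply/differentiable_cdiff/dk; rewrite subrr nc0 ltW.
pose c : C R := ((2 * pi)%:C)%C.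
pose h w := (k (a + (r%:C)%C * cexp (c * w)) - k a) * cexp (- c * w).
have Ec s t : c * (s +i* t)%C = ((2 * pi * s) +i* (2 * pi * t))%C.
  by apply: eq_ReIm; rewrite ?ReM ?ImM/=; ring.
have Ecn s t : - c * (s +i* t)%C = ((2 * pi * - s) +i* (2 * pi * - t))%C.
  by apply: eq_ReIm; rewrite ?ReM ?ImM/= ?oppr0; ring.
have Es s t : cexp ((2 * pi * s) +i* (2 * pi * t))%C = ((expR (2 * pi * s))%:C)%C * cis t.
  by apply: eq_ReIm; rewrite ?ReM ?ImM/= ?expR0; ring.
have pi0 : 0 < 2 * pi :> R by rewrite mulr_gt0// pi_gt0.
have dh s t : s <= 0 -> differentiable h ((s +i* t)%C : C R).
  move=> s0; apply: differentiableM; last exact: differentiable_cexp_lin.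
  apply: differentiableB; last exact: differentiable_cst.
  apply: differentiable_circle_map.
  apply: dk; rewrite [_ + _ - _]addrAC subrr add0r ncM ncR gtr0_norm// nc_cexp.
  by rewrite ler_piMr ?(ltW r0)// Ec/= -[leRHS]expR0 ler_expR pmulr_rle0.
have per s : h (s +i* 1)%C = h (s +i* 0)%C.
  rewrite /h !Ec !Ecn !mulr1 !mulr0 cexp_2pi; congr (_ * _).
  by rewrite /cexp/= mulrN1 oppr0 mulr0 cosN sinN -[2 * pi]add0r mulr_natl
    cosD2pi sinD2pi cos0 sin0 oppr0.
have hE s t : h (s +i* t)%C = (k (a + ((r * expR (2 * pi * s))%:C)%C * cis t) - k a) *
    (((expR (2 * pi * s))^-1%:C)%C * cis (- t)).
  by rewrite /h Ec Ecn !Es rmorphM/= mulrA mulrN expRN.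
have -> : (fun t => (k (a + (r%:C)%C * cis t) - k a) * cis (- t)) =
    (fun t => h (0 +i* t)%C).
  by apply/funext => t; rewrite hE mulr0 expR0 mulr1 invr1 mul1r.
apply/eqP; rewrite -subr_eq0 -nc_eq0 eq_le nc_ge0 andbT.
apply/ler_addgt0Pr => e e0; rewrite add0r.
have [d d0 dP] := Dk (e / r) ltac:(by rewrite divr_gt0).
(* Far enough to the left the circle has radius rho <= d / 2, where the difference quotient is
   within e / r of D. *)
pose s0 := Num.min 0 (ln (d / (2 * r)) / (2 * pi)).
have s00 : s0 <= 0 by rewrite ge_min lexx.
have bh : bmeas (fun t => h (s0 +i* t)%C).
  apply: ccont_bmeas => t _.
  exact: (cdiff_ccont (differentiable_cdiff (dh s0 t s00))).
rewrite -(periodic_mean s00 dh per) -[X in _ - X]IC_cst -ICB//; last exact: bmeas_cst.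
apply: nc_IC_le => [|t _]; first by apply: bmeasB => //; exact: bmeas_cst.
set rho := r * expR (2 * pi * s0).
have rho0 : 0 < rho by rewrite mulr_gt0// expR_gt0.
have rhod : rho < d.
  apply: (@le_lt_trans _ _ (r * (d / (2 * r)))).
    rewrite ler_wpM2l ?(ltW r0)// -[leRHS]lnK ?posrE ?divr_gt0 ?mulr_gt0// ler_expR.
    by rewrite mulrC -ler_pdivlMr// ge_min lexx orbT.
  rewrite (_ : r * _ = d / 2); first lra.
  by field; rewrite gt_eqF.
have := dP ((rho%:C)%C * cis t).
rewrite ncM nc_cis ncR mulr1 gtr0_norm// => /(_ rhod) H.
rewrite hE -/rho.
rewrite (_ : _ - (r%:C)%C * D = (k (a + (rho%:C)%C * cis t) - k a - (rho%:C)%C * cis t * D) *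
    (((expR (2 * pi * s0))^-1%:C)%C * cis (- t))).
  rewrite !ncM nc_cis mulr1 ncR gtr0_norm ?invr_gt0 ?expR_gt0//.
  rewrite ler_pdivrMr ?expR_gt0// (le_trans H)//.
  by rewrite /rho mulrA divfK ?gt_eqF.
rewrite [RHS]mulrBl; congr (_ - _).
rewrite (_ : (rho%:C)%C * cis t * D * _ = (rho%:C)%C * ((expR (2 * pi * s0))^-1%:C)%C * D *
  (cis t * cis (- t))); last by ring.
rewrite cisN mulr1 -rmorphM/= /rho mulfK// gt_eqF// expR_gt0//.
Qed.

Lemma circle_mem a (r t : R) : 0 <= r -> nc (a + (r%:C)%C * cis t - a) = r.
Proof. by move=> r0; rewrite [_ + _ - _]addrAC subrr add0r ncM nc_cis ncR mulr1 ger0_norm. Qed.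

Lemma ccont_cis t : ccont (fun t : R => (cis (- t) : C R)) t.
Proof.
pose c : C R := ((- (2 * pi))%:C)%C.
have := @cdiff_ccont (fun w => cexp (c * w)) 0 t _
  (differentiable_cdiff (differentiable_cexp_lin c _)).
have -> // : (fun t0 => cexp (c * (0 +i* t0)%C)) = (fun t => cis (- t)).
apply/funext => x; congr cexp; apply: eq_ReIm; rewrite ?ReM ?ImM/=; ring.
Qed.

Lemma bmeas_circle k a (r : R) : 0 < r ->
  (forall l, nc (l - a) <= r -> differentiable k l) ->
  bmeas (fun t => k (a + (r%:C)%C * cis t)).
Proof.
move=> r0 dk; apply: ccont_bmeas => t _; apply: differentiable_ccont => //.
by apply: dk; rewrite circle_mem ?(ltW r0).
Qed.

Lemma bmeas_cisN : bmeas (fun t : R => cis (- t)).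
Proof. by apply: ccont_bmeas => t _; exact: ccont_cis. Qed.

(** The factor 2 comes from the difference k(l) - k(a) under the integral of [cauchy_circle]. *)
Lemma cauchy_estimate k a (r M : R) : 0 < r ->
  (forall l, nc (l - a) <= r -> differentiable k l) ->
  (forall l, nc (l - a) <= r -> nc (k l) <= M) ->
  nc ('d k a 1) <= 2 * M / r.
Proof.
move=> r0 dk kM; rewrite ler_pdivlMr// mulrC -{1}(gtr0_norm r0) -ncR -ncM.
rewrite -cauchy_circle//; apply: nc_IC_le.
  apply: bmeasM; last exact: bmeas_cisN.
  by apply: bmeasB; [exact: bmeas_circle|exact: bmeas_cst].
move=> t _; rewrite ncM nc_cis mulr1 (le_trans (ncD _ _))// ncN mulr_natl mulr2n.
by rewrite lerD// kM ?circle_mem ?subrr ?nc0// ltW.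
Qed.

(** [cauchy_circle] is applied to k(l) (l - a), which vanishes at a and has derivative k(a)
    there. *)
Lemma mean_value_circle k a (r : R) : 0 < r ->
  (forall l, nc (l - a) <= r -> differentiable k l) ->
  integralC01 (fun t => k (a + (r%:C)%C * cis t)) = k a.
Proof.
move=> r0 dk.
have dk' l : nc (l - a) <= r -> differentiable (fun l => k l * (l - a)) l.
  move=> lr; apply: differentiableM; first exact: dk.
  by apply: differentiableB => //; exact: differentiable_cst.
have da : nc (a - a) <= r by rewrite subrr nc0 ltW.
have D : 'd (fun l => k l * (l - a)) a 1 = k a.
  apply: (cdiff_unique (differentiable_cdiff (dk' a da))) => e e0.
  have [d d0 dP] := differentiable_cdiff (dk a da) (ltr01).
  set K := 'd k a 1 in dP.
  have K0 : 0 < nc K + 1 by rewrite ltr_wpDl// nc_ge0.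
  exists (Num.min d (e / (nc K + 1))); first by rewrite lt_min d0 divr_gt0.
  move=> h; rewrite lt_min => /andP[hd he].
  rewrite subrr mulr0 subr0 (_ : _ - _ = (k (a + h) - k a) * h); last by ring.
  rewrite ncM ler_wpM2r ?nc_ge0// -[X in nc X](subrK (h * K)) (le_trans (ncD _ _))//.
  rewrite (le_trans (lerD (dP h hd) (lexx _)))// ncM mul1r -[X in X + _]mulr1 -mulrDr.
  by rewrite addrC -ler_pdivlMr// ltW.
have := cauchy_circle r0 dk'; rewrite D => H.
have rC : (r%:C)%C != 0 by rewrite -nc_eq0 ncR normr_eq0 gt_eqF.
apply: (mulfI rC); rewrite -H -ICZ; last exact: bmeas_circle.
apply: eq_IC => t _; rewrite subrr mulr0 subr0 [a + _ - a]addrAC subrr add0r.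
by rewrite -[LHS]mulr1 -(cisN t); ring.
Qed.

End cauchy.

(** * Compactness of closed balls and boundedness of holomorphic functions *)

Section compactness.
Context {R : realType}.
Local Notation nc := (@Normc.normc R).

Lemma pair_complex_continuous :
  continuous (fun p : R * R => (p.1 +i* p.2)%C : C R).
Proof.
move=> p; apply/(@cvgrPdist_le _ _ _ (nbhs p) (nbhs_filter p)) => e e0.
have /andP[/eqP Ime Ree] : (complex.Im e == 0) && (0 < complex.Re e).
  by move: e0; rewrite ltcE /=.
have -> : e = ((complex.Re e)%:C)%C by rewrite RRe_real// realE (ltW e0).
have e2 : 0 < complex.Re e / 2 by rewrite divr_gt0.
have H1 : \forall q \near p, `|p.1 - q.1| < complex.Re e / 2.
  have H : (fun q : R * R => q.1) @ p --> p.1 by case: (p) => ? ?; exact: cvg_fst.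
  exact: ((@cvgrPdist_lt _ _ _ _ _ _ _).1 H _ e2).
have H2 : \forall q \near p, `|p.2 - q.2| < complex.Re e / 2.
  have H : (fun q : R * R => q.2) @ p --> p.2 by case: (p) => ? ?; exact: cvg_snd.
  exact: ((@cvgrPdist_lt _ _ _ _ _ _ _).1 H _ e2).
near=> q.
rewrite normC_nc lecR (le_trans (nc_le_ReIm _))// ReB ImB/= (splitr (complex.Re e)).
by apply: lerD; apply: ltW; near: q.
Unshelve. all: by end_near. Qed.

Lemma norm2_continuous n : continuous (@norm2 R n).
Proof.
move=> x; apply/(@cvgrPdist_le _ _ _ (nbhs x) (nbhs_filter x)) => e e0.
apply/near_norm2; exists e => // y xy.
have := norm2D (x - y) y; have := norm2D (y - x) x; rewrite !subrK [norm2 (x - y)]norm2B.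
by rewrite ler_norml => h1 h2; apply/andP; split; lra.
Qed.

Lemma compact_ball n (r : R) : compact [set z : 'rV[C R]_n | norm2 z <= r].
Proof.
pose A : set (C R) := [set (p.1 +i* p.2)%C | p in (`[- r, r] `*` `[- r, r])%classic].
have cA : compact A.
  apply: continuous_compact.
    exact: continuous_subspaceT pair_complex_continuous.
  by apply: compact_setX; exact: segment_compact.
apply: (subclosed_compact _ (@rV_compact _ n (fun=> A) (fun=> cA))).
  rewrite [X in closed X](_ : _ = (@norm2 R n) @^-1` [set x : R | x <= r])//.
  by apply: closed_comp; [move=> ? _; exact: norm2_continuous|exact: closed_le].
move=> z /= zr i; exists (complex.Re (z 0 i), complex.Im (z 0 i)); last first.
  by case: (z 0 i).
have zi := le_trans (norm2_coord z i) zr.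
have h1 := le_trans (nc_Re _) zi; have h2 := le_trans (nc_Im _) zi.
by split; rewrite /= in_itv/=; rewrite -ler_norml.
Qed.

Lemma holomorphic_bounded n (f : 'rV[C R]_n -> C R) (r : R) :
  (forall z, norm2 z <= r -> differentiable f z) ->
  exists2 M : R, 0 <= M & forall z, norm2 z <= r -> nc (f z) <= M.
Proof.
move=> df.
have [r0|r0] := ltP r 0.
  by exists 0 => // z; rewrite leNgt (lt_le_trans r0)// norm2_ge0.
have [c _ cP] : exists2 c, c \in [set z : 'rV[C R]_n | norm2 z <= r] &
    forall t, t \in [set z : 'rV[C R]_n | norm2 z <= r] -> nc (f t) <= nc (f c).
  apply: compact_EVT_max; [|exact: compact_ball|].
    by exists 0; rewrite /= norm20.
  apply: continuous_in_subspaceT => x; rewrite inE/= => xr.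
  apply/(@cvgrPdist_le _ _ _ (nbhs x) (nbhs_filter x)) => e e0.
  have := differentiable_continuous (df x xr).
  move/(@cvgrPdist_le _ _ _ (nbhs x) (nbhs_filter x)) => /(_ (e%:C)%C).
  rewrite ltcR => /(_ e0); apply: filterS => y; rewrite normC_nc lecR => H.
  have := ncD (f x - f y) (f y); have := ncD (f y - f x) (f x).
  rewrite !subrK [nc (f y - f x)]ncB ler_norml => h1 h2.
  by apply/andP; split; lra.
by exists (nc (f c)) => [|z zr]; [exact: nc_ge0|apply: cP; rewrite inE].
Qed.

End compactness.

(** * Mean value inequality and quadratic Taylor remainder in one variable *)

Section remainder.
Context {R : realType}.
Local Notation nc := (@Normc.normc R).
Implicit Types (k : C R -> C R) (l : C R).

Lemma cdiff_Re_derive k (a b c d : C R) (t : R) :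
  cdiff k (a + (t%:C)%C * b) d ->
  is_derive t 1 (fun t : R => complex.Re (c * k (a + (t%:C)%C * b)))
    (complex.Re (c * (b * d))).
Proof.
move=> H.
set f := (fun t : R => _).
suff cvgf : (h^-1 *: (f (h *: 1 + t) - f t)) @[h --> 0^'] --> complex.Re (c * (b * d)).
  have df : derivable f t 1 by apply/cvg_ex; eexists; exact: cvgf.
  by apply: DeriveDef => //; rewrite /derive; apply/cvg_lim.
apply/cvgrPdist_le => e e0; rewrite near_withinE.
have K0 : 0 < nc c * nc b + 1 by rewrite ltr_wpDl// mulr_ge0 ?nc_ge0.
have [r r0 rP] := H (e / (nc c * nc b + 1)) ltac:(by rewrite divr_gt0).
have b0 : 0 < nc b + 1 by rewrite ltr_wpDl// nc_ge0.
apply/nbhs_normP; exists (r / (nc b + 1)); first by rewrite /= divr_gt0.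
move=> h; rewrite /ball_/= sub0r normrN => hr h0.
have hb : nc ((h%:C)%C * b) < r.
  rewrite ncM ncR (@le_lt_trans _ _ (`|h| * (nc b + 1)))//.
    by rewrite ler_wpM2l// lerDl.
  by rewrite -ltr_pdivlMr.
have := rP _ hb.
have -> : a + (t%:C)%C * b + (h%:C)%C * b = a + ((h + t)%:C)%C * b.
  by rewrite rmorphD/=; ring.
set X := k _; set Y := k _ => HX.
have -> : h^-1 *: (f (h *: 1 + t) - f t) = (complex.Re (c * X) - complex.Re (c * Y)) / h.
  by rewrite [_ *: 1]mulr1 [_ *: _]mulrC.
have -> : complex.Re (c * (b * d)) - (complex.Re (c * X) - complex.Re (c * Y)) / h =
  - (complex.Re (c * (X - Y - (h%:C)%C * b * d))) / h.
  apply: (mulIf h0); rewrite mulrBl !divfK// -ReB -mulrBr.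
  have -> : complex.Re (c * (b * d)) * h = complex.Re (c * ((h%:C)%C * b * d)).
    have -> : c * ((h%:C)%C * b * d) = (h%:C)%C * (c * (b * d)) by ring.
    by rewrite [RHS]ReM/=; ring.
  by rewrite -ReB -ReN; congr complex.Re; ring.
rewrite normrM normrN normfV ler_pdivrMr ?normr_gt0// (le_trans (nc_Re _))//.
rewrite ncM (le_trans (ler_wpM2l (nc_ge0 _) HX))// ncM ncR.
rewrite [leLHS](_ : _ = e * `|h| * (nc c * nc b / (nc c * nc b + 1))); last first.
  by move: (nc c) (nc b) `|h| (lt0r_neq0 K0) => x y z K1; field.
by rewrite ler_piMr ?mulr_ge0 ?(ltW e0)// ler_pdivrMr// mul1r lerDl.
Qed.

(** With w = k(a + b) - k(a), the real mean value theorem is applied to t |-> Re(conj(w) k(a + t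
    b)), whose increment is |w|^2. *)
Lemma complex_mean_value k (a b : C R) (M : R) :
  (forall t : R, 0 <= t <= 1 -> differentiable k (a + (t%:C)%C * b)) ->
  (forall t : R, 0 <= t <= 1 -> nc ('d k (a + (t%:C)%C * b) 1) <= M) ->
  nc (k (a + b) - k a) <= M * nc b.
Proof.
move=> dk kM; set w := k (a + b) - k a.
have M0 : 0 <= M by apply: le_trans (kM 0 _); rewrite ?nc_ge0// lexx ler01.
have [->|w0] := eqVneq w 0; first by rewrite nc0 mulr_ge0 ?nc_ge0.
have ncw : 0 < nc w by rewrite nc_gt0.
pose f (t : R) := complex.Re (conjc w * k (a + (t%:C)%C * b)).
pose f' (t : R) := complex.Re (conjc w * (b * 'd k (a + (t%:C)%C * b) 1)).
have df (t : R) : 0 <= t <= 1 -> is_derive t 1 f (f' t).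
  by move=> t01; apply: cdiff_Re_derive; exact: (differentiable_cdiff (dk t t01)).
have [] := @MVT_segment R f f' 0 1 ler01.
- by move=> t; rewrite in_itv/= => /andP[/ltW t0 /ltW t1]; apply: df; rewrite t0.
- apply: derivable_within_continuous => t; rewrite in_itv/= => t01.
  by have [] := df t t01.
move=> c; rewrite in_itv/= => c01; rewrite subr0 mulr1 => E.
have E1 : f 1 - f 0 = nc w ^+ 2.
  by rewrite /f mul1r mul0r addr0 -ReB -mulrBr conjc_mul.
rewrite E1 in E.
have : nc w ^+ 2 <= nc w * (nc b * M).
  rewrite E (le_trans (ler_norm _))// (le_trans (nc_Re _))// !ncM.
  have -> : nc (conjc w) = nc w by case: (w) => x y /=; rewrite sqrrN.
  by rewrite ler_pM2l// ler_wpM2l ?nc_ge0// kM.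
by rewrite expr2 ler_pM2l// mulrC.
Qed.

Variables (k : C R -> C R) (r M : R).
Hypothesis r0 : 0 < r.
Hypothesis dk : forall l, nc l <= 3 * r -> differentiable k l.
Hypothesis kM : forall l, nc l <= 3 * r -> nc (k l) <= M.

Lemma deriv_bound l : nc l <= 2 * r -> nc ('d k l 1) <= 2 * M / r.
Proof.
move=> lr; have near3 l' : nc (l' - l) <= r -> nc l' <= 3 * r.
  by move=> ll; have := ncD (l' - l) l; rewrite subrK; lra.
by apply: cauchy_estimate => // l' /near3; [exact: dk|exact: kM].
Qed.

Lemma bound_ge0 : 0 <= M.
Proof. by apply: le_trans (kM (l := 0) _); rewrite ?nc_ge0// nc0 mulr_ge0 ?ltW. Qed.

Lemma lipschitz_bound l l' : nc l <= 2 * r -> nc l' <= 2 * r ->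
  nc (k l' - k l) <= 2 * M / r * nc (l' - l).
Proof.
move=> lr lr'.
have seg (t : R) : 0 <= t <= 1 -> nc (l + (t%:C)%C * (l' - l)) <= 2 * r.
  move=> /andP[t0 t1].
  have -> : l + (t%:C)%C * (l' - l) = ((1 - t)%:C)%C * l + (t%:C)%C * l'.
    by rewrite rmorphB/=; ring.
  rewrite (le_trans (ncD _ _))// !ncM !ncR !ger0_norm ?subr_ge0//; nra.
have H := @complex_mean_value k l (l' - l) (2 * M / r).
rewrite [l + (l' - l)]addrC subrK in H; apply: H.
- by move=> t /seg tr; apply: dk; move: r0; lra.
- by move=> t /seg tr; exact: deriv_bound.
Qed.

(** Cauchy's formula on the circles of radius r around l and l' writes r (k'(l') - k'(l)) as a mean
    of differences of k at points of the disc of radius 2 r, where [lipschitz_bound] holds. The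
    second derivative never appears. *)
Lemma deriv_lipschitz l l' : nc l <= r -> nc l' <= r ->
  nc ('d k l' 1 - 'd k l 1) <= 4 * M / r ^+ 2 * nc (l' - l).
Proof.
move=> lr lr'.
have near2 l1 l2 : nc l1 <= r -> nc (l2 - l1) <= r -> nc l2 <= 2 * r.
  by move=> h1 h2; have := ncD (l2 - l1) l1; rewrite subrK; move: r0; lra.
have c3 l1 : nc l1 <= r -> forall l2, nc (l2 - l1) <= r -> differentiable k l2.
  by move=> h1 l2 /(near2 _ _ h1) h2; apply: dk; move: r0; lra.
have bm l1 : nc l1 <= r -> bmeas (fun t => (k (l1 + (r%:C)%C * cis t) - k l1) * cis (- t)).
  move=> h1; apply: bmeasM; last exact: bmeas_cisN.
  by apply: bmeasB; [apply: bmeas_circle => //; exact: c3|exact: bmeas_cst].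
have rC : nc (r%:C)%C = r by rewrite ncR gtr0_norm.
rewrite -(ler_pM2l r0) -{1}rC -ncM.
have -> : (r%:C)%C * ('d k l' 1 - 'd k l 1) =
    integralC01 (fun t => (k (l' + (r%:C)%C * cis t) - k l') * cis (- t)) -
    integralC01 (fun t => (k (l + (r%:C)%C * cis t) - k l) * cis (- t)).
  by rewrite (cauchy_circle r0 (c3 _ lr)) (cauchy_circle r0 (c3 _ lr')) mulrBr.
rewrite -ICB; [|exact: bm|exact: bm].
apply: nc_IC_le => [|t _]; first by apply: bmeasB; exact: bm.
rewrite -mulrBl ncM nc_cis mulr1.
have -> : k (l' + (r%:C)%C * cis t) - k l' - (k (l + (r%:C)%C * cis t) - k l) =
  (k (l' + (r%:C)%C * cis t) - k (l + (r%:C)%C * cis t)) - (k l' - k l) by ring.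
rewrite (le_trans (ncD _ _))// ncN.
have cm l1 : nc l1 <= r -> nc (l1 + (r%:C)%C * cis t) <= 2 * r.
  by move=> h1; apply: (near2 l1) => //; rewrite circle_mem ?(ltW r0).
have h1 := lipschitz_bound (cm _ lr) (cm _ lr').
have h2 : nc (k l' - k l) <= 2 * M / r * nc (l' - l).
  by apply: lipschitz_bound; move: r0; lra.
rewrite [_ + _ - _](_ : _ = l' - l) in h1; last by ring.
rewrite (le_trans (lerD h1 h2))// le_eqVlt; apply/orP; left; apply/eqP.
by field; rewrite gt_eqF.
Qed.

Lemma cdiff_lipschitz l l' d d' : cdiff k l d -> cdiff k l' d' ->
  nc l <= r -> nc l' <= r -> nc (d' - d) <= 4 * M / r ^+ 2 * nc (l' - l).
Proof.
move=> dl dl' lr lr'.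
have d1 : differentiable k l by exact: cdiff_differentiable dl.
have d2 : differentiable k l' by exact: cdiff_differentiable dl'.
have E1 := cdiff_unique (differentiable_cdiff d1) dl.
have E2 := cdiff_unique (differentiable_cdiff d2) dl'.
by subst d d'; exact: deriv_lipschitz.
Qed.

(** The mean value inequality for k(l) - l k'(0), whose derivative along the segment from 0 is small
    by [deriv_lipschitz]. *)
Lemma quadratic_remainder l : nc l <= r ->
  nc (k l - k 0 - l * 'd k 0 1) <= 4 * M / r ^+ 2 * nc l ^+ 2.
Proof.
move=> lr; have n0 : nc 0 <= r by rewrite nc0 ltW.
have [D HD HL] : exists2 D, D = 'd k 0 1 &
    forall x : C R, nc x <= r -> nc ('d k x 1 - D) <= 4 * M / r ^+ 2 * nc x.
  exists ('d k 0 1) => // x xr.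
  have := deriv_lipschitz n0 xr; by rewrite [x - 0]subr0.
rewrite -HD {HD}.
have lin x : differentiable (fun l => l * D) x /\ cdiff (fun l => l * D) x D.
  suff H : cdiff (fun l => l * D) x D by split => //; exact: cdiff_differentiable H.
  move=> e e0; exists 1 => // h _.
  by rewrite mulrDl [x * D + _]addrC addrK subrr nc0 mulr_ge0 ?nc_ge0// ltW.
have seg (t : R) : 0 <= t <= 1 -> nc ((0 : C R) + (t%:C)%C * l) <= nc l.
  by move=> /andP[t0 t1]; rewrite add0r ncM ncR ger0_norm// ler_piMl ?nc_ge0//.
have dkt (t : R) : 0 <= t <= 1 -> differentiable k ((0 : C R) + (t%:C)%C * l).
  by move=> /seg H; apply: dk; move: r0; lra.
have := @complex_mean_value (fun l => k l - l * D) 0 l (4 * M / r ^+ 2 * nc l).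
rewrite add0r mul0r subr0 expr2 mulrA => H.
rewrite [k l - _ - _]addrAC; apply: H => t t01.
  by apply: differentiableB; [exact: dkt|exact: (lin _).1].
have -> : 'd (fun l => k l - l * D) ((0 : C R) + (t%:C)%C * l) 1 = 'd k ((0 : C R) + (t%:C)%C * l) 1 - D.
  have dx := dkt _ t01; move: ((0 : C R) + _) dx => x dx.
  apply: (@cdiff_unique _ (fun l => k l - l * D) x).
    by apply: differentiable_cdiff; apply: differentiableB => //; exact: (lin x).1.
  move=> e e0; have [d d0 dP] := differentiable_cdiff dx e0.
  exists d => // h hd; have := dP h hd; move: ('d k x 1) => E.
  rewrite (_ : k (x + h) - (x + h) * D - (k x - x * D) - h * (E - D) =
    k (x + h) - k x - h * E) //.
  by move: (k (x + h)) (k x) => u v; ring.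
apply: (le_trans (HL _ (le_trans (seg t t01) lr))).
apply: ler_wpM2l; last exact: seg.
by rewrite divr_ge0 ?exprn_ge0 ?mulr_ge0 ?bound_ge0// ltW.
Qed.

End remainder.

(** * Several complex variables *)

Section several_variables_cauchy.
Context {R : realType} {n : nat}.
Local Notation nc := (@Normc.normc R).
Local Notation Cn := 'rV[C R]_n.
Implicit Types (f : Cn -> C R) (z v h : Cn).

Definition grad f z : Cn := \row_(j < n) 'D_(delta_mx 0 j) f z.

Lemma radial_grad f z : radial f z = lform (grad f z) z.
Proof. exact: radialE. Qed.

Lemma norm2_eq0 z : norm2 z = 0 -> z = 0.
Proof.
move=> z0; apply/rowP => j; rewrite mxE; apply/eqP; rewrite -nc_eq0 eq_le nc_ge0.
by rewrite andbT -z0 norm2_coord.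
Qed.

Lemma norm2_slice z v (l : C R) : norm2 (z + l *: v - z) = nc l * norm2 v.
Proof. by rewrite addrAC subrr add0r norm2Z. Qed.

Lemma differentiable_slice f z v (l : C R) : differentiable f (z + l *: v) ->
  differentiable (fun l : C R => f (z + l *: v)) l.
Proof.
move=> df; have H := fdiff_slice v (differentiable_fdiff df).
apply: (@cdiff_differentiable _ _ _ (lform (grad f (z + l *: v)) v)) => e e0.
have [r r0 rP] := H e e0; exists r => // h hr; have := rP h hr.
by rewrite add0r scale0r addr0 scalerDl addrA.
Qed.

Lemma slice_deriv f z v (l : C R) : differentiable f (z + l *: v) ->
  'd (fun l : C R => f (z + l *: v)) l 1 = lform (grad f (z + l *: v)) v.
Proof.
move=> df; have H := fdiff_slice v (differentiable_fdiff df).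
apply: (cdiff_unique (differentiable_cdiff (differentiable_slice df))) => e e0.
have [r r0 rP] := H e e0; exists r => // h hr; have := rP h hr.
by rewrite add0r scale0r addr0 scalerDl addrA.
Qed.

Section one_function.
Variables (f : Cn -> C R) (z : Cn) (rho M : R).
Hypothesis rho0 : 0 < rho.
Hypothesis df : forall x, norm2 (x - z) < rho -> differentiable f x.
Hypothesis fM : forall x, norm2 (x - z) < rho -> nc (f x) <= M.

Lemma grad_le v (r : R) : 0 < r -> r * norm2 v < rho ->
  nc (lform (grad f z) v) <= 2 * M / r.
Proof.
move=> r0 rv.
have H (l : C R) : nc (l - 0) <= r -> norm2 (z + l *: v - z) < rho.
  rewrite subr0 norm2_slice => lr; apply: le_lt_trans rv.
  by rewrite ler_wpM2r ?norm2_ge0.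
have := @cauchy_estimate R (fun l : C R => f (z + l *: v)) 0 r M r0.
rewrite slice_deriv ?scale0r ?addr0; last first.
  by apply: df; rewrite subrr norm20.
apply; first by move=> l lr; apply: differentiable_slice; apply: df; exact: H.
by move=> l lr; apply: fM; exact: H.
Qed.

Lemma taylor1 h : norm2 h <= rho / 4 ->
  nc (f (z + h) - f z - lform (grad f z) h) <= 64 * M / rho ^+ 2 * norm2 h ^+ 2.
Proof.
move=> hr; have [h0|h0] := eqVneq (norm2 h) 0.
  by rewrite (norm2_eq0 h0) addr0 subrr linear0 subrr nc0 norm20 expr0n/= mulr0.
have hp : 0 < norm2 h by rewrite lt_def h0 norm2_ge0.
(* The slice is z + l h evaluated at l = 1. This r is at least 1, and 3 r |h| = 3 rho / 4 keeps the
   disc of radius 3 r inside the ball; 4 M / r^2 then produces the constant 64. *)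
pose r := rho / (4 * norm2 h).
have r0 : 0 < r by rewrite divr_gt0 ?mulr_gt0.
have r1 : 1 <= r by rewrite ler_pdivlMr ?mulr_gt0// mul1r mulrC -ler_pdivlMr.
have H (l : C R) : nc l <= 3 * r -> norm2 (z + l *: h - z) < rho.
  rewrite norm2_slice => lr.
  apply: (@le_lt_trans _ _ (3 * r * norm2 h)); first by rewrite ler_wpM2r ?norm2_ge0.
  rewrite (_ : _ * _ = 3 / 4 * rho); first lra.
  by rewrite /r; field.
have := @quadratic_remainder R (fun l : C R => f (z + l *: h)) r M r0 _ _ 1.
rewrite nc1 expr1n mulr1 scale1r mul1r slice_deriv ?scale0r ?addr0; last first.
  by apply: df; rewrite subrr norm20.
move=> /(_ _ _ r1) H1; apply: (le_trans (H1 _ _)).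
- by move=> l lr; apply: differentiable_slice; apply: df; exact: H.
- by move=> l lr; apply: fM; exact: H.
- rewrite le_eqVlt; apply/orP; left; apply/eqP; rewrite /r.
  by field; rewrite h0 gt_eqF.
Qed.

End one_function.

Section parametric.
Variables (G : R -> Cn -> C R) (z : Cn) (rho M : R).
Hypothesis rho0 : 0 < rho.
Hypothesis dG : forall t x, 0 <= t <= 1 -> norm2 (x - z) < rho -> differentiable (G t) x.
Hypothesis GM : forall t x, 0 <= t <= 1 -> norm2 (x - z) < rho -> nc (G t x) <= M.
Hypothesis mG : forall x, norm2 (x - z) < rho -> bmeas (G ^~ x).

Let M0 : 0 <= M.
Proof.
apply: le_trans (GM (t := 0) (x := z) _ _); rewrite ?nc_ge0 ?lexx ?ler01//.
by rewrite subrr norm20.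
Qed.

Lemma cvg_harmonic_bound (u : nat -> R) (l K : R) :
  (forall m, `|u m - l| <= K / m.+1%:R) -> u @ \oo --> l.
Proof.
move=> H; apply/cvgrPdist_le => e e0.
exists (Num.bound `|K / e|) => // m /= mb; rewrite distrC (le_trans (H m))//.
rewrite ler_pdivrMr ?ltr0n// mulrC -ler_pdivrMr//.
rewrite (le_trans (ler_norm _))// ltW// (lt_le_trans (archi_boundP _))//.
by rewrite ler_nat (leq_trans mb).
Qed.

(** The difference quotients [q m] depend measurably on t and, by [taylor1], converge to the
    derivative at rate 1 / (m + 1); measurability passes to the limit, and boundedness is Cauchy's
    estimate. *)
Lemma bmeas_grad v : bmeas (fun t => lform (grad (G t) z) v).
Proof.
have v0 : 0 < 4 * (norm2 v + 1) by rewrite mulr_gt0// ltr_wpDl ?norm2_ge0.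
pose s0 := rho / (4 * (norm2 v + 1)).
have s00 : 0 < s0 by rewrite divr_gt0.
have s0v : s0 * norm2 v <= rho / 4.
  rewrite /s0 mulrAC ler_pdivrMr// (_ : rho / 4 * _ = rho * (norm2 v + 1)).
    by rewrite ler_wpM2l ?(ltW rho0)// lerDl.
  by field.
pose s (m : nat) := s0 / m.+1%:R.
have sp m : 0 < s m by rewrite divr_gt0.
have ss m : s m <= s0 by rewrite ler_pdivrMr// ler_peMr ?(ltW s00)// ler1n.
have nh m : norm2 (((s m)%:C)%C *: v) = s m * norm2 v.
  by rewrite norm2Z ncR gtr0_norm.
have hv m : norm2 (((s m)%:C)%C *: v) <= rho / 4.
  by rewrite nh (le_trans _ s0v)// ler_wpM2r ?norm2_ge0.
pose q m t := (((s m)^-1)%:C)%C * (G t (z + ((s m)%:C)%C *: v) - G t z).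
have bq m : bmeas (q m).
  apply: bmeasZ; apply: bmeasB; apply: mG; last by rewrite subrr norm20.
  by rewrite addrAC subrr add0r (le_lt_trans (hv m))//; move: rho0; lra.
pose K := 64 * M / rho ^+ 2 * norm2 v ^+ 2 * s0.
have qP m t : 0 <= t <= 1 -> nc (q m t - lform (grad (G t) z) v) <= K / m.+1%:R.
  move=> t01.
  have := @taylor1 (G t) z rho M rho0 (fun x => @dG t x t01) (fun x => @GM t x t01) _ (hv m).
  rewrite linearZ/= nh => H.
  have -> : q m t - lform (grad (G t) z) v = (((s m)^-1)%:C)%C *
      (G t (z + ((s m)%:C)%C *: v) - G t z - ((s m)%:C)%C *: lform (grad (G t) z) v).
    rewrite [RHS]mulrBr -/(q m t) [_ *: _]/(_ * _) [in RHS]mulrA -rmorphM/=.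
    by rewrite mulVf ?gt_eqF// mul1r.
  rewrite ncM ncR gtr0_norm ?invr_gt0// ler_pdivrMl// (le_trans H)//.
  rewrite exprMn /K le_eqVlt; apply/orP; left; apply/eqP.
  have m1 : m.+1%:R != 0 :> R by rewrite pnatr_eq0.
  by rewrite /s; move: (m.+1%:R) m1 => X X0; field; rewrite X0 gt_eqF.
have [r r0 rv] : exists2 r : R, 0 < r & r * norm2 v < rho.
  by exists s0 => //; rewrite (le_lt_trans s0v)//; move: rho0; lra.
split.
- apply: (@measurable_fun_cvg _ _ _ _ (fun m t => complex.Re (q m t))).
    by move=> m; have [] := bq m.
  move=> t; rewrite /= in_itv/= => t01; apply: (@cvg_harmonic_bound _ _ K) => m.
  by rewrite -ReB (le_trans (nc_Re _))// qP.
- apply: (@measurable_fun_cvg _ _ _ _ (fun m t => complex.Im (q m t))).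
    by move=> m; have [] := bq m.
  move=> t; rewrite /= in_itv/= => t01; apply: (@cvg_harmonic_bound _ _ K) => m.
  by rewrite -ImB (le_trans (nc_Im _))// qP.
- exists (2 * M / r) => t t01.
  by apply: (grad_le rho0 _ _ r0 rv) => x; [exact: dG|exact: GM].
Qed.

Definition mean_grad : Cn := \row_(j < n) integralC01 (fun t => grad (G t) z 0 j).

Lemma bmeas_grad_coord j : bmeas (fun t => grad (G t) z 0 j).
Proof.
have := bmeas_grad (delta_mx 0 j).
rewrite (_ : (fun _ => _) = fun t => grad (G t) z 0 j)//; apply/funext => t.
rewrite /lform (bigD1 j)//= mxE !eqxx mul1r big1 ?addr0// => i ij.
by rewrite mxE (negbTE ij) andbF mul0r.
Qed.

Lemma lform_mean_grad v : lform mean_grad v = integralC01 (fun t => lform (grad (G t) z) v).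
Proof.
rewrite /lform IC_sum => [|j]; last by apply: bmeasZ; exact: bmeas_grad_coord.
by apply: eq_bigr => j _; rewrite mxE ICZ//; exact: bmeas_grad_coord.
Qed.

(** Differentiation under the integral: the remainder of [taylor1] is quadratic uniformly in t, so
    it is simply integrated. *)
Lemma parametric_fdiff : fdiff (fun x => integralC01 (G ^~ x)) z mean_grad.
Proof.
move=> e e0; pose K := 64 * M / rho ^+ 2.
have K0 : 0 <= K by rewrite divr_ge0 ?mulr_ge0 ?exprn_ge0// ltW.
have K1 : 0 < K + 1 by rewrite ltr_wpDl.
exists (Num.min (rho / 4) (e / (K + 1))); first by rewrite lt_min !divr_gt0.
move=> h; rewrite lt_min => /andP[/ltW h1 /ltW h2].
have zh : norm2 (z + h - z) < rho.
  by rewrite addrAC subrr add0r (le_lt_trans h1)//; move: rho0; lra.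
have zz : norm2 (z - z) < rho by rewrite subrr norm20.
rewrite lform_mean_grad -ICB; [|exact: mG|exact: mG].
rewrite -ICB; [|by apply: bmeasB; exact: mG|exact: bmeas_grad].
apply: nc_IC_le.
  by apply: bmeasB; [apply: bmeasB; exact: mG|exact: bmeas_grad].
move=> t t01.
have := @taylor1 (G t) z rho M rho0 (fun x => @dG t x t01) (fun x => @GM t x t01) _ h1.
move/le_trans; apply; rewrite expr2 mulrA ler_wpM2r ?norm2_ge0//.
rewrite -/K (le_trans (ler_wpM2l K0 h2))// mulrA ler_pdivrMr// mulrC.
by rewrite ler_wpM2l ?(ltW e0)// lerDl.
Qed.

End parametric.

Lemma fdiff_congr f g z c (rho : R) : 0 < rho ->
  (forall x, norm2 (x - z) < rho -> f x = g x) -> fdiff f z c -> fdiff g z c.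
Proof.
move=> rho0 fg H e e0; have [r r0 rP] := H e e0.
exists (Num.min r rho); first by rewrite lt_min r0.
move=> h; rewrite lt_min => /andP[hr hrho].
have zh : norm2 (z + h - z) < rho by rewrite addrAC subrr add0r.
have zz : norm2 (z - z) < rho by rewrite subrr norm20.
by rewrite -(fg _ zh) -(fg _ zz) rP.
Qed.

End several_variables_cauchy.

(** * The operator Tg *)

Section radial_and_Tg.
Context {R : realType} {n : nat}.
Local Notation nc := (@Normc.normc R).
Local Notation mu := (@lebesgue_measure R).
Local Notation I01 := (`[(0 : R), (1 : R)]%classic).
Local Notation Cn := 'rV[C R]_n.
Implicit Types (f g F : Cn -> C R) (z x v h : Cn).

Lemma holomorphicE f : holomorphic f <-> forall z, norm2 z < 1 -> differentiable f z.
Proof. by split => H z /BnE; exact: H. Qed.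

Lemma fdiff_affine f (c : C R) b z w : fdiff f (c *: z + b) w ->
  fdiff (fun x => f (c *: x + b)) z (c *: w).
Proof.
move=> H e e0; have c0 : 0 < nc c + 1 by rewrite ltr_wpDl ?nc_ge0.
have [r r0 rP] := H _ (divr_gt0 e0 c0).
exists (r / (nc c + 1)) => [|h hr]; first by rewrite divr_gt0.
have ch : norm2 (c *: h) <= norm2 h * (nc c + 1).
  by rewrite norm2Z mulrC ler_wpM2l ?norm2_ge0// lerDl.
have {}hr : norm2 (c *: h) < r by rewrite (le_lt_trans ch)// -ltr_pdivlMr.
have := rP _ hr; rewrite scalerDr [c *: z + c *: h + b]addrAC.
have -> : lform w (c *: h) = lform (c *: w) h.
  by apply: eq_bigr => i _; rewrite !mxE; ring.
move/le_trans; apply; rewrite mulrAC ler_pdivrMr// -mulrA.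
by rewrite ler_wpM2l ?(ltW e0).
Qed.

Lemma differentiable_affine f (c : C R) b z : differentiable f (c *: z + b) ->
  differentiable (fun x => f (c *: x + b)) z.
Proof.
move=> /differentiable_fdiff/fdiff_affine; exact: fdiff_differentiable.
Qed.

Lemma norm2_scaleR (t : R) x : 0 <= t -> norm2 ((t%:C)%C *: x) = t * norm2 x.
Proof. by move=> t0; rewrite norm2Z ncR ger0_norm. Qed.

(** Cauchy's formula on l |-> g(x + l x) writes Rg(x) as a mean, over a circle of radius r
    independent of x near z, of functions holomorphic in x; [parametric_fdiff] then differentiates
    it. With r = d / 4 one has N x < 1 - 3 r, so the circle stays in the ball of radius 1 - 2 r. *)
Lemma radial_holomorphic g : holomorphic g -> holomorphic (radial g).
Proof.
move=> /holomorphicE hg; apply/holomorphicE => z z1.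
pose d := 1 - norm2 z; have d0 : 0 < d by rewrite subr_gt0.
have d1 : d <= 1 by rewrite lerBlDr lerDl norm2_ge0.
pose r := d / 4; have r0 : 0 < r by rewrite divr_gt0.
have [M M0 gM] : exists2 M, 0 <= M & forall x, norm2 x <= 1 - d / 2 -> nc (g x) <= M.
  by apply: holomorphic_bounded => x xd; apply: hg; lra.
have xz x : norm2 (x - z) < r -> norm2 x < 1 - 3 * r.
  by move=> H; have := norm2D (x - z) z; rewrite subrK /r /d in H *; lra.
have near_ x (l : C R) : norm2 (x - z) < r -> nc (l - 0) <= r -> norm2 (x + l *: x) <= 1 - d / 2.
  rewrite subr0 => /xz xr lr; rewrite (le_trans (norm2D _ _))// norm2Z.
  have := norm2_ge0 x; have := nc_ge0 l; rewrite /r in xr lr *; nra.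
pose G (t : R) x := ((r^-1)%:C)%C * ((g (x + ((r%:C)%C * cis t) *: x) - g x) * cis (- t)).
have dx x : norm2 (x - z) < r -> norm2 x <= 1 - d / 2.
  by move=> /xz; rewrite /r; lra.
have rc t : nc ((r%:C)%C * cis t - 0) <= r by rewrite subr0 ncM nc_cis ncR mulr1 gtr0_norm.
have dsl x : norm2 (x - z) < r -> forall l : C R, nc (l - 0) <= r ->
    differentiable (fun l : C R => g (x + l *: x)) l.
  move=> xr l lr; apply: differentiable_slice; apply: hg.
  by rewrite (le_lt_trans (near_ _ _ xr lr))//; lra.
have E x : norm2 (x - z) < r -> integralC01 (G ^~ x) = radial g x.
  move=> xr; have := cauchy_circle r0 (dsl x xr).
  have dgx : differentiable g (x + 0 *: x).
    by rewrite scale0r addr0; apply: hg; rewrite (le_lt_trans (dx _ xr))//; lra.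
  rewrite (slice_deriv dgx) scale0r addr0 -radial_grad => H.
  have -> : radial g x = ((r^-1)%:C)%C * ((r%:C)%C * radial g x).
    by rewrite mulrA -rmorphM/= mulVf ?gt_eqF// mul1r.
  rewrite -H -ICZ.
    by apply: eq_IC => t _; rewrite /G add0r.
  apply: bmeasM; last exact: bmeas_cisN.
  by apply: bmeasB; [exact: (bmeas_circle r0 (dsl x xr))|exact: bmeas_cst].
apply: fdiff_differentiable; apply: (fdiff_congr r0 E).
apply: (@parametric_fdiff R n G z r (r^-1 * (2 * M)) r0).
- move=> t x _ xr; rewrite /G.
  apply: (@differentiableZ _ _ _ (fun x => _ * cis (- t))).
  apply: differentiableM; last exact: differentiable_cst.
  apply: differentiableB; last first.
    by apply: hg; rewrite (le_lt_trans (dx _ xr))//; lra.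
  have := @differentiable_affine g (1 + (r%:C)%C * cis t) 0 x.
  rewrite addr0 scalerDl scale1r (_ : (fun x => g (_ *: x + 0)) = fun x => g (x + ((r%:C)%C * cis t) *: x)).
    by apply; apply: hg; rewrite (le_lt_trans (near_ _ _ xr (rc t)))//; lra.
  by apply/funext => y; rewrite addr0 scalerDl scale1r.
- move=> t x _ xr; rewrite /G ncM ncR gtr0_norm ?invr_gt0// ler_wpM2l ?invr_ge0 ?(ltW r0)//.
  rewrite ncM nc_cis mulr1 (le_trans (ncD _ _))// ncN mulr_natl mulr2n.
  by apply: lerD; apply: gM; [exact: (near_ _ _ xr (rc t))|exact: dx].
- move=> x xr; apply: bmeasZ; apply: bmeasM; last exact: bmeas_cisN.
  apply: bmeasB; last exact: bmeas_cst.
  have := bmeas_circle r0 (dsl x xr).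
  have E1 : (fun t => g (x + (0 + (r%:C)%C * cis t) *: x)) =
      (fun t => g (x + ((r%:C)%C * cis t) *: x)).
    by apply/funext => t; rewrite add0r.
  by rewrite E1.
Qed.

Lemma radial0 g : radial g 0 = 0.
Proof. by rewrite /radial big1// => i _; rewrite mxE mul0r. Qed.

(** The mean value inequality along the ray from 0, with the derivative bounded by Cauchy's
    estimate. The linear factor t is what makes a later division by t harmless near 0. *)
Lemma ray_lipschitz F x (s d M r t : R) :
  (forall y, norm2 y < s + d -> differentiable F y) ->
  (forall y, norm2 y < s + d -> nc (F y) <= M) ->
  norm2 x <= s -> 0 < d -> 0 < r -> r * norm2 x < d -> 0 <= t <= 1 ->
  nc (F ((t%:C)%C *: x) - F 0) <= 2 * M / r * t.
Proof.
move=> dF FM xs d0 r0 rx /andP[t0 t1].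
have sx (u : R) : 0 <= u <= 1 -> norm2 (0 + ((0 : C R) + (u%:C)%C * (t%:C)%C) *: x) <= s.
  move=> /andP[u0 u1]; rewrite !add0r -rmorphM norm2_scaleR ?mulr_ge0//.
  by rewrite (le_trans _ xs)// ler_piMl ?norm2_ge0// mulr_ile1.
have near_ y0 y : norm2 y0 <= s -> norm2 (y - y0) < d -> norm2 y < s + d.
  by move=> h1 h2; have := norm2D (y - y0) y0; rewrite subrK; lra.
have := @complex_mean_value R (fun l : C R => F (0 + l *: x)) 0 (t%:C)%C (2 * M / r).
rewrite !add0r scale0r ncR ger0_norm//; apply => u u01.
  by apply: differentiable_slice; apply: dF; rewrite (le_lt_trans (sx u u01))// ltrDl.
have dFu := sx u u01.
rewrite slice_deriv; last by apply: dF; rewrite (le_lt_trans dFu)// ltrDl.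
by apply: (@grad_le R n F _ d M d0 _ _ x r r0 rx) => y hy; [apply: dF|apply: FM];
  exact: near_ dFu hy.
Qed.

(** Integrands divided by t have a default value at t = 0, where continuity fails in general; a
    single point does not disturb measurability. *)
Lemma bmeas_oc (h : R -> C R) (M : R) : (forall t, 0 < t <= 1 -> ccont h t) ->
  (forall t, 0 <= t <= 1 -> nc (h t) <= M) -> bmeas h.
Proof.
move=> hc hM.
have key (u : R -> R) : (forall t, 0 < t <= 1 -> {for t, continuous u}) ->
    measurable_fun I01 u.
  move=> cu; have -> : I01 = [set (0 : R)] `|` `](0 : R), (1 : R)]%classic.
    by rewrite setU1itv// bnd_simp.
  apply/measurable_funU => //; split; first exact: measurable_fun_set1.
  apply: subspace_continuous_measurable_fun => //.
  apply: continuous_in_subspaceT => t; rewrite inE/= in_itv/=; exact: cu.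
by split; [apply: key => t /hc/ccont_ReIm[]..|exists M].
Qed.

Lemma eq_IC_oc (h k : R -> C R) : bmeas h -> bmeas k ->
  (forall t, 0 < t <= 1 -> h t = k t) -> integralC01 h = integralC01 k.
Proof.
move=> bh bk hk.
have key (u v : R -> R) : mu.-integrable I01 (EFin \o u) ->
    mu.-integrable I01 (EFin \o v) -> (forall t, 0 < t <= 1 -> u t = v t) ->
    Rintegral mu I01 u = Rintegral mu I01 v.
  move=> iu iv uv; rewrite -!Rintegral_itv_obnd_cbnd.
  - by apply: eq_Rintegral => t; rewrite inE/= in_itv/= => /uv.
  - by apply: integrableS iv => //; apply: subset_itv; rewrite bnd_simp.
  - by apply: integrableS iu => //; apply: subset_itv; rewrite bnd_simp.
apply: eq_ReIm; rewrite ?Re_IC ?Im_IC; apply: key.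
- exact: bmeas_Re.
- exact: bmeas_Re.
- by move=> t /hk ->.
- exact: bmeas_Im.
- exact: bmeas_Im.
- by move=> t /hk ->.
Qed.

Lemma cdiff_ccont_line (k : C R -> C R) (a b d : C R) (t : R) :
  cdiff k (a + (t%:C)%C * b) d -> ccont (fun t => k (a + (t%:C)%C * b)) t.
Proof.
move=> H e e0; have [r r0 rP] := H 1 ltr01.
have K0 : 0 < (nc d + 1) * nc b + 1 by rewrite ltr_wpDl// mulr_ge0 ?addr_ge0 ?nc_ge0.
have b0 : 0 < nc b + 1 by rewrite ltr_wpDl// nc_ge0.
exists (Num.min (r / (nc b + 1)) (e / ((nc d + 1) * nc b + 1))).
  by rewrite lt_min !divr_gt0.
move=> s; rewrite lt_min => /andP[sr se].
have sb : nc ((s%:C)%C * b) < r.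
  rewrite ncM ncR (@le_lt_trans _ _ (`|s| * (nc b + 1)))//.
    by rewrite ler_wpM2l// lerDl.
  by rewrite -ltr_pdivlMr.
have := rP _ sb; rewrite mul1r.
have -> : a + (t%:C)%C * b + (s%:C)%C * b = a + ((t + s)%:C)%C * b.
  by rewrite rmorphD/=; ring.
move: (k _) (k _) => X Y HXY.
rewrite -[X in nc X](subrK ((s%:C)%C * b * d)) (le_trans (ncD _ _))//.
rewrite (le_trans (lerD HXY (lexx _)))// [nc (_ * d)]ncM -[X in X + _]mulr1 -mulrDr.
rewrite ncM ncR -mulrA [nc b * _]mulrC [1 + _]addrC.
rewrite (@le_trans _ _ (`|s| * ((nc d + 1) * nc b + 1)))//.
  by rewrite ler_wpM2l// lerDl.
by rewrite -ler_pdivlMr// ltW.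
Qed.

Section ray_integral.
Variable F : Cn -> C R.
Hypothesis dF : forall x, norm2 x < 1 -> differentiable F x.
Hypothesis F0 : F 0 = 0.

(** For F = f Rg this is the integrand of [Tg]. At t = 0 division by zero gives 0, whereas the limit
    is the derivative of F at 0 in direction x. *)
Definition ray_quotient (t : R) x := F ((t%:C)%C *: x) / (t%:C)%C.
Local Notation G := ray_quotient.

Let Gbound (s : R) : s < 1 -> exists2 M, 0 <= M &
  forall t x, 0 <= t <= 1 -> norm2 x <= s -> nc (G t x) <= M.
Proof.
move=> s1; have [s0|s0] := ltP s 0.
  exists 0 => // t x _ xs; exfalso; have := norm2_ge0 x; lra.
pose d := (1 - s) / 2; have d0 : 0 < d by rewrite divr_gt0// subr_gt0.
have [M M0 FM] : exists2 M, 0 <= M & forall x, norm2 x <= s + d -> nc (F x) <= M.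
  by apply: holomorphic_bounded => x xs; apply: dF; rewrite /d in xs *; lra.
exists (2 * M / d); first by rewrite divr_ge0 ?(ltW d0) ?mulr_ge0.
move=> t x /andP[t0 t1] xs; rewrite /ray_quotient.
have [->|tn0] := eqVneq t 0.
  by rewrite scale0r F0 mul0r nc0 divr_ge0 ?(ltW d0) ?mulr_ge0.
have tp : 0 < t by rewrite lt_def tn0.
rewrite ncM ncV ncR gtr0_norm// ler_pdivrMr// -[F _]subr0 -F0.
apply: (@ray_lipschitz F x s d _ _ _ _ _ xs d0 d0).
- by move=> y ys; apply: dF; rewrite /d in ys *; lra.
- by move=> y /ltW; exact: FM.
- by rewrite gtr_pMr// (le_lt_trans xs).
- by rewrite t0.
Qed.

(** The factor t of the inner dilation cancels the division by t. *)
Let dG t x : 0 < t <= 1 -> norm2 x < 1 -> fdiff (G t) x (grad F ((t%:C)%C *: x)).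
Proof.
move=> /andP[t0 t1] x1.
have tx : norm2 ((t%:C)%C *: x) < 1.
  by rewrite norm2_scaleR ?(ltW t0)// (le_lt_trans _ x1)// ler_piMl ?norm2_ge0.
move=> e e0; have [r r0 rP] := differentiable_fdiff (dF tx) e0.
have tC : (t%:C)%C != 0 :> C R by rewrite -nc_eq0 ncR normr_eq0 gt_eqF.
exists r => // h hr; have := rP ((t%:C)%C *: h).
rewrite norm2_scaleR ?(ltW t0)// -/(grad F _); move: (grad F _) => c H.
have {}H := H (le_lt_trans (ler_piMl (norm2_ge0 _) t1) hr).
have E : G t (x + h) - G t x - lform c h =
    (F ((t%:C)%C *: x + (t%:C)%C *: h) - F ((t%:C)%C *: x) -
     lform c ((t%:C)%C *: h)) / (t%:C)%C.
  have -> : lform c ((t%:C)%C *: h) = lform c h * (t%:C)%C.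
    by rewrite mulr_suml; apply: eq_bigr => i _; rewrite mxE; ring.
  by rewrite /ray_quotient scalerDr !mulrBl mulfK.
by rewrite E ncM ncV ncR gtr0_norm// ler_pdivrMr// (le_trans H)// mulrA mulrAC.
Qed.

Let G0 x : G 0 x = 0.
Proof. by rewrite /ray_quotient scale0r F0 mul0r. Qed.

Let dG' t x : 0 <= t <= 1 -> norm2 x < 1 -> differentiable (G t) x.
Proof.
move=> /andP[]; rewrite le_eqVlt => /predU1P[<- _ _|t0 t1 x1].
  rewrite (_ : G 0 = cst 0); first exact: differentiable_cst.
  by apply/funext => y; rewrite G0.
by apply: fdiff_differentiable; apply: dG; rewrite // t0.
Qed.

Lemma bmeas_ray x : norm2 x < 1 -> bmeas (G ^~ x).
Proof.
move=> x1; have [M M0 GM] := Gbound x1.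
apply: (@bmeas_oc _ M) => [t /andP[t0 t1]|t t01]; last exact: GM.
have tx : norm2 (0 + ((0 : C R) + (t%:C)%C * 1) *: x) < 1.
  rewrite add0r add0r mulr1 norm2_scaleR ?(ltW t0)//.
  by rewrite (le_lt_trans _ x1)// ler_piMl ?norm2_ge0.
have tC : (0 : C R) + (t%:C)%C * 1 != 0.
  by rewrite add0r mulr1 -nc_eq0 ncR normr_eq0 gt_eqF.
have dk : differentiable (fun l : C R => F (0 + l *: x) * l^-1) ((0 : C R) + (t%:C)%C * 1).
  apply: differentiableM; first exact: (differentiable_slice (dF tx)).
  exact: differentiable_Rinv.
have := cdiff_ccont_line (differentiable_cdiff dk).
rewrite (_ : (fun t => _) = G ^~ x)//; apply/funext => u.
by rewrite /ray_quotient !add0r mulr1.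
Qed.

Let ray_fdiff z : norm2 z < 1 -> fdiff (fun x => integralC01 (G ^~ x)) z (mean_grad G z).
Proof.
move=> z1; pose d := (1 - norm2 z) / 2; have d0 : 0 < d by rewrite divr_gt0// subr_gt0.
have near_ x : norm2 (x - z) < d -> norm2 x <= norm2 z + d.
  by move=> H; have := norm2D (x - z) z; rewrite subrK; lra.
have [M M0 GM] : exists2 M, 0 <= M & forall t x, 0 <= t <= 1 ->
    norm2 x <= norm2 z + d -> nc (G t x) <= M.
  by apply: Gbound; rewrite /d; lra.
have lt1 x : norm2 x <= norm2 z + d -> norm2 x < 1 by rewrite /d; lra.
apply: (@parametric_fdiff R n G z d M d0).
- by move=> t x t01 /near_/lt1; exact: dG'.
- by move=> t x t01 /near_; exact: GM.
- by move=> x /near_/lt1; exact: bmeas_ray.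
Qed.

Lemma ray_holomorphic : holomorphic (fun x => integralC01 (G ^~ x)).
Proof.
by apply/holomorphicE => z z1; apply: fdiff_differentiable; exact: ray_fdiff z1.
Qed.

(** The slice of F through t0 a in direction a has a Lipschitz derivative by [cdiff_lipschitz]; this
    is the continuity that the fundamental theorem of calculus asks for. *)
Lemma cdiff_ray_cont a (t0 : R) : 0 <= t0 <= 1 -> norm2 a < 1 ->
  ccont (fun t => lform (grad F ((t%:C)%C *: a)) a) t0.
Proof.
move=> /andP[t00 t01] a1; pose d := (1 - norm2 a) / 4.
have d0 : 0 < d by rewrite divr_gt0// subr_gt0.
have [M M0 FM] : exists2 M, 0 <= M & forall x, norm2 x <= norm2 a + 3 * d -> nc (F x) <= M.
  by apply: holomorphic_bounded => x xs; apply: dF; rewrite /d in xs *; lra.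
pose k (l : C R) := F ((t0%:C)%C *: a + l *: a).
have near_ (l : C R) : nc l <= 3 * d -> norm2 ((t0%:C)%C *: a + l *: a) <= norm2 a + 3 * d.
  move=> ld; rewrite (le_trans (norm2D _ _))// norm2Z norm2_scaleR//.
  rewrite lerD//; first by rewrite ler_piMl ?norm2_ge0.
  by rewrite (le_trans _ ld)// ler_piMr ?nc_ge0// ltW.
have lt1 x : norm2 x <= norm2 a + 3 * d -> norm2 x < 1 by rewrite /d; lra.
have dk (l : C R) : nc l <= 3 * d -> differentiable k l.
  by move=> /near_/lt1 H; apply: differentiable_slice; exact: dF.
have kM (l : C R) : nc l <= 3 * d -> nc (k l) <= M by move=> /near_; exact: FM.
move=> e e0; pose K := 4 * M / d ^+ 2 + 1.
have K0 : 0 < K by rewrite ltr_wpDl// divr_ge0 ?exprn_ge0 ?(ltW d0) ?mulr_ge0.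
exists (Num.min d (e / K)); first by rewrite lt_min d0 divr_gt0.
move=> s; rewrite lt_min => /andP[sd se].
have n0 : nc (0 : C R) <= d by rewrite nc0 ltW.
have sd' : nc (s%:C)%C <= d by rewrite ncR ltW.
have D (l : C R) : nc l <= d -> cdiff k l (lform (grad F ((t0%:C)%C *: a + l *: a)) a).
  move=> ld; have dl : differentiable F ((t0%:C)%C *: a + l *: a : Cn).
    by apply/dF/lt1/near_; lra.
  move=> e' e'0; have [r r0 rP] := fdiff_slice a (differentiable_fdiff dl) e'0.
  exists r => // h hr; have := rP h hr.
  by rewrite add0r scale0r addr0 /k scalerDl addrA.
have D0 := D _ n0; rewrite scale0r addr0 in D0.
have Ds := D _ sd'; rewrite -scalerDl -rmorphD in Ds.
have H := cdiff_lipschitz d0 dk kM D0 Ds n0 sd'.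
rewrite [(s%:C)%C - 0]subr0 ncR in H; apply: (le_trans H).
rewrite (@le_trans _ _ (K * `|s|))//; first by rewrite ler_wpM2r// lerDl.
by rewrite mulrC -ler_pdivlMr// ltW.
Qed.

(** The fundamental theorem of calculus for t |-> F(t a), with F(0) = 0. It is used for the real
    functions Re(c F); c = 1 and c = -i recover both parts. *)
Lemma IC_ray_derivative a : norm2 a < 1 ->
  integralC01 (fun t => lform (grad F ((t%:C)%C *: a)) a) = F a.
Proof.
move=> a1.
have ta (t : R) : 0 <= t <= 1 -> norm2 (0 + ((0 : C R) + (t%:C)%C * 1) *: a) < 1.
  move=> /andP[t0 t1]; rewrite !add0r mulr1 norm2_scaleR//.
  by rewrite (le_lt_trans _ a1)// ler_piMl ?norm2_ge0.
have dk (t : R) : 0 <= t <= 1 -> cdiff (fun l : C R => F (0 + l *: a))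
    ((0 : C R) + (t%:C)%C * 1) (lform (grad F ((t%:C)%C *: a)) a).
  move=> t01; have H := differentiable_cdiff (differentiable_slice (dF (ta _ t01))).
  by rewrite (slice_deriv (dF (ta _ t01))) !add0r mulr1 in H; rewrite add0r mulr1.
have key (c : C R) : complex.Re (c * integralC01 (fun t => lform (grad F ((t%:C)%C *: a)) a)) =
    complex.Re (c * F a).
  have cc t : 0 <= t <= 1 -> ccont (fun t => c * lform (grad F ((t%:C)%C *: a)) a) t.
    move=> t01 e e0.
    have c0 : 0 < nc c + 1 by rewrite ltr_wpDl// nc_ge0.
    have [r r0 rP] := cdiff_ray_cont t01 a1 (divr_gt0 e0 c0).
    exists r => // s /rP H; rewrite -mulrBr ncM.
    rewrite (le_trans (ler_wpM2l (nc_ge0 _) H))// mulrCA ler_piMr ?(ltW e0)//.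
    by rewrite ler_pdivrMr// mul1r lerDl.
  have bl : bmeas (fun t => lform (grad F ((t%:C)%C *: a)) a).
    by apply: ccont_bmeas => t t01; exact: cdiff_ray_cont.
  rewrite -ICZ// Re_IC.
  pose phi (t : R) := complex.Re (c * F (0 + ((0 : C R) + (t%:C)%C * 1) *: a)).
  have dphi (t : R) : 0 <= t <= 1 -> is_derive t 1 phi
      (complex.Re (c * (1 * lform (grad F ((t%:C)%C *: a)) a))).
    by move=> t01; exact: (@cdiff_Re_derive R (fun l : C R => F (0 + l *: a)) 0 1 c _ t (dk t t01)).
  have cphi (t : R) : 0 <= t <= 1 -> {for t, continuous phi}.
    move=> t01; apply: differentiable_continuous; apply/derivable1_diffP.
    by have [] := dphi t t01.
  have := @continuous_FTC2 R (fun t => complex.Re (c * lform (grad F ((t%:C)%C *: a)) a)) phi 0 1 ltr01.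
  rewrite /Rintegral => ->.
  - rewrite /= /phi !add0r mul0r mul1r scale1r scale0r F0 mulr0 subr0//.
  - by apply: ctson_within => t t0 t1; have [] := ccont_ReIm (cc t _); rewrite ?t0.
  - split.
    + move=> t; rewrite in_itv/= => /andP[/ltW t0 /ltW t1].
      by have [] := dphi t _; rewrite ?t0.
    + apply: cvg_at_right_filter; apply: cphi; by rewrite lexx ler01.
    + apply: cvg_at_left_filter; apply: cphi; by rewrite lexx ler01.
  - move=> t; rewrite in_itv/= => /andP[/ltW t0 /ltW t1].
    have t01 : 0 <= t <= 1 by rewrite t0.
    by rewrite derive1E (@derive_val _ _ _ _ _ _ _ (dphi t t01)) mul1r.
apply: eq_ReIm; first by have := key 1; rewrite !mul1r.
have := key (0 +i* (-1))%C; rewrite !ReM/= !mul0r !sub0r !mulN1r !opprK.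
by [].
Qed.

(** Under the integral, the derivative of G t in direction a is that of F at t a, and these
    integrate to F(a) by [IC_ray_derivative]. With F = f Rg this inverts [Tg]. *)
Lemma radial_ray a : norm2 a < 1 -> radial (fun x => integralC01 (G ^~ x)) a = F a.
Proof.
move=> a1; rewrite -(IC_ray_derivative a1) radial_grad.
have H1 := differentiable_fdiff (ray_holomorphic ((BnE a).2 a1)).
transitivity (lform (mean_grad G a) a).
  exact: (cdiff_unique (fdiff_slice a H1) (fdiff_slice a (ray_fdiff a1))).
pose d := (1 - norm2 a) / 2; have d0 : 0 < d by rewrite divr_gt0// subr_gt0.
have near_ x : norm2 (x - a) < d -> norm2 x <= norm2 a + d.
  by move=> H; have := norm2D (x - a) a; rewrite subrK; lra.
have lt1 x : norm2 x <= norm2 a + d -> norm2 x < 1 by rewrite /d; lra.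
have [M M0 GM] : exists2 M, 0 <= M & forall t x, 0 <= t <= 1 ->
    norm2 x <= norm2 a + d -> nc (G t x) <= M.
  by apply: Gbound; rewrite /d; lra.
have hd t x : 0 <= t <= 1 -> norm2 (x - a) < d -> differentiable (G t) x.
  by move=> t01 /near_/lt1; exact: dG'.
have hM t x : 0 <= t <= 1 -> norm2 (x - a) < d -> nc (G t x) <= M.
  by move=> t01 /near_; exact: GM.
have hm x : norm2 (x - a) < d -> bmeas (G ^~ x) by move=> /near_/lt1; exact: bmeas_ray.
(* At t = 0 the two integrands may differ, since G 0 is identically 0; they are compared on ]0, 1]
   only. *)
rewrite (lform_mean_grad d0 hd hM hm); apply: eq_IC_oc.
- exact: (bmeas_grad d0 hd hM hm).
- by apply: ccont_bmeas => t t01; exact: cdiff_ray_cont.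
- move=> t t01.
  have t01' : 0 <= t <= 1 by case/andP: t01 => /ltW -> ->.
  exact: (cdiff_unique (fdiff_slice a (differentiable_fdiff (dG' t01' a1)))
    (fdiff_slice a (dG t01 a1))).
Qed.

End ray_integral.

Section Tg.
Variables f g : Cn -> C R.
Hypothesis hf : holomorphic f.
Hypothesis hg : holomorphic g.

Lemma holomorphic_mul_radial x : norm2 x < 1 -> differentiable (fun x => f x * radial g x) x.
Proof.
move=> x1; apply: differentiableM; first exact/hf/BnE.
exact/(radial_holomorphic hg)/BnE.
Qed.

Let F0 : f 0 * radial g 0 = 0. Proof. by rewrite radial0 mulr0. Qed.

Lemma bmeas_Tg a : norm2 a < 1 ->
  bmeas (fun t => f ((t%:C)%C *: a) * radial g ((t%:C)%C *: a) / (t%:C)%C).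
Proof. exact: (bmeas_ray holomorphic_mul_radial F0). Qed.

Lemma Tg_holomorphic : holomorphic (Tg g f).
Proof. exact: (ray_holomorphic holomorphic_mul_radial F0). Qed.

Lemma radial_Tg a : norm2 a < 1 -> radial (Tg g f) a = f a * radial g a.
Proof. exact: (radial_ray holomorphic_mul_radial F0). Qed.

End Tg.

End radial_and_Tg.

(** * Affine substitutions in C^n *)

Section affine_substitution.
Context {R : realType}.
Local Notation nc := (@Normc.normc R).
Local Notation leb := (@lebesgue_measure R).
Local Notation MR := (measurableTypeR R).

Definition affine (a b : R) (x : MR) : MR := a * x + b.

Lemma measurable_affine (a b : R) : measurable_fun setT (affine a b).
Proof.
by apply: measurable_funD => //; apply: measurable_funM.
Qed.

Definition affine_image (a b : R) : {measure set MR -> \bar R} :=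
  measure_function_pushforward__canonical__measure_function_Measure leb (measurable_affine a b).

(** By uniqueness of Lebesgue measure it is enough to look at intervals ]x, y]. For a < 0 the
    preimage is half-open on the other side, with the same length formula. *)
Lemma lebesgue_affine (a b : R) (X : set MR) : a != 0 -> measurable X ->
  leb X = mscale (NngNum (normr_ge0 a)) (affine_image a b) X.
Proof.
move=> a0; apply: lebesgue_measure_unique => Y /ocitvP[->|[[x y] /= xy ->]].
  by rewrite !measure0.
rewrite /mscale/= /pushforward; case: (ltgtP a 0) a0 => // a0 _.
  rewrite (_ : _ @^-1` _ = `[(y - b) / a, (x - b) / a[%classic); last first.
    apply/seteqP; split => t; rewrite /= !in_itv/= /affine.
      move=> /andP[h1 h2]; rewrite ler_ndivrMr// ltr_ndivlMr//.
      by apply/andP; split; lra.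
    move=> /andP[]; rewrite ler_ndivrMr// ltr_ndivlMr// => h1 h2.
    by apply/andP; split; lra.
  rewrite !lebesgue_measure_itv/= !lte_fin xy ltr_nM2r ?invr_lt0// ltrD2r xy.
  by rewrite -!EFinD -EFinM ltr0_norm//; congr EFin; field; rewrite lt_eqF.
rewrite (_ : _ @^-1` _ = `](x - b) / a, (y - b) / a]%classic); last first.
  apply/seteqP; split => t; rewrite /= !in_itv/= /affine.
    move=> /andP[h1 h2]; rewrite ltr_pdivrMr// ler_pdivlMr//.
    by apply/andP; split; lra.
  move=> /andP[]; rewrite ltr_pdivrMr// ler_pdivlMr// => h1 h2.
  by apply/andP; split; lra.
rewrite !lebesgue_measure_itv/= !lte_fin xy ltr_pM2r ?invr_gt0// ltrD2r xy.
by rewrite -!EFinD -EFinM gtr0_norm//; congr EFin; field; rewrite gt_eqF.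
Qed.

Lemma integral_affine (a b : R) (F : MR -> \bar R) : a != 0 ->
  measurable_fun setT F -> (forall x, 0 <= F x)%E ->
  (\int[leb]_x F x = `|a|%:E * \int[leb]_x F (affine a b x))%E.
Proof.
move=> a0 mF F0.
rewrite (eq_measure_integral (mscale (NngNum (normr_ge0 a)) (affine_image a b))).
  rewrite ge0_integral_mscale//; congr (_ * _)%E.
  by rewrite ge0_integral_pushforward//; exact: measurable_affine.
by move=> A mA _; exact: lebesgue_affine.
Qed.

Local Notation C2 := (MR * MR)%type.

Definition cplx (p : C2) : C R := (p.1 +i* p.2)%C.

Definition caff (c w : C R) (p : C2) : C2 :=
  (complex.Re (c * cplx p + w), complex.Im (c * cplx p + w)).

Lemma caffE c w p : cplx (caff c w p) = c * cplx p + w.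
Proof. by rewrite /cplx/=; case: (_ + _). Qed.

Lemma measurable_caff c w : measurable_fun setT (caff c w).
Proof.
apply/measurable_fun_pair => /=.
  apply: (eq_measurable_fun (fun p : C2 => complex.Re c * p.1 - complex.Im c * p.2 + complex.Re w)).
    by move=> p _; rewrite ReD ReM.
  by apply: measurable_funD => //; apply: measurable_funB; apply: measurable_funM => //.
apply: (eq_measurable_fun (fun p : C2 => complex.Re c * p.2 + complex.Im c * p.1 + complex.Im w)).
  by move=> p _; rewrite ImD ImM.
by apply: measurable_funD => //; apply: measurable_funD; apply: measurable_funM => //.
Qed.

Definition leb2 := prod_sf leb leb.

Lemma leb2E (F : C2 -> \bar R) : measurable_fun setT F -> (forall x, 0 <= F x)%E ->
  (\int[leb2]_p F p = \int[leb]_x \int[leb]_y F (x, y))%E.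
Proof. by move=> mF F0; rewrite -fubini_tonelli1. Qed.

Lemma integral_swap2 (F : C2 -> \bar R) : measurable_fun setT F -> (forall x, 0 <= F x)%E ->
  (\int[leb]_x \int[leb]_y F (x, y) = \int[leb]_y \int[leb]_x F (x, y))%E.
Proof. exact: fubini_tonelli. Qed.

Definition shear (a b u : R) (p : C2) : C2 := (a * p.1 + b * p.2 + u, p.2).

Lemma measurable_shear a b u : measurable_fun setT (shear a b u).
Proof.
apply/measurable_fun_pair => //=.
by apply: measurable_funD => //; apply: measurable_funD; apply: measurable_funM.
Qed.

Definition flip (p : C2) : C2 := (p.2, p.1).

Lemma measurable_flip : measurable_fun setT flip.
Proof. exact/measurable_fun_pair. Qed.

Lemma integral_shear (a b u : R) (F : C2 -> \bar R) : a != 0 ->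
  measurable_fun setT F -> (forall x, 0 <= F x)%E ->
  (\int[leb2]_p F p = `|a|%:E * \int[leb2]_p F (shear a b u p))%E.
Proof.
move=> a0 mF F0.
have mG : measurable_fun setT (fun p : C2 => F (shear a b u p)).
  by apply: measurableT_comp => //; exact: measurable_shear.
have E (H : C2 -> \bar R) : measurable_fun setT H -> (forall x, 0 <= H x)%E ->
    (\int[leb2]_p H p = \int[leb]_y \int[leb]_x H (x, y))%E.
  by move=> mH H0; rewrite leb2E// integral_swap2.
rewrite !E// -ge0_integralZl//; last 2 first.
- exact: (measurable_fun_fubini_tonelli_G (m1 := leb) (fun p => F (shear a b u p)) mG
    (fun x => F0 _)).
- by move=> x _; apply: integral_ge0 => *; exact: F0.
apply: eq_integral => y _; rewrite (@integral_affine a (b * y + u))//.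
- by congr (_ * _)%E; apply: eq_integral => x _; rewrite /shear /affine/= addrA.
- by apply: measurableT_comp => //; exact: measurable_pair2.
Qed.

Lemma integral_flip (F : C2 -> \bar R) :
  measurable_fun setT F -> (forall x, 0 <= F x)%E ->
  (\int[leb2]_p F p = \int[leb2]_p F (flip p))%E.
Proof.
move=> mF F0; rewrite leb2E// integral_swap2// leb2E//.
by apply: measurableT_comp => //; exact: measurable_flip.
Qed.

(* An affine map p |-> c p + w of the plane is a product of shears and flips. *)
Lemma integral_caff (c w : C R) (F : C2 -> \bar R) : c != 0 ->
  measurable_fun setT F -> (forall x, 0 <= F x)%E ->
  (\int[leb2]_p F p = ((nc c) ^+ 2)%:E * \int[leb2]_p F (caff c w p))%E.
Proof.
case: c w => a b [u v] c0 mF F0; rewrite nc_sqr/=.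
have mfl := measurable_flip; have msh := measurable_shear.
have [a0|a0] := eqVneq a 0.
  have b0 : b != 0 by apply: contraNneq c0 => ->; rewrite a0.
  rewrite (@integral_shear (- b) 0 u F) ?oppr_eq0//.
  have m1 : measurable_fun setT (F \o shear (- b) 0 u) by exact: measurableT_comp.
  rewrite (@integral_flip (F \o shear (- b) 0 u))//; last by move=> x; exact: F0.
  have m2 : measurable_fun setT (F \o shear (- b) 0 u \o flip) by exact: measurableT_comp.
  rewrite (@integral_shear b 0 v (F \o shear (- b) 0 u \o flip))//; last first.
    by move=> x; exact: F0.
  rewrite muleA -EFinM normrN -expr2 real_normK ?num_real//.
  rewrite a0 expr0n/= add0r; congr (_ * _)%E; apply: eq_integral => -[x y] _ /=.
  by rewrite /caff/cplx/shear/flip/=; congr (F (_, _)); ring.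
(* Once X = a x - b y + u is the first coordinate, the second one, b x + a y + v, equals s y + q X +
   r. The two shears have Jacobians a and s, with a s = |c|^2. *)
pose q := b / a; pose s := (a ^+ 2 + b ^+ 2) / a; pose r := v - q * u.
have s0 : s != 0.
  rewrite mulf_neq0 ?invr_eq0// gt_eqF// ltr_pwDl ?sqr_ge0//.
  by rewrite lt_def sqrf_eq0 a0 sqr_ge0.
have n0 (G : C2 -> C2) x : (0 <= (F \o G) x)%E by exact: F0.
rewrite integral_flip//.
have m1 : measurable_fun setT (F \o flip) by exact: measurableT_comp.
rewrite (@integral_shear s q r (F \o flip))//.
have m2 : measurable_fun setT (F \o (flip \o shear s q r)).
  by apply: measurableT_comp => //; exact: measurableT_comp.
rewrite (@integral_flip (F \o (flip \o shear s q r)))//.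
have m3 : measurable_fun setT (F \o (flip \o shear s q r \o flip)).
  by apply: measurableT_comp => //; do 2 apply: measurableT_comp => //.
rewrite (@integral_shear a (- b) u (F \o (flip \o shear s q r \o flip)))//.
rewrite muleA -EFinM -normrM /s divfK// ger0_norm ?addr_ge0 ?sqr_ge0//.
congr (_ * _)%E; apply: eq_integral => -[x y] _ /=.
rewrite /caff/cplx/shear/flip/=; congr (F (_, _)); first by ring.
by rewrite /s /r /q; field.
Qed.

End affine_substitution.

(** * Coordinatewise substitution in a product measure *)

Section tuple_substitution.
Local Open Scope ereal_scope.
Context d (T : measurableType d) (R : realType).
Variable mu : {sigma_finite_measure set T -> \bar R}.

Lemma integral_tupleS n (F : n.+1.-tuple T -> \bar R) :
  measurable_fun setT F -> (forall x, 0 <= F x) ->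
  \int[tuple_measure mu n.+1]_t F t =
  \int[mu]_x \int[tuple_measure mu n]_t F (tcons (x, t)).
Proof.
move=> mF F0.
have mG : measurable_fun setT (F \o @tcons _ T n).
  by apply: measurableT_comp => //; exact: measurable_tcons.
rewrite -[RHS](@fubini_tonelli1 _ _ _ _ _ mu (tuple_measure mu n) (F \o @tcons _ T n))//; last first.
  by move=> p; exact: F0.
rewrite [LHS](@ge0_integral_pushforward _ _ _ _ _ _ (@measurable_tcons _ T n))//.
Qed.

Lemma measurable_tuple_map n (phi : 'I_n -> T -> T) :
  (forall i, measurable_fun setT (phi i)) ->
  measurable_fun setT (fun t : n.-tuple T => [tuple phi i (tnth t i) | i < n]).
Proof.
move=> mphi; apply/measurable_fun_tnthP => i.
apply: (eq_measurable_fun (phi i \o (fun t => tnth t i))).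
  by move=> t _ /=; rewrite tnth_mktuple.
by apply: measurableT_comp => //; exact: measurable_tnth.
Qed.

Lemma integral_tuple_map (J : R) n (phi : 'I_n -> T -> T) :
  (0 <= J)%R -> (forall i, measurable_fun setT (phi i)) ->
  (forall i (F : T -> \bar R), measurable_fun setT F -> (forall x, 0 <= F x) ->
    \int[mu]_x F x = J%:E * \int[mu]_x F (phi i x)) ->
  forall F : n.-tuple T -> \bar R, measurable_fun setT F -> (forall x, 0 <= F x) ->
  \int[tuple_measure mu n]_t F t =
  (J ^+ n)%:E * \int[tuple_measure mu n]_t F [tuple phi i (tnth t i) | i < n].
Proof.
move=> J0; elim: n phi => [|n IH] phi mphi Hphi F mF F0.
  rewrite expr0 mul1e; apply: eq_integral => t _; congr F.
  by apply: eq_from_tnth => -[].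
have mFp := measurable_tuple_map mphi.
rewrite !integral_tupleS//; last by apply: measurableT_comp.
have mG : measurable_fun setT (F \o @tcons _ T n).
  by apply: measurableT_comp => //; exact: measurable_tcons.
have mG1 := measurable_fun_fubini_tonelli_F (m2 := tuple_measure mu n)
  (F \o @tcons _ T n) mG (fun x => F0 _).
rewrite (Hphi ord0 (fun x => \int[tuple_measure mu n]_t F (tcons (x, t))))//; last first.
  by move=> x; apply: integral_ge0 => t _; exact: F0.
rewrite exprS EFinM -muleA; congr (_ * _).
rewrite -ge0_integralZl//; last 3 first.
- apply: (measurable_fun_fubini_tonelli_F (m2 := tuple_measure mu n)
    (fun p => F [tuple phi i (tnth (tcons p) i) | i < n.+1])) => //.
  apply: (measurableT_comp mF); apply: (measurableT_comp mFp).
  exact: measurable_tcons.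
- by move=> x _; apply: integral_ge0 => t _; exact: F0.
- by rewrite lee_fin exprn_ge0.
apply: eq_integral => x _.
rewrite (IH (fun i => phi (lift ord0 i)) _ _ (fun t => F (tcons (phi ord0 x, t))))//.
- congr (_ * _); apply: eq_integral => t _; congr F.
  apply: eq_from_tnth => i; rewrite tnth_mktuple.
  case: (unliftP ord0 i) => [j ->|->]//; rewrite !tnthS/= ?tnth_mktuple//.
- by move=> i F' mF' F'0; exact: Hphi.
- by apply: (measurableT_comp mG); exact: measurable_pair1.
Qed.

End tuple_substitution.

(** * Measurability *)

Section measurable_vectors.
Context {R : realType} {n : nat}.
Local Notation nc := (@Normc.normc R).
Local Notation leb := (@lebesgue_measure R).
Local Notation MR := (measurableTypeR R).
Local Notation C2 := (MR * MR)%type.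
Local Notation X := (n.-tuple C2).
Local Notation Cn := 'rV[C R]_n.

Definition to_coords (z : Cn) : X :=
  [tuple (complex.Re (z 0 i), complex.Im (z 0 i)) | i < n].

Lemma to_coordsK : cancel to_coords (@of_coords R n).
Proof.
move=> z; apply/rowP => j; rewrite mxE tnth_mktuple/=.
by case: (z 0 j).
Qed.

(** Measurability of a C^n-valued map is read off the real coordinates, which carry the measure. *)
Definition mvec d (T : measurableType d) (Z : T -> Cn) := forall j,
  measurable_fun setT (fun p => complex.Re (Z p 0 j) : MR) /\
  measurable_fun setT (fun p => complex.Im (Z p 0 j) : MR).

Section mvec_theory.
Context d (T : measurableType d).
Implicit Types Z W : T -> Cn.

Lemma measurable_to_coords Z : mvec Z -> measurable_fun setT (fun p => to_coords (Z p)).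
Proof.
move=> mZ; apply/measurable_fun_tnthP => i.
apply: (eq_measurable_fun (fun p => (complex.Re (Z p 0 i) : MR, complex.Im (Z p 0 i) : MR))).
  by move=> p _ /=; rewrite tnth_mktuple.
by apply/measurable_fun_pair; have [] := mZ i.
Qed.

Lemma mvec_comp d' (Y : measurableType d') (F : Cn -> Y) Z : mvec Z ->
  measurable_fun setT (fun t => F (@of_coords R n t)) ->
  measurable_fun setT (fun p => F (Z p)).
Proof.
move=> /measurable_to_coords mZ mF.
apply: (eq_measurable_fun ((fun t => F (@of_coords R n t)) \o (fun p => to_coords (Z p)))).
  by move=> p _ /=; rewrite to_coordsK.
exact: measurableT_comp.
Qed.

Lemma mvecD Z W : mvec Z -> mvec W -> mvec (fun p => Z p + W p).
Proof.
move=> mZ mW j; have [z1 z2] := mZ j; have [w1 w2] := mW j; split.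
- apply: (eq_measurable_fun (fun p => complex.Re (Z p 0 j) + complex.Re (W p 0 j))).
    by move=> p _; rewrite mxE ReD.
  exact: measurable_funD.
- apply: (eq_measurable_fun (fun p => complex.Im (Z p 0 j) + complex.Im (W p 0 j))).
    by move=> p _; rewrite mxE ImD.
  exact: measurable_funD.
Qed.

Lemma mvecZ (c : T -> C R) Z : measurable_fun setT (fun p => complex.Re (c p) : MR) ->
  measurable_fun setT (fun p => complex.Im (c p) : MR) -> mvec Z ->
  mvec (fun p => c p *: Z p).
Proof.
move=> m1 m2 mZ j; have [z1 z2] := mZ j; split.
- apply: (eq_measurable_fun (fun p => complex.Re (c p) * complex.Re (Z p 0 j) -
    complex.Im (c p) * complex.Im (Z p 0 j))).
    by move=> p _; rewrite mxE ReM.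
  by apply: measurable_funB; exact: measurable_funM.
- apply: (eq_measurable_fun (fun p => complex.Re (c p) * complex.Im (Z p 0 j) +
    complex.Im (c p) * complex.Re (Z p 0 j))).
    by move=> p _; rewrite mxE ImM.
  by apply: measurable_funD; exact: measurable_funM.
Qed.

Lemma mvec_cst z : mvec (fun _ : T => z).
Proof. by move=> j; split. Qed.

Lemma mvecB Z W : mvec Z -> mvec W -> mvec (fun p => Z p - W p).
Proof.
move=> mZ mW; rewrite (_ : (fun _ => _) = fun p => Z p + (-1) *: W p).
  by apply: mvecD => //; apply: mvecZ.
by apply/funext => p; rewrite scaleN1r.
Qed.

Lemma mvec_of_coords (Z : T -> X) : measurable_fun setT Z ->
  mvec (fun p => @of_coords R n (Z p)).
Proof.
move=> mZ j; have mj : measurable_fun setT (fun p => tnth (Z p) j).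
  exact: (measurableT_comp (measurable_tnth j) mZ).
split.
- apply: (eq_measurable_fun (fun p => (tnth (Z p) j).1)); first by move=> p _; rewrite mxE.
  exact: measurableT_comp.
- apply: (eq_measurable_fun (fun p => (tnth (Z p) j).2)); first by move=> p _; rewrite mxE.
  exact: measurableT_comp.
Qed.

Lemma measurable_norm2 Z : mvec Z -> measurable_fun setT (fun p => norm2 (Z p) : R).
Proof.
move=> mZ.
apply: (eq_measurable_fun (fun p => Num.sqrt
    (\sum_(j < n) (complex.Re (Z p 0 j) ^+ 2 + complex.Im (Z p 0 j) ^+ 2)))).
  by move=> p _; rewrite /norm2 /sqnorm; congr Num.sqrt; apply: eq_bigr => j _; rewrite nc_sqr.
apply: (@measurableT_comp _ _ _ _ _ _ (@Num.sqrt R)).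
  by apply: continuous_measurable_fun; exact: sqrt_continuous.
apply: measurable_sum => j; have [z1 z2] := mZ j.
by apply: measurable_funD; apply: measurable_funX.
Qed.

End mvec_theory.

Lemma mvec_id : mvec (@of_coords R n).
Proof. by apply: mvec_of_coords. Qed.

(** Rounding down to multiples of 1 / (k + 1), recorded by integers: a function that factors through
    it takes countably many values, each on a measurable set, so it is measurable whatever it is. *)
Definition grid (k : nat) (t : X) : n.-tuple (int * int) :=
  [tuple (Num.floor (k.+1%:R * (tnth t i).1), Num.floor (k.+1%:R * (tnth t i).2)) | i < n].

Definition grid_point (k : nat) (a : n.-tuple (int * int)) : Cn :=
  \row_(i < n) (((tnth a i).1%:~R / k.+1%:R) +i* ((tnth a i).2%:~R / k.+1%:R))%C.

Lemma measurable_grid k (a : n.-tuple (int * int)) : measurable (grid k @^-1` [set a]).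
Proof.
have mfl (m : int) : measurable ([set x : MR | Num.floor (k.+1%:R * x) = m]).
  rewrite [X in measurable X](_ : _ = `[m%:~R / k.+1%:R, (m + 1)%:~R / k.+1%:R[%classic)//.
  apply/seteqP; split => x /=; rewrite in_itv/= ler_pdivrMr ?ltr0n// ltr_pdivlMr ?ltr0n//.
    by rewrite [x * _]mulrC => <-; exact: floor_itv.
  by rewrite [x * _]mulrC; exact: floor_def.
pose A i := [set x : C2 | Num.floor (k.+1%:R * x.1) = (tnth a i).1] `&`
  [set x : C2 | Num.floor (k.+1%:R * x.2) = (tnth a i).2].
have mA i : measurable (A i).
  apply: measurableI.
    rewrite -[X in measurable X]setTI.
    exact: (@measurable_fst _ _ MR MR measurableT _ (mfl _)).
  rewrite -[X in measurable X]setTI.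
  exact: (@measurable_snd _ _ MR MR measurableT _ (mfl _)).
rewrite [X in measurable X](_ : _ =
    \bigcap_(i in [set: 'I_n]) ((tnth (T:=C2))^~ i @^-1` A i)).
  apply: fin_bigcap_measurable => // i _.
  by rewrite -[X in measurable X]setTI; exact: measurable_tnth.
apply/seteqP; split => t /=.
  by move=> ga i _ /=; rewrite /A -ga tnth_mktuple.
move=> H; apply: eq_from_tnth => i; rewrite tnth_mktuple.
by have [/= -> ->] := H i Logic.I; case: (tnth a i).
Qed.

Lemma measurable_grid_comp k (F : Cn -> R) :
  measurable_fun setT (fun t => F (grid_point k (grid k t))).
Proof.
move=> _ Y mY; rewrite setTI.
rewrite [X in measurable X](_ : _ = \bigcup_(a : n.-tuple (int * int))
  (if `[< Y (F (grid_point k a)) >] then grid k @^-1` [set a] else set0)).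
  apply: countable_bigcupT_measurable; first exact: countableP.
  by move=> a; case: ifPn => _; [exact: measurable_grid|exact: measurable0].
apply/seteqP; split => t /=.
  by move=> H; exists (grid k t) => //; case: asboolP.
by move=> [a _]; case: asboolP => // H /= ->.
Qed.

Lemma grid_point_near k t : norm2 (grid_point k (grid k t) - of_coords t) <= (2 * n%:R) / k.+1%:R.
Proof.
have fl (x : R) : `|(Num.floor (k.+1%:R * x))%:~R / k.+1%:R - x| <= k.+1%:R^-1.
  have k0 : 0 < k.+1%:R :> R by rewrite ltr0n.
  have := floor_itv (k.+1%:R * x); rewrite intrD => /andP[h1 h2].
  move: (Num.floor _)%:~R k0 h1 h2 => m k0 h1 h2.
  rewrite (_ : _ - x = (m - k.+1%:R * x) / k.+1%:R); last first.
    by rewrite mulrBl [_ * x]mulrC mulfK ?gt_eqF.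
  rewrite normrM (gtr0_norm (_ : 0 < k.+1%:R^-1)) ?invr_gt0//.
  rewrite ler_piMl ?invr_ge0 ?(ltW k0)// ler_norml; apply/andP; split; lra.
apply: (le_trans (norm2_le_sum _)).
have -> : 2 * n%:R / k.+1%:R = \sum_(i < n) (2 / k.+1%:R) :> R.
  by rewrite sumr_const card_ord -[RHS]mulr_natl; ring.
apply: ler_sum => i _; rewrite !mxE tnth_mktuple.
apply: (le_trans (nc_le_ReIm _)); rewrite ReB ImB/=.
by rewrite mulrDl mul1r; apply: lerD; exact: fl.
Qed.

(** Inside the ball u is the pointwise limit of its values at grid points. Some grid points may lie
    outside the ball, but for large k only those within d of the given point count. *)
Lemma continuous_on_ball_measurable (u : Cn -> R) :
  (forall z, norm2 z < 1 -> forall e : R, 0 < e ->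
    exists2 d : R, 0 < d & forall h, norm2 h < d -> `|u (z + h) - u z| <= e) ->
  measurable_fun setT (fun t => if norm2 (@of_coords R n t) < 1 then u (of_coords t) else 0).
Proof.
move=> cu.
have mN : measurable_fun setT (fun t => norm2 (@of_coords R n t) : R).
  exact: measurable_norm2 mvec_id.
have mb : measurable_fun setT (fun t => norm2 (@of_coords R n t) < 1).
  exact: measurable_fun_ltr.
apply: measurable_fun_if => //.
apply: (@measurable_fun_cvg _ _ _ _ (fun k t => u (grid_point k (grid k t)))).
  move=> k; apply: (@measurable_funS _ _ _ _ setT) => //; exact: measurable_grid_comp.
move=> t /= [_ /= t1]; apply/cvgrPdist_le => e e0.
have [d d0 dP] := cu _ t1 e e0.
exists (Num.bound (2 * n%:R / d)) => // k /= kd.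
have K0 : 0 <= 2 * n%:R / d :> R by rewrite divr_ge0 ?mulr_ge0 ?(ltW d0).
have := dP (grid_point k (grid k t) - of_coords t).
rewrite [of_coords t + _]addrC subrK distrC; apply; apply: (le_lt_trans (grid_point_near k t)).
rewrite ltr_pdivrMr ?ltr0n// [d * _]mulrC -ltr_pdivrMr//.
by rewrite (lt_le_trans (archi_boundP K0))// ler_nat (leq_trans kd).
Qed.

Lemma holomorphic_nc_measurable (f : Cn -> C R) (Phi : R -> R) : holomorphic f ->
  (forall t, 0 <= t -> forall e : R, 0 < e -> exists2 d : R, 0 < d &
     forall s, 0 <= s -> `|s - t| < d -> `|Phi s - Phi t| <= e) ->
  measurable_fun setT
    (fun t => if norm2 (@of_coords R n t) < 1 then Phi (nc (f (of_coords t))) else 0).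
Proof.
move=> /holomorphicE hf cP; apply: (continuous_on_ball_measurable (u := fun z => Phi (nc (f z)))).
move=> z z1 e e0; have [d d0 dP] := cP (nc (f z)) (nc_ge0 _) e e0.
have := differentiable_continuous (hf z z1).
move/(@cvgrPdist_lt _ _ _ (nbhs z) (nbhs_filter z)) => /(_ (d%:C)%C).
rewrite ltcR => /(_ d0)/near_norm2[r r0 rP].
exists r => // h hr; apply: dP; first exact: nc_ge0.
have := rP (z + h); rewrite addrAC subrr add0r => /(_ hr).
rewrite normC_nc ltcR => H.
have := ncD (f z - f (z + h)) (f (z + h)); have := ncD (f (z + h) - f z) (f z).
by rewrite !subrK [nc (f (z + h) - f z)]ncB ltr_norml => h1 h2; apply/andP; split; lra.
Qed.

End measurable_vectors.

(** * Integration on C^n *)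

Section integral_on_Cn.
Context {R : realType} {n : nat}.
Local Notation nc := (@Normc.normc R).
Local Notation leb := (@lebesgue_measure R).
Local Notation MR := (measurableTypeR R).
Local Notation C2 := (MR * MR)%type.
Local Notation X := (n.-tuple C2).
Local Notation Cn := 'rV[C R]_n.
Implicit Types (F G : Cn -> \bar R) (z w x y : Cn) (u v : Cn -> R).

Definition mI F : \bar R := (\int[lebesgueC R n]_t F (of_coords t))%E.

Definition emeas F := measurable_fun setT (fun t => F (@of_coords R n t)).

Definition rmeas (u : Cn -> R) := measurable_fun setT (fun t => u (@of_coords R n t)).

Lemma rmeas_emeas u : rmeas u -> emeas (fun z => (u z)%:E).
Proof. by move=> mu; apply/measurable_EFinP. Qed.

Lemma mI_ge0 F : (forall z, 0 <= F z)%E -> (0 <= mI F)%E.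
Proof. by move=> F0; apply: integral_ge0 => t _; exact: F0. Qed.

Lemma mI_le F G : emeas F -> emeas G -> (forall z, 0 <= F z)%E ->
  (forall z, F z <= G z)%E -> (mI F <= mI G)%E.
Proof.
by move=> mF mG F0 FG; apply: ge0_le_integral.
Qed.

Lemma mI_Z (k : R) F : 0 <= k -> emeas F -> (forall z, 0 <= F z)%E ->
  mI (fun z => k%:E * F z)%E = (k%:E * mI F)%E.
Proof. by move=> k0 mF F0; rewrite /mI ge0_integralZl. Qed.

Lemma mI_D F G : emeas F -> emeas G -> (forall z, 0 <= F z)%E ->
  (forall z, 0 <= G z)%E -> mI (fun z => F z + G z)%E = (mI F + mI G)%E.
Proof. by move=> mF mG F0 G0; rewrite /mI ge0_integralD. Qed.

Lemma eq_mI F G : F =1 G -> mI F = mI G.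
Proof. by move=> FG; apply: eq_integral => t _; rewrite FG. Qed.

(** Each complex coordinate contributes the real Jacobian |c|^2, whence the exponent 2 n. *)
Lemma mI_affine (c : C R) w F : c != 0 -> emeas F -> (forall z, 0 <= F z)%E ->
  mI F = (((nc c) ^+ (2 * n))%:E * mI (fun z => F (c *: z + w)%R))%E.
Proof.
move=> c0 mF F0.
rewrite /mI [LHS](@integral_tuple_map _ _ _ _ (nc c ^+ 2) n
    (fun i => caff c (w 0 i)) _ _ _ (fun t => F (of_coords t)))//.
- rewrite exprM; congr (_ * _)%E; apply: eq_integral => t _; congr F.
  by apply/rowP => j; rewrite !mxE tnth_mktuple; exact: caffE.
- by rewrite exprn_ge0 ?nc_ge0.
- by move=> i; exact: measurable_caff.
- by move=> i H mH H0; exact: integral_caff.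
Qed.

Lemma mI_tonelli (K : Cn -> Cn -> \bar R) :
  measurable_fun setT (fun p : X * X => K (@of_coords R n p.1) (@of_coords R n p.2)) ->
  (forall x y, 0 <= K x y)%E ->
  mI (fun x => mI (K x)) = mI (fun y => mI (K ^~ y)).
Proof.
move=> mK K0.
exact: (@fubini_tonelli _ _ _ _ _ (lebesgueC R n) (lebesgueC R n)
  (fun p : X * X => K (of_coords p.1) (of_coords p.2)) mK (fun p => K0 _ _)).
Qed.

Lemma mI_tonelli_real (K : R -> Cn -> \bar R) :
  measurable_fun setT (fun p : MR * X => K p.1 (@of_coords R n p.2)) ->
  (forall t y, 0 <= K t y)%E ->
  (\int[leb]_t mI (K t) = mI (fun y => \int[leb]_t K t y))%E.
Proof.
move=> mK K0.
exact: (@fubini_tonelli _ _ _ _ _ leb (lebesgueC R n)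
  (fun p : MR * X => K p.1 (of_coords p.2)) mK (fun p => K0 _ _)).
Qed.

Definition ball_fn (d : R) w z : R := (norm2 (z - w) < d)%R%:R.

Lemma ball_fn_ge0 (d : R) w z : 0 <= ball_fn d w z. Proof. exact: ler0n. Qed.

Lemma measurable_bool_fn d (T : measurableType d) (b : T -> bool) :
  measurable_fun setT b -> measurable_fun setT (fun t => (b t)%:R : R).
Proof.
move=> mb; apply: (eq_measurable_fun (fun t => if b t then (1 : R) else 0)).
  by move=> t _; case: (b t).
exact: measurable_fun_ifT.
Qed.

Lemma measurable_ball_fn dd (T : measurableType dd) (D : T -> R) (W Z : T -> Cn) :
  measurable_fun setT D -> mvec W -> mvec Z ->
  measurable_fun setT (fun t => ball_fn (D t) (W t) (Z t)).
Proof.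
move=> mD mW mZ; apply: measurable_bool_fn; apply: measurable_fun_ltr => //.
by apply: measurable_norm2; exact: mvecB.
Qed.

Lemma rmeas_ball_fn (d : R) w : rmeas (ball_fn d w).
Proof.
apply: (@measurable_ball_fn _ _ (fun=> d) (fun=> w) (@of_coords R n)) => //.
exact: mvec_id.
Qed.

Lemma emeas_affine (c : C R) w F : emeas F -> emeas (fun z => F (c *: z + w)).
Proof.
move=> mF; apply: (mvec_comp (F := F)) => //; apply: mvecD; last exact: mvec_cst.
by apply: mvecZ => //; exact: mvec_id.
Qed.

(** The volume of the unit ball; its value is never computed, only finiteness and positivity
    matter. *)
Definition vol : R := fine (mI (fun z => (ball_fn 1 0 z)%:E)).

Lemma box_measure (e : R) : 0 < e ->
  lebesgueC R n [set t | forall i, (`](- e), e[%classic `*` `](- e), e[%classic) (tnth t i)] =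
  ((2 * e) ^+ 2 ^+ n)%:E.
Proof.
move=> e0; rewrite [LHS](@tuple_measureE _ _ _ (prod_sf leb leb) n
    (fun=> (`](- e), e[%classic `*` `](- e), e[%classic))) => [|i]; last first.
  by apply: measurableX; exact: measurable_itv.
rewrite (eq_bigr (fun=> ((2 * e) ^+ 2)%:E)) => [|i _].
  by rewrite prodEFin prodr_const card_ord.
have L : leb `](- e), e[%classic = (2 * e)%:E.
  rewrite lebesgue_measure_itv/= lte_fin (_ : - e < e); last lra.
  by rewrite -EFinD; congr EFin; ring.
set I := [set` _] in L *; transitivity (leb I * leb I)%E.
  by apply: product_measure1E; exact: measurable_itv.
by rewrite L -EFinM expr2.
Qed.

Lemma mI_box (e : R) (u : Cn -> \bar R) : 0 < e ->
  u = (fun z => ([forall i : 'I_n, (`|complex.Re (z 0 i)| < e) && (`|complex.Im (z 0 i)| < e)]%R%:R)%:E) ->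
  emeas u /\ mI u = ((2 * e) ^+ 2 ^+ n)%:E.
Proof.
move=> e0 ->.
pose A := [set t : X | forall i, (`](- e), e[%classic `*` `](- e), e[%classic) (tnth t i)].
have mA : measurable A.
  rewrite /A [X in measurable X](_ : _ = \bigcap_(i in [set: 'I_n])
     ((tnth (T:=C2))^~ i @^-1` (`](- e), e[%classic `*` `](- e), e[%classic))).
    apply: fin_bigcap_measurable => // i _.
    rewrite -[X in measurable X]setTI; apply: measurable_tnth => //.
    by apply: measurableX; exact: measurable_itv.
  by apply/seteqP; split => t /= H i; [move=> _|]; apply: H.
have E t : [forall i : 'I_n, (`|complex.Re (@of_coords R n t 0 i)| < e) &&
    (`|complex.Im (@of_coords R n t 0 i)| < e)]%R%:R = \1_A t :> R.
  rewrite indicE; congr (nat_of_bool _)%:R; apply/forallP/idP.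
    move=> H; rewrite inE => i; have := H i; rewrite mxE/= => /andP[h1 h2].
    by split; rewrite /= in_itv/= -ltr_norml.
  rewrite inE => H i; have [] := H i; rewrite /= !in_itv/= -!ltr_norml mxE/=.
  by move=> -> ->.
split.
  apply: (eq_measurable_fun (fun t => (\1_A t)%:E)); first by move=> t _; rewrite E.
  by apply/measurable_EFinP; exact: measurable_indic.
transitivity (\int[lebesgueC R n]_t (\1_A t)%:E)%E.
  by apply: eq_integral => t _; rewrite E.
by rewrite integral_indic// setIT -(box_measure e0).
Qed.

Lemma mI_ball1 : mI (fun z => (ball_fn 1 0 z)%:E) = vol%:E /\ 0 < vol.
Proof.
have mB := rmeas_emeas (rmeas_ball_fn 1 0).
have [mU U] := mI_box (@ltr01 R) erefl.
(* The ball lies between two cubes. In the cube of half-side e the sum of the 2 n absolute values of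
   real coordinates is at most 2 n e < 1, so the smaller cube is inside the ball. *)
pose e : R := (2 * n%:R + 1)^-1.
have e0 : 0 < e by rewrite invr_gt0 ltr_wpDl ?mulr_ge0.
have [ml L] := mI_box e0 erefl.
have le1 : (mI (fun z => (ball_fn 1 0 z)%:E) <= ((2 * 1) ^+ 2 ^+ n)%:E)%E.
  rewrite -U; apply: mI_le => // z; rewrite lee_fin ?ball_fn_ge0// /ball_fn subr0.
  case: ltP => // z1; rewrite (_ : [forall i, _] = true)//; apply/forallP => i.
  have := norm2_coord z i; have := nc_Re (z 0 i); have := nc_Im (z 0 i) => h1 h2 h3.
  by apply/andP; split; rewrite (le_lt_trans _ z1)//; [apply: le_trans h3|apply: le_trans h3].
have le2 : (((2 * e) ^+ 2 ^+ n)%:E <= mI (fun z => (ball_fn 1 0 z)%:E))%E.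
  rewrite -L; apply: mI_le => // z; rewrite lee_fin ?ler0n// /ball_fn subr0.
  case: forallP => // H; case: ltP => // z1; exfalso; move: z1; apply/negP; rewrite -ltNge.
  apply: (le_lt_trans (norm2_le_sum z)).
  apply: (@le_lt_trans _ _ (\sum_(i < n) (2 * e))).
    apply: ler_sum => i _; apply: (le_trans (nc_le_ReIm _)).
    by have /andP[/ltW h1 /ltW h2] := H i; rewrite mulr_natl mulr2n lerD.
  rewrite sumr_const card_ord -[_ *+ n]mulr_natl mulrA [n%:R * 2]mulrC.
  have n1 : 0 < 2 * n%:R + 1 :> R by rewrite ltr_wpDl ?mulr_ge0.
  by rewrite ltr_pdivrMr// mul1r ltrDl.
have fin : mI (fun z => (ball_fn 1 0 z)%:E) \is a fin_num.
  rewrite ge0_fin_numE; first by rewrite (le_lt_trans le1)// ltry.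
  by apply: mI_ge0 => z; rewrite lee_fin ball_fn_ge0.
split; first by rewrite fineK.
rewrite -lte_fin fineK//; apply: lt_le_trans le2.
by rewrite lte_fin !exprn_gt0// mulr_gt0.
Qed.

Lemma vol_gt0 : 0 < vol. Proof. by have [] := mI_ball1. Qed.

Lemma mI_ball (d : R) w : 0 < d -> mI (fun z => (ball_fn d w z)%:E) = (d ^+ (2 * n) * vol)%:E.
Proof.
move=> d0; have dC : (d%:C)%C != 0 :> C R by rewrite -nc_eq0 ncR normr_eq0 gt_eqF.
have mB := rmeas_emeas (rmeas_ball_fn d w).
rewrite (mI_affine w dC mB)//; last by move=> z; rewrite lee_fin ball_fn_ge0.
rewrite ncR gtr0_norm// EFinM; congr (_ * _)%E; rewrite -mI_ball1.1; apply: eq_mI => z.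
by rewrite /ball_fn addrK subr0 norm2_scaleR ?(ltW d0)// gtr_pMr.
Qed.

(** Functions on the ball are total on C^n with arbitrary values outside; cutting them off turns
    integrals over the ball into integrals over C^n, where substitutions and Tonelli apply. *)
Definition ext (u : Cn -> R) z : R := if norm2 z < 1 then u z else 0.

Lemma rmeasM u v : rmeas u -> rmeas v -> rmeas (fun z => u z * v z).
Proof. exact: measurable_funM. Qed.

Lemma rmeas_nc (f : Cn -> C R) : holomorphic f -> rmeas (ext (fun z => nc (f z))).
Proof.
move=> hf; apply: (holomorphic_nc_measurable (Phi := id)) => // t _ e e0.
by exists e => // s _ /ltW.
Qed.

Lemma measurable_cis : measurable_fun setT (fun t : MR => complex.Re (cis t) : MR) /\
  measurable_fun setT (fun t : MR => complex.Im (cis t) : MR).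
Proof.
have H (h : R -> R) : continuous h -> measurable_fun setT (fun t : MR => expR 0 * h (2 * pi * t) : MR).
  move=> ch; apply: measurable_funM => //.
  apply: (measurableT_comp (continuous_measurable_fun ch)).
  exact: measurable_funM.
by split; apply: H; [exact: continuous_cos|exact: continuous_sin].
Qed.

(** The mean value property on a circle in the complex line through x and x + v. The indicator of
    [0, 1] sits inside the integrand in view of Tonelli. *)
Lemma circle_mean (f : Cn -> C R) x (v : Cn) (d : R) :
  (forall y, norm2 (y - x) < d -> differentiable f y) -> norm2 v < d ->
  ((nc (f x))%:E <= \int[leb]_t (((0 <= t <= 1)%R%:R * nc (f (cis t *: v + x)))%R%:E))%E.
Proof.
move=> df vd.
have dk (l : C R) : nc (l - 0) <= 1 -> differentiable (fun l : C R => f (x + l *: v)) l.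
  rewrite subr0 => l1; apply: differentiable_slice; apply: df.
  by rewrite norm2_slice (le_lt_trans _ vd)// ler_piMl ?norm2_ge0.
have bm := bmeas_circle ltr01 dk.
have := mean_value_circle ltr01 dk; rewrite scale0r addr0 => E.
pose h (t : R) := nc (f (x + ((0 : C R) + 1 * cis t) *: v)).
have mh : measurable_fun (`[(0:R), (1:R)]%classic) h.
  apply: (eq_measurable_fun (fun t => Num.sqrt
    (complex.Re (f (x + ((0 : C R) + 1 * cis t) *: v)) ^+ 2 +
     complex.Im (f (x + ((0 : C R) + 1 * cis t) *: v)) ^+ 2))).
    by move=> t _; rewrite /h -nc_sqr sqrtr_sqr ger0_norm ?nc_ge0.
  apply: (measurableT_comp (f := @Num.sqrt R)).
    by apply: continuous_measurable_fun; exact: sqrt_continuous.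
  by have [m1 m2 _] := bm; apply: measurable_funD; apply: measurable_funX.
have ih : leb.-integrable `[(0:R), (1:R)] (EFin \o h).
  have [_ _ [M hM]] := bm; apply: (bounded01_integrable mh (M := M)) => t t01.
  by rewrite ger0_norm ?nc_ge0// hM.
have := nc_IC_le_int bm ih (fun t _ => lexx _); rewrite E -lee_fin => H.
apply: (le_trans H); rewrite /Rintegral fineK; last exact: integrable_fin_num.
rewrite integral_mkcond le_eqVlt; apply/orP; left; apply/eqP.
apply: eq_integral => t _; rewrite patchE mem_setE in_itv/=; case: ifP => _.
  by rewrite mul1r /= /h add0r mul1r addrC.
by rewrite mul0r.
Qed.

End integral_on_Cn.

(** * Sub-mean value property of growth functions of holomorphic functions *)

Section area_mean.
Context {R : realType} {n : nat}.
Local Notation nc := (@Normc.normc R).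
Local Notation leb := (@lebesgue_measure R).
Local Notation MR := (measurableTypeR R).
Local Notation C2 := (MR * MR)%type.
Local Notation X := (n.-tuple C2).
Local Notation Cn := 'rV[C R]_n.
Implicit Types (x y z w : Cn).

Lemma ext_ge0 (u : Cn -> R) z : (forall z, 0 <= u z) -> 0 <= ext u z.
Proof. by move=> u0; rewrite /ext; case: ifP. Qed.

(** [circle_mean] is integrated over v in the ball of radius d and the integrals are exchanged. For
    fixed t the substitution y = cis t v + x preserves Lebesgue measure and the ball, which takes
    the place of polar coordinates. *)
Lemma area_mean (f : Cn -> C R) x (d : R) : holomorphic f -> 0 < d -> norm2 x + d <= 1 ->
  ((d ^+ (2 * n) * (@vol R n) * nc (f x))%:E <=
   mI (fun y => (ball_fn d x y * ext (fun z => nc (f z)) y)%:E))%E.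
Proof.
move=> hf d0 xd1; pose U y := ball_fn d x y * ext (fun z => nc (f z)) y.
have mU : rmeas U by apply: rmeasM; [exact: rmeas_ball_fn|exact: rmeas_nc].
have U0 y : 0 <= U y.
  by rewrite mulr_ge0 ?ball_fn_ge0 ?ext_ge0// => z; exact: nc_ge0.
have Uball v : norm2 v < d -> U (v + x) = nc (f (v + x)).
  move=> vd; rewrite /U /ball_fn addrK vd mul1r /ext (_ : norm2 (v + x) < 1)//.
  by rewrite (le_lt_trans (norm2D _ _))//; lra.
pose K (t : R) (v : Cn) : \bar R := ((0 <= t <= 1)%R%:R * U (cis t *: v + x))%:E.
have mK : measurable_fun setT (fun p : MR * X => K p.1 (@of_coords R n p.2)).
  apply/measurable_EFinP; apply: measurable_funM.
    apply: measurable_bool_fn; apply: measurable_and; apply: measurable_fun_ler => //.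
  apply: (mvec_comp (F := U)) => //; apply: mvecD; last exact: mvec_cst.
  apply: mvecZ.
  - exact: (measurableT_comp (@measurable_cis R).1 measurable_fst).
  - exact: (measurableT_comp (@measurable_cis R).2 measurable_fst).
  - exact: mvec_of_coords.
have K0 t v : (0 <= K t v)%E by rewrite lee_fin mulr_ge0 ?ler0n.
have KU t : mI (K t) = ((0 <= t <= 1)%R%:R%:E * mI (fun y => (U y)%:E))%E.
  have c0 : cis t != 0 :> C R by rewrite -nc_eq0 nc_cis oner_eq0.
  have mU' := emeas_affine (cis t) x (rmeas_emeas mU).
  rewrite [mI (fun y => (U y)%:E)](mI_affine x c0 (rmeas_emeas mU))//.
  rewrite nc_cis expr1n mul1e.
  have F0 z : (0 <= (U (cis t *: z + x))%:E)%E by rewrite lee_fin.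
  by rewrite -(@mI_Z R n ((0 <= t <= 1)%R%:R) _ (ler0n _ _) mU' F0).
have step : (mI (fun v : Cn => (ball_fn d 0 v * nc (f x))%:E) <=
    mI (fun v : Cn => \int[leb]_t K t v))%E.
  apply: mI_le.
  - apply: rmeas_emeas; apply: (rmeasM (v := fun=> nc (f x)) (rmeas_ball_fn d 0)).
    exact: measurable_cst.
  - exact: (measurable_fun_fubini_tonelli_G (m1 := leb)
      (fun p : MR * X => K p.1 (@of_coords R n p.2)) mK (fun p => K0 _ _)).
  - by move=> v; rewrite lee_fin mulr_ge0 ?ball_fn_ge0 ?nc_ge0.
  - move=> v; rewrite /ball_fn subr0; case: ltP => [vd|_]; last first.
      by rewrite mul0r; apply: integral_ge0.
    rewrite mul1r; apply: (le_trans (circle_mean _ vd)).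
      move=> y /= yd; apply: ((holomorphicE f).1 hf).
      by have := norm2D (y - x) x; rewrite subrK; lra.
    rewrite le_eqVlt; apply/orP; left; apply/eqP; apply: eq_integral => t _.
    by rewrite /K Uball// norm2Z nc_cis mul1r.
rewrite -mI_tonelli_real// in step.
have E1 : (\int[leb]_t mI (K t) = mI (fun y => (U y)%:E))%E.
  transitivity (\int[leb]_t ((0 <= (t : R) <= 1)%R%:R%:E * mI (fun y => (U y)%:E)))%E.
    by apply: eq_integral => t _; exact: KU.
  have UG : (0 <= mI (fun y => (U y)%:E))%E by apply: mI_ge0 => y; rewrite lee_fin.
  rewrite ge0_integralZr//; last first.
    apply/measurable_EFinP; apply: measurable_bool_fn.
    by apply: measurable_and; apply: measurable_fun_ler.
  transitivity ((\int[leb]_t (\1_(`[(0:R), (1:R)]%classic) t)%:E) * mI (fun y => (U y)%:E))%E.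
    congr (_ * _)%E; apply: eq_integral => t _.
    by rewrite indicE mem_setE in_itv.
  rewrite integral_indic//= setIT lebesgue_measure_itv/= lte_fin ltr01 oppr0 adde0.
  by rewrite mul1e.
rewrite E1 in step; apply: le_trans step.
rewrite (eq_mI (G := fun v => ((nc (f x))%:E * (ball_fn d 0 v)%:E)%E)).
  rewrite mI_Z ?nc_ge0//; last 2 first.
  - exact: rmeas_emeas (rmeas_ball_fn d 0).
  - by move=> z; rewrite lee_fin ball_fn_ge0.
  by rewrite mI_ball// -EFinM lee_fin mulrC.
by move=> v; rewrite -EFinM mulrC.
Qed.

End area_mean.

Section submean.
Context {R : realType}.
Local Notation nc := (@Normc.normc R).
Variable Phi : R -> R.
Hypothesis Phi_ge0 : forall t, 0 <= t -> 0 <= Phi t.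
Hypothesis Phi_cont : forall t, 0 <= t -> forall e : R, 0 < e ->
  exists2 d : R, 0 < d & forall s, 0 <= s -> `|s - t| < d -> `|Phi s - Phi t| <= e.
Hypothesis Phi_mono : forall s t, 0 <= s -> s <= t -> Phi s <= Phi t.

Variable n : nat.
Local Notation Cn := 'rV[C R]_n.
Implicit Types (x y z w : Cn) (f : Cn -> C R).

Definition orlicz f z : R := ext (fun z => Phi (nc (f z))) z.

Lemma rmeas_orlicz f : holomorphic f -> rmeas (orlicz f).
Proof. by move=> hf; exact: (holomorphic_nc_measurable hf Phi_cont). Qed.

Lemma orlicz_ge0 f z : 0 <= orlicz f z.
Proof. by apply: ext_ge0 => y; exact/Phi_ge0/nc_ge0. Qed.

Definition local_int f (d : R) x : \bar R := mI (fun y => (ball_fn d x y * orlicz f y)%:E).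

Lemma emeas_local f (d : R) x : holomorphic f ->
  emeas (fun y => (ball_fn d x y * orlicz f y)%:E).
Proof.
by move=> hf; apply: rmeas_emeas; apply: rmeasM; [exact: rmeas_ball_fn|exact: rmeas_orlicz].
Qed.

Lemma local_ge0 f (d : R) x y : (0 <= (ball_fn d x y * orlicz f y)%:E)%E.
Proof. by rewrite lee_fin mulr_ge0 ?ball_fn_ge0 ?orlicz_ge0. Qed.

Lemma local_int_ge0 f (d : R) x : (0 <= local_int f d x)%E.
Proof. by apply: mI_ge0 => y; exact: local_ge0. Qed.

(** An inequality u <= a + b Phi(u) for the values u of |f| in the ball carries [area_mean] over
    from |f| to Phi(|f|). The two classes differ in the choice of a and b. *)
Lemma mean_le_affine f x (d a b : R) : holomorphic f -> 0 < d -> norm2 x + d <= 1 ->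
  0 <= a -> 0 <= b -> (forall y, norm2 (y - x) < d -> nc (f y) <= a + b * Phi (nc (f y))) ->
  ((d ^+ (2 * n) * (@vol R n) * nc (f x))%:E <=
   (a * (d ^+ (2 * n) * (@vol R n)))%:E + b%:E * local_int f d x)%E.
Proof.
move=> hf d0 xd a0 b0 H; apply: (le_trans (area_mean hf d0 xd)).
have mB := rmeas_emeas (rmeas_ball_fn d x).
have B0 y : (0 <= (ball_fn d x y)%:E)%E by rewrite lee_fin ball_fn_ge0.
rewrite EFinM -(mI_ball x d0) -mI_Z// -mI_Z//; [|exact: emeas_local|exact: local_ge0].
rewrite -mI_D//; last 4 first.
- by apply: (@emeasurable_funM _ _ _ _ (fun=> a%:E)).
- by apply: (@emeasurable_funM _ _ _ _ (fun=> b%:E)) => //; exact: emeas_local.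
- by move=> z; rewrite mule_ge0.
- by move=> z; rewrite mule_ge0// local_ge0.
apply: mI_le.
- by apply: rmeas_emeas; apply: rmeasM; [exact: rmeas_ball_fn|exact: rmeas_nc].
- apply: emeasurable_funD; apply: emeasurable_funM => //; exact: emeas_local.
- by move=> z; rewrite lee_fin mulr_ge0 ?ball_fn_ge0 ?ext_ge0// => y; exact: nc_ge0.
move=> z; rewrite -!EFinM -EFinD lee_fin /ball_fn; case: ltP => [zx|_]; last first.
  by rewrite !mul0r !mulr0 addr0.
have z1 : norm2 z < 1 by have := norm2D (z - x) x; rewrite subrK; lra.
by rewrite !mul1r mulr1 /orlicz /ext z1 H.
Qed.

Definition submean_property := exists2 K : R, 0 < K &
  forall f x (d : R), holomorphic f -> 0 < d -> norm2 x + d < 1 ->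
  ((d ^+ (2 * n) * Phi (nc (f x)))%:E <= K%:E * local_int f d x)%E.

Lemma submean_intro (K : R) : 0 < K ->
  (forall f x (d J : R), holomorphic f -> 0 < d -> norm2 x + d < 1 ->
    0 < Phi (nc (f x)) -> 0 <= J -> local_int f d x = J%:E ->
    d ^+ (2 * n) * Phi (nc (f x)) <= K * J) -> submean_property.
Proof.
move=> K0 H; exists K => // f x d hf d0 xd.
have [P0|P0] := ltP 0 (Phi (nc (f x))); last first.
  have -> : Phi (nc (f x)) = 0 by apply/eqP; rewrite eq_le P0 Phi_ge0// nc_ge0.
  by rewrite mulr0 mule_ge0 ?local_int_ge0// lee_fin ltW.
have := local_int_ge0 f d x; case E : (local_int f d x) => [J| |]// J0.
- by rewrite -EFinM lee_fin; apply: H.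
- by rewrite gt0_muley ?lte_fin// leey.
Qed.

(** Let a = |f(x)|. Values of |f| up to a / 2 are bounded by a / 2; for larger values u,
    monotonicity of Phi(t) / t gives u <= (a / 2) Phi(u) / Phi(a / 2). Half of the left-hand side
    absorbs the first term, and doubling passes from Phi(a / 2) to Phi(a). *)
Lemma submean_nondecreasing (K : R) : 0 < K ->
  (forall s t, 0 < s -> s <= t -> Phi s / s <= Phi t / t) ->
  (forall s, 0 < s -> Phi (s * 2) <= K * Phi s) -> Phi 0 = 0 -> submean_property.
Proof.
move=> K0 incr dbl Ph0.
apply: (@submean_intro (K / (@vol R n))); first by rewrite divr_gt0 ?vol_gt0.
move=> f x d J hf d0 xd P0 J0 EJ; set a := nc (f x) in P0 *.
have a0 : 0 < a.
  by rewrite lt_def nc_ge0 andbT; apply: contraTneq P0 => ->; rewrite Ph0 ltxx.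
have a2 : 0 < a / 2 by rewrite divr_gt0.
have PA : 0 < Phi (a / 2).
  have := dbl _ a2; rewrite divfK// => H.
  by have := lt_le_trans P0 H; rewrite pmulr_rgt0.
have xd' : norm2 x + d <= 1 by rewrite ltW.
have b0 : 0 <= (a / 2) / Phi (a / 2) by rewrite divr_ge0 ?ltW.
have := @mean_le_affine f x d (a / 2) ((a / 2) / Phi (a / 2)) hf d0 xd' (ltW a2) b0.
rewrite EJ -EFinM -EFinD lee_fin -/a => H.
have {}H := H _.
have dn : 0 < d ^+ (2 * n) by rewrite exprn_gt0.
have v0 := @vol_gt0 R n.
have H1 : d ^+ (2 * n) * (@vol R n) * a <= a / 2 * (d ^+ (2 * n) * (@vol R n)) + a / 2 / Phi (a / 2) * J.
  apply: H => y yx; have [ya|ya] := leP (nc (f y)) (a / 2).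
    by rewrite (le_trans ya)// lerDl mulr_ge0 ?Phi_ge0 ?nc_ge0.
  have y0 : 0 < nc (f y) by exact: lt_trans ya.
  have := incr _ _ a2 (ltW ya); rewrite ler_pdivlMr// => H2.
  rewrite -[leLHS]add0r lerD ?(ltW a2)//.
  by rewrite -ler_pdivrMl ?divr_gt0// invf_div.
have H2 : Phi (a / 2) * (d ^+ (2 * n) * (@vol R n)) <= J.
  set V := d ^+ (2 * n) * (@vol R n) in H1 *.
  have h : a / 2 * V <= a / 2 / Phi (a / 2) * J by lra.
  by rewrite -ler_pdivlMl// -(ler_pM2l a2) [leRHS]mulrA.
have := dbl _ a2; rewrite divfK// => H3.
rewrite [K / _ * J]mulrAC ler_pdivlMr//.
have : K * (Phi (a / 2) * (d ^+ (2 * n) * (@vol R n))) <= K * J by rewrite ler_pM2l.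
have : Phi a * (d ^+ (2 * n) * (@vol R n)) <= K * Phi (a / 2) * (d ^+ (2 * n) * (@vol R n)).
  by rewrite ler_wpM2r// mulr_ge0 ?ltW.
lra.
Qed.

(* Hardy-Littlewood's argument: near a point nearly maximizing (d - |y - x|)^(2n) Phi(|f y|), |f| is comparable to its value there, so that the concave function Phi is comparable to a linear one. *)
Lemma submean_nonincreasing (p K : R) : 0 < p -> 0 < K ->
  (forall s t, 0 < s -> s <= t -> Phi t / t <= Phi s / s) ->
  (forall s t, 0 < s -> 0 < t -> t <= 1 -> Phi (s * t) <= K * t `^ p * Phi s) ->
  Phi 0 = 0 -> submean_property.
Proof.
move=> p0 K0 decr low Ph0.
(* L will bound Phi(|f y|) / Phi(|f y0|) for y within r of y0: the factor 2 is near-maximality of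
   y0, and 2^(2n) arises since d - |y0 - x| = 2 r while d - |y - x| >= r. B inverts lower type:
   Phi(u) <= L Phi(u0) implies u <= B u0. *)
pose L : R := 2 * 2 ^+ (2 * n); have L0 : 0 < L by rewrite mulr_gt0// exprn_gt0.
pose B : R := Num.max 1 ((K * L) `^ p^-1).
have B1 : 1 <= B by rewrite le_max lexx.
have v0 := @vol_gt0 R n.
have B0 : 0 < B by exact: lt_le_trans B1.
apply: (@submean_intro (L * B / (@vol R n))); first by rewrite divr_gt0// mulr_gt0.
move=> f x d J hf d0 xd P0 J0 EJ.
have [M M0 fM] : exists2 M, 0 <= M & forall z, norm2 z <= norm2 x + d -> nc (f z) <= M.
  by apply: holomorphic_bounded => z zx; apply: ((holomorphicE f).1 hf); lra.
have near_ y (r : R) : norm2 (y - x) < r -> norm2 y <= norm2 x + r.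
  by move=> h; have := norm2D (y - x) x; rewrite subrK; lra.
pose q y := (d - norm2 (y - x)) ^+ (2 * n) * Phi (nc (f y)).
pose S := [set q y | y in [set y | norm2 (y - x) < d]].
have Sx : S (q x) by exists x => //=; rewrite subrr norm20.
have hS : has_sup S.
  split; first by exists (q x).
  exists (d ^+ (2 * n) * Phi M) => _ [y /= yx <-].
  apply: ler_pM; rewrite ?exprn_ge0 ?Phi_ge0 ?nc_ge0 ?subr_ge0 ?(ltW yx)//.
    apply: lerXn2r; rewrite ?nnegrE ?subr_ge0 ?(ltW yx) ?(ltW d0)//.
    by rewrite lerBlDr lerDl norm2_ge0.
  by apply: Phi_mono; [exact: nc_ge0|apply: fM; exact: near_].
pose A := sup S.
have qA y : norm2 (y - x) < d -> q y <= A.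
  by move=> yx; apply: ub_le_sup; [case: hS|exists y].
have qx : d ^+ (2 * n) * Phi (nc (f x)) <= A.
  by have := qA x; rewrite /q subrr norm20 subr0; apply.
have A0 : 0 < A by apply: lt_le_trans qx; rewrite mulr_gt0// exprn_gt0.
have [_ [y0 /= y0x <-] Aq] : exists2 s, S s & A - A / 2 < s.
  by apply: sup_adherent => //; rewrite divr_gt0.
pose r := (d - norm2 (y0 - x)) / 2.
have r0 : 0 < r by rewrite divr_gt0// subr_gt0.
have rn : 0 < r ^+ (2 * n) by rewrite exprn_gt0.
set u0 := nc (f y0).
have E2 : q y0 = 2 ^+ (2 * n) * r ^+ (2 * n) * Phi u0.
  by rewrite /q -exprMn; congr (_ ^+ _ * _); rewrite /r; field.
have Pu0 : 0 < Phi u0.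
  have : 0 < q y0 by lra.
  by rewrite E2 pmulr_rgt0// mulr_gt0// exprn_gt0.
have u00 : 0 < u0.
  by rewrite lt_def nc_ge0 andbT; apply: contraTneq Pu0 => ->; rewrite Ph0 ltxx.
have cmp y : norm2 (y - y0) < r -> nc (f y) <= B * u0.
  move=> yy; set u := nc (f y).
  have yx : norm2 (y - x) < d - r.
    by have := norm2D (y - y0) (y0 - x); rewrite addrA subrK /r in yy r0 *; lra.
  have PL : Phi u <= L * Phi u0.
    have h1 : r ^+ (2 * n) * Phi u <= A.
      apply: (le_trans _ (qA y _)); last by lra.
      apply: ler_wpM2r; first exact/Phi_ge0/nc_ge0.
      by apply: lerXn2r; rewrite ?nnegrE ?(ltW r0) ?subr_ge0//; lra.
    have : r ^+ (2 * n) * Phi u <= r ^+ (2 * n) * (L * Phi u0).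
      rewrite (le_trans h1)// (_ : _ * _ = 2 * q y0); first lra.
      by rewrite E2 /L; ring.
    by rewrite ler_pM2l.
  have [uu|uu] := leP u u0; first by rewrite (le_trans uu)// ler_peMl// ltW.
  have up : 0 < u by exact: lt_trans uu.
  have t0 : 0 < u0 / u by rewrite divr_gt0.
  have := low u (u0 / u) up t0; rewrite [u * _]mulrC divfK ?gt_eqF// ler_pdivrMr// mul1r.
  move=> /(_ (ltW uu)) h.
  have h2 : Phi u0 <= K * (u0 / u) `^ p * (L * Phi u0).
    by rewrite (le_trans h)// ler_wpM2l// mulr_ge0 ?(ltW K0)// powR_ge0.
  have h3 : 1 <= K * L * (u0 / u) `^ p.
    rewrite -(ler_pM2r Pu0) mul1r (le_trans h2)// le_eqVlt; apply/orP; left; apply/eqP; ring.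
  have h4 : (u / u0) `^ p <= K * L.
    have -> : (u / u0) `^ p = ((u0 / u) `^ p)^-1.
      by rewrite -powRN -mulN1r powRrM powR_inv1 ?(ltW t0)// invf_div.
    by rewrite -[leLHS]mul1r ler_pdivrMr ?powR_gt0.
  have h5 : u / u0 <= (K * L) `^ p^-1.
    have -> : u / u0 = ((u / u0) `^ p) `^ p^-1.
      by rewrite -powRrM divff ?gt_eqF// powRr1// divr_ge0 ?ltW.
    by apply: ge0_ler_powR; rewrite ?nnegrE ?invr_ge0 ?powR_ge0 ?mulr_ge0 ?(ltW p0) ?(ltW K0) ?(ltW L0).
  by rewrite -ler_pdivrMr// le_max h5 orbT.
(* All values u of |f| near y0 are at most b, and Phi(t) / t is non-increasing, so u <= (b / Phi b)
   Phi(u): [mean_le_affine] applies without constant term. *)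
pose b := B * u0; have b0 : 0 < b by rewrite mulr_gt0.
have ub : u0 <= b by rewrite ler_peMl// ltW.
have Pb : 0 < Phi b by apply: (lt_le_trans Pu0); apply: Phi_mono => //; exact: ltW.
have y0r : norm2 y0 + r <= 1 by have := near_ _ _ y0x; have := near_ y0 (d - 2 * r + r); rewrite /r in r0 *; lra.
have bP : 0 <= b / Phi b by rewrite divr_ge0 ?ltW.
have := @mean_le_affine f y0 r 0 (b / Phi b) hf r0 y0r (lexx _) bP.
rewrite mul0r add0e -/u0 => H.
have H1 : ((r ^+ (2 * n) * (@vol R n) * u0)%:E <= (b / Phi b)%:E * local_int f r y0)%E.
  apply: H => y yy; rewrite add0r; set u := nc (f y).
  have [->|un0] := eqVneq u 0; first by rewrite mulr_ge0 ?Phi_ge0.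
  have u_gt0 : 0 < u by rewrite lt_def un0 nc_ge0.
  have := decr u b u_gt0 (cmp y yy); rewrite ler_pdivlMr// => h.
  by rewrite -ler_pdivrMl ?divr_gt0// invf_div.
have H2 : (local_int f r y0 <= J%:E)%E.
  rewrite -EJ; apply: mI_le; [exact: emeas_local|exact: emeas_local|exact: local_ge0|].
  move=> y; rewrite lee_fin ler_wpM2r ?orlicz_ge0// /ball_fn; case: ltP => // yy.
  rewrite (_ : norm2 (y - x) < d)//.
  by have := norm2D (y - y0) (y0 - x); rewrite addrA subrK /r in yy r0 *; lra.
have H3 : r ^+ (2 * n) * (@vol R n) * u0 <= b / Phi b * J.
  by rewrite -lee_fin (EFinM (b / Phi b) J) (le_trans H1)// lee_wpmul2l.
have H4 : r ^+ (2 * n) * (@vol R n) * Phi b <= B * J.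
  rewrite -(ler_pM2l u00) (_ : u0 * (_ * _) = r ^+ (2 * n) * (@vol R n) * u0 * Phi b); last by ring.
  by rewrite -ler_pdivlMr// (le_trans H3)// le_eqVlt /b; apply/orP; left; apply/eqP; ring.
apply: (le_trans qx).
have H5 : A <= L * (r ^+ (2 * n) * Phi u0) by rewrite E2 in Aq; rewrite /L; lra.
apply: (le_trans H5); rewrite (_ : _ / _ * J = L * (B * J / (@vol R n))); last by ring.
rewrite (ler_pM2l L0) ler_pdivlMr// mulrAC.
apply: le_trans H4; rewrite ler_wpM2l//; first by rewrite mulr_ge0 ?ltW.
by apply: Phi_mono => //; exact: ltW.
Qed.

End submean.

(** * Integrals of powers of the distance to the boundary *)

Section power_weights.
Context {R : realType}.
Local Notation leb := (@lebesgue_measure R).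
Local Notation MR := (measurableTypeR R).

Lemma powR_within_continuous (a b c : R) : 0 < a ->
  {within `[a, b], continuous (fun u : R => u `^ c)}.
Proof.
move=> a0; apply: derivable_within_continuous => x; rewrite in_itv/= => /andP[ax _].
exact: (@ex_derive _ _ _ _ _ _ _ (is_derive1_powR c (lt_le_trans a0 ax))).
Qed.

Lemma integral_powR (a b c : R) : 0 < a -> a < b -> c + 1 != 0 ->
  (\int[leb]_(u in `[a, b]) (u `^ c)%:E = ((b `^ (c + 1) - a `^ (c + 1)) / (c + 1))%:E)%E.
Proof.
move=> a0 ab c1; pose F (u : R) := (c + 1)^-1 * u `^ (c + 1).
have dF (u : R) : 0 < u -> is_derive u 1 F (u `^ c).
  move=> u0; have -> : u `^ c = (c + 1)^-1 *: ((c + 1) * u `^ (c + 1 - 1)).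
    by rewrite addrK /GRing.scale/= mulrA mulVf// mul1r.
  exact: (is_deriveZ (c + 1)^-1 (is_derive1_powR (c + 1) u0)).
have cF (u : R) : 0 < u -> {for u, continuous F}.
  move=> u0; apply: differentiable_continuous; apply/derivable1_diffP.
  exact: (@ex_derive _ _ _ _ _ _ _ (dF u u0)).
have b0 : 0 < b by exact: lt_trans ab.
rewrite (@continuous_FTC2 _ _ F a b ab).
- by rewrite -EFinB /F; congr EFin; field.
- exact: powR_within_continuous.
- split.
  + move=> u; rewrite in_itv/= => /andP[au _].
    exact: (@ex_derive _ _ _ _ _ _ _ (dF u (lt_trans a0 au))).
  + exact: cvg_at_right_filter (cF a a0).
  + exact: cvg_at_left_filter (cF b b0).
- move=> u; rewrite in_itv/= => /andP[au _]; rewrite derive1E.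
  exact: (@derive_val _ _ _ _ _ _ _ (dF u (lt_trans a0 au))).
Qed.

Definition pw (c r u : R) : R := (0 < u <= r)%R%:R * u `^ c.

Lemma pw_ge0 c r u : 0 <= pw c r u.
Proof. by rewrite mulr_ge0 ?powR_ge0. Qed.

Lemma measurable_pw (c r : R) : measurable_fun setT (pw c r : MR -> MR).
Proof.
apply: measurable_funM; last exact: measurable_powR.
apply: measurable_bool_fn; apply: measurable_and.
  exact: measurable_fun_ltr.
exact: measurable_fun_ler.
Qed.

(** For c < 0 the power is singular at 0, so ]0, r] is exhausted by the intervals [r / (k + 2), r],
    nondegenerate for every k, and monotone convergence is used. *)
Lemma integral_pw (c r : R) : -1 < c -> 0 < r ->
  (\int[leb]_u (pw c r u)%:E <= (r `^ (c + 1) / (c + 1))%:E)%E.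
Proof.
move=> c1 r0; have c0 : 0 < c + 1 by lra.
pose F k : set MR := `[(r / k.+2%:R), r]%classic.
have mpw : measurable_fun setT (fun u : MR => (pw c r u)%:E).
  by apply/measurable_EFinP; exact: measurable_pw.
have F1 k : r / k.+2%:R < r by rewrite ltr_pdivrMr// ltr_pMr// ltr1n.
have F0 k : 0 < r / k.+2%:R :> R by rewrite divr_gt0.
have UF : \bigcup_k F k = `]0, r]%classic.
  apply/seteqP; split => u /=.
    by move=> [k _]; rewrite /F/= !in_itv/= => /andP[h ->]; rewrite (lt_le_trans _ h).
  rewrite in_itv/= => /andP[u0 ur]; have := archimedean.Num.Theory.archi_boundP (divr_ge0 (ltW r0) (ltW u0)).
  set k := archimedean.Num.bound _ => hk; exists k => //; rewrite /F/= in_itv/= ur andbT.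
  rewrite ler_pdivrMr// mulrC -ler_pdivrMr// (le_trans (ltW hk))// ler_nat.
  by rewrite -addn2 leq_addr.
have -> : (\int[leb]_u (pw c r u)%:E = \int[leb]_(u in \bigcup_k F k) (pw c r u)%:E)%E.
  rewrite UF integral_mkcond [RHS]integral_mkcond; apply: eq_integral => u _.
  rewrite !patchE in_setT mem_setE in_itv/= /pw; case: ifP => [->|_] //.
  by rewrite mul0r.
have nF : nondecreasing_seq F.
  move=> k l kl; apply/subsetPset => u; rewrite /F/= !in_itv/= => /andP[h ->].
  rewrite andbT (le_trans _ h)// ler_pM2l// lef_pV2 ?posrE// ler_nat.
  by rewrite !ltnS.
have p0 (k : nat) x : F k x -> (0 <= (pw c r x)%:E)%E by rewrite lee_fin pw_ge0.
have cv := @ge0_nondecreasing_set_cvg_integral _ _ R F (fun u : MR => (pw c r u)%:E) leb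
  nF (fun k => measurable_itv _) (fun k => measurable_funTS mpw) p0.
rewrite -(cvg_lim _ cv)//; apply: lime_le; first by apply/cvg_ex; eexists; exact: cv.
near=> k; apply: (@le_trans _ _ (\int[leb]_(u in F k) (u `^ c)%:E)%E).
  apply: ge0_le_integral; rewrite /F//=.
  - by move=> u _; rewrite lee_fin pw_ge0.
  - exact: measurable_funTS mpw.
  - apply/measurable_EFinP; apply: measurable_funTS; exact: measurable_powR.
  - by move=> u _; rewrite lee_fin ler_piMl ?powR_ge0// lern1 leq_b1.
rewrite integral_powR ?gt_eqF//; rewrite lee_fin ler_pM2r ?invr_gt0//.
by rewrite gerBl powR_ge0.
Unshelve. all: by end_near. Qed.

Lemma integral_pw_dilate (c r s : R) : -1 < c -> 0 < r -> 0 < s ->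
  (\int[leb]_t (pw c r (1 - t * s))%:E <= (r `^ (c + 1) / (c + 1) / s)%:E)%E.
Proof.
move=> c1 r0 s0.
have mpw : measurable_fun setT (fun u : MR => (pw c r u)%:E).
  by apply/measurable_EFinP; exact: measurable_pw.
have := integral_pw c1 r0.
rewrite (@integral_affine R (- s) 1 (fun u => (pw c r u)%:E)) ?oppr_eq0 ?gt_eqF//; last first.
  by move=> x; rewrite lee_fin pw_ge0.
rewrite normrN gtr0_norm//.
rewrite (_ : (\int[leb]_t (pw c r (1 - t * s))%:E = \int[leb]_t (pw c r (affine (- s) 1 t))%:E)%E); last first.
  by apply: eq_integral => t _; rewrite /affine mulNr addrC mulrC.
have I0 : (0 <= \int[leb]_t (pw c r (affine (- s) 1 t))%:E)%E.
  by apply: integral_ge0 => t _; rewrite lee_fin pw_ge0.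
case E : (\int[leb]_t (pw c r (affine (- s) 1 t))%:E)%E I0 => [J| |]// _.
  by rewrite -EFinM !lee_fin (ler_pdivlMr _ _ s0) [J * s]mulrC.
by rewrite gt0_muley// lte_fin.
Qed.

Lemma powR_le_half (c u : R) : -1 < c -> 1 / 2 <= u -> u <= 1 -> u `^ c <= 2.
Proof.
move=> c1 u2 u1; have u0 : 0 < u by lra.
apply: (@le_trans _ _ (u `^ (-1))); first by apply: ger_powR; [rewrite u0|exact: ltW].
by rewrite powR_inv1 ?(ltW u0)// -(invrK 2) lef_pV2 ?posrE ?invr_gt0//; lra.
Qed.

(** For s >= 1 / 2 the substitution u = 1 - t s costs 1 / s <= 2. For s < 1 / 2 the variable u stays
    in [1 / 2, 1], where u^c <= 2, and the short interval of t is integrated trivially. *)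
Lemma integral_pw_average (c : R) : -1 < c -> exists2 K : R, 0 < K &
  forall r s : R, 0 < r -> r <= 8 -> 0 <= s ->
  (\int[leb]_t ((1 - r / 16 <= t <= 1)%R%:R * pw c r (1 - t * s))%:E <= (K * r `^ (c + 1))%:E)%E.
Proof.
move=> c1; have c0 : 0 < c + 1 by lra.
exists (2 / (c + 1) + 2 `^ (c + 1)).
  by rewrite addr_gt0// ?powR_gt0// divr_gt0.
move=> r s r0 r8 s0.
have mb : measurable_fun setT (fun t : MR => (1 - r / 16 <= t <= 1)%R%:R : R).
  by apply: measurable_bool_fn; apply: measurable_and; apply: measurable_fun_ler.
have mp : measurable_fun setT (fun t : MR => pw c r (1 - t * s)).
  apply: (measurableT_comp (measurable_pw c r)).
  by apply: measurable_funB => //; apply: measurable_funM.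
have m1 : measurable_fun setT (fun t : MR => ((1 - r / 16 <= t <= 1)%R%:R * pw c r (1 - t * s))%:E).
  by apply/measurable_EFinP; apply: measurable_funM.
have rc := powR_ge0 r (c + 1); have rc2 := powR_ge0 2 (c + 1).
have [s2|s2] := leP (1 / 2) s.
  have sp : 0 < s by lra.
  apply: (@le_trans _ _ (\int[leb]_t (pw c r (1 - t * s))%:E)%E).
    apply: ge0_le_integral => //.
    - by move=> t _; rewrite lee_fin mulr_ge0 ?pw_ge0.
    - by apply/measurable_EFinP.
    - by move=> t _; rewrite lee_fin ler_piMl ?pw_ge0// lern1 leq_b1.
  apply: (le_trans (integral_pw_dilate c1 r0 sp)); rewrite lee_fin mulrDl.
  rewrite -[leLHS]addr0 lerD//; last by rewrite mulr_ge0.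
  rewrite (ler_pdivrMr _ _ sp).
  rewrite (_ : _ * _ * s = r `^ (c + 1) / (c + 1) * (2 * s)); last by ring.
  by rewrite ler_peMr ?divr_ge0 ?(ltW c0)//; lra.
(* Where the integrand does not vanish, 1 / 2 <= u <= r, so 2 r >= 1: the extra power only enlarges
   the bound 2 and gives it the required dependence on r. *)
pose G := 2 * (2 * r) `^ (c + 1).
have G0 : 0 <= G by rewrite mulr_ge0 ?powR_ge0.
apply: (@le_trans _ _ (\int[leb]_t (G%:E * (\1_(`[1 - r / 16, 1]%classic : set MR) t)%:E))%E).
  apply: ge0_le_integral => //.
  - by move=> t _; rewrite lee_fin mulr_ge0 ?pw_ge0.
  - by apply/measurable_EFinP; apply: measurable_funM => //; apply: measurable_indic; exact: measurable_itv.
  - move=> t _; rewrite -EFinM lee_fin indicE mem_setE in_itv/=.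
    case: (boolP (_ <= t <= 1)) => [/andP[t1 t2]|_]; last by rewrite mul0r mulr0.
    rewrite mul1r mulr1 /pw; case: (boolP (0 < _ <= r)) => [/andP[u0 ur]|_]; last by rewrite mul0r.
    have u1 : 1 - t * s <= 1 by rewrite gerBl mulr_ge0//; lra.
    have u2 : 1 / 2 <= 1 - t * s.
      by have : t * s <= 1 * s by [rewrite ler_wpM2r]; lra.
    rewrite mul1r (le_trans (powR_le_half c1 u2 u1))// /G ler_peMr//.
    by rewrite -[leLHS](powRr0 (2 * r)) ler_powR ?(ltW c0)//; lra.
rewrite ge0_integralZl//; last first.
  by apply/measurable_EFinP; apply: measurable_indic; exact: measurable_itv.
rewrite integral_indic//= setIT lebesgue_measure_itv/= lte_fin (_ : 1 - r / 16 < 1); last lra.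
rewrite -EFinB -EFinM lee_fin /G powRM//; last by rewrite ltW.
have q0 : 0 <= 2 / (c + 1) by rewrite divr_ge0 ?ltW.
have := mulr_ge0 q0 rc; have := mulr_ge0 rc2 rc; nra.
Qed.

End power_weights.

(** * Averages against powers of the distance to the boundary *)

Section averaging.
Context {R : realType} {n : nat}.
Local Notation leb := (@lebesgue_measure R).
Local Notation MR := (measurableTypeR R).
Local Notation X := (n.-tuple (MR * MR)%type).
Local Notation Cn := 'rV[C R]_n.
Implicit Types (x y z w : Cn).

Definition wt (c : R) z : R := ext (fun z => (1 - norm2 z) `^ c) z.

Lemma wt_ge0 c z : 0 <= wt c z.
Proof. by apply: ext_ge0 => y; exact: powR_ge0. Qed.

Lemma mvec_norm2 : measurable_fun setT (fun t : X => norm2 (of_coords t) : MR).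
Proof. by apply: measurable_norm2; exact: mvec_id. Qed.

Lemma rmeas_ext (u : Cn -> R) : rmeas u -> rmeas (ext u).
Proof.
move=> mu; rewrite /rmeas /ext; apply: measurable_fun_ifT => //.
by apply: measurable_fun_ltr => //; exact: mvec_norm2.
Qed.

Lemma rmeas_wt c : rmeas (wt c).
Proof.
apply: rmeas_ext; apply: (measurableT_comp (measurable_powR c)).
by apply: measurable_funB => //; exact: mvec_norm2.
Qed.

Lemma rmeas_pw c r : rmeas (fun z => pw c r (1 - norm2 z)).
Proof.
apply: (measurableT_comp (measurable_pw c r)).
by apply: measurable_funB => //; exact: mvec_norm2.
Qed.

(* Averaging over the dilations x = t y with 1 - r / 16 <= t <= 1 and integrating first in t reduces the estimate to one variable. *)
Lemma boundary_weight (c : R) : -1 < c -> exists2 K : R, 0 < K &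
  forall (r : R) y, 0 < r -> r <= 8 ->
  (mI (fun x => (ball_fn r y x * pw c r (1 - norm2 x))%:E) <=
   (K * (r ^+ (2 * n) * r `^ c))%:E)%E.
Proof.
move=> c1; have [K K0 HK] := integral_pw_average c1.
have v0 := @vol_gt0 R n.
exists (16 * K * 2 ^+ (2 * n) * (@vol R n)).
  by rewrite !mulr_gt0// exprn_gt0.
move=> r y r0 r8; pose F x := ball_fn r y x * pw c r (1 - norm2 x).
have mF : rmeas F by apply: rmeasM; [exact: rmeas_ball_fn|exact: rmeas_pw].
have F0 x : 0 <= F x by rewrite mulr_ge0 ?ball_fn_ge0 ?pw_ge0.
have meF := rmeas_emeas mF.
have eF0 x : (0 <= (F x)%:E)%E by rewrite lee_fin.
have IF0 : (0 <= mI (fun x => (F x)%:E))%E by exact: mI_ge0.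
pose b (t : R) : R := (1 - r / 16 <= t <= 1)%R%:R.
have b0 t : 0 <= b t by rewrite ler0n.
have mb : measurable_fun setT (b : MR -> MR).
  by apply: measurable_bool_fn; apply: measurable_and; apply: measurable_fun_ler.
pose H (t : R) (z : Cn) : \bar R := (b t * F (t%:C%C *: z))%:E.
have H0 t z : (0 <= H t z)%E by rewrite lee_fin mulr_ge0.
have mH : measurable_fun setT (fun p : MR * X => H p.1 (@of_coords R n p.2)).
  apply/measurable_EFinP; apply: measurable_funM.
    exact: (measurableT_comp mb measurable_fst).
  apply: (mvec_comp (F := F)) => //; apply: mvecZ.
  - exact: measurable_fst.
  - exact: measurable_cst.
  - exact: mvec_of_coords.
(* The substitution x = t z has Jacobian t^(2n) <= 1. *)
have step t : ((b t)%:E * mI (fun x => (F x)%:E) <= mI (H t))%E.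
  have [bt|bt] := boolP (1 - r / 16 <= t <= 1); last first.
    by rewrite /b (negbTE bt) mul0e; exact: mI_ge0.
  have t0 : 0 < t by move: bt => /andP[]; lra.
  have tC : (t%:C)%C != 0 :> C R by rewrite -nc_eq0 ncR normr_eq0 gt_eqF.
  rewrite /H /b bt mul1e [leLHS](mI_affine 0 tC meF)//.
  rewrite (eq_mI (F := fun z => (F ((t%:C)%C *: z + 0))%:E) (G := H t)); last first.
    by move=> z; rewrite addr0 /H /b bt mul1r.
  rewrite (_ : H t = fun z => (1 * F (t%:C%C *: z))%:E); last by rewrite /H /b bt.
  rewrite -[leRHS]mul1e; apply: lee_wpmul2r.
    by apply: mI_ge0 => z; rewrite lee_fin mul1r.
  rewrite lee_fin ncR gtr0_norm// exprn_ile1 ?(ltW t0)//.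
  by move: bt => /andP[].
have I1 : ((r / 16)%:E * mI (fun x => (F x)%:E) <= \int[leb]_t mI (H t))%E.
  apply: (@le_trans _ _ (\int[leb]_t ((b t)%:E * mI (fun x => (F x)%:E)))%E).
    rewrite ge0_integralZr//; try by apply/measurable_EFinP.
      apply: lee_wpmul2r => //.
      rewrite (_ : (\int[leb]_t (b t)%:E = \int[leb]_t (\1_(`[1 - r / 16, 1]%classic : set MR) t)%:E)%E).
        rewrite integral_indic//= setIT lebesgue_measure_itv/= lte_fin.
        by rewrite (_ : 1 - r / 16 < 1); [rewrite -EFinB lee_fin; lra|lra].
      by apply: eq_integral => t _; rewrite indicE mem_setE in_itv.
    by move=> t _; rewrite lee_fin b0.
  apply: ge0_le_integral => //.
  - by move=> t _; rewrite mule_ge0// lee_fin.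
  - by apply: emeasurable_funM => //; apply/measurable_EFinP.
  - exact: (measurable_fun_fubini_tonelli_F (m2 := lebesgueC R n)
      (fun p : MR * X => H p.1 (@of_coords R n p.2)) mH (fun p => H0 _ _)).
rewrite mI_tonelli_real// in I1.
(* If some t z lies within r of y and in the unit ball, then t >= 1 / 2 gives |z| <= 2, so (1 - t)
   |z| <= r / 8 and z is within 2 r of y. *)
have pt z : (\int[leb]_t H t z <= (K * r `^ (c + 1) * ball_fn (2 * r) y z)%:E)%E.
  have [zy|zy] := ltP (norm2 (z - y)) (2 * r); last first.
    rewrite /ball_fn ltNge zy mulr0 integral0_eq// => t _; congr EFin.
    rewrite /b; case: (boolP (_ <= t <= 1)) => [/andP[t1 t2]|_]; last by rewrite mul0r.
    rewrite mul1r /F /ball_fn; case: ltP => [h|_]; last by rewrite mul0r.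
    rewrite mul1r /pw; case: (boolP (0 < _ <= r)) => [/andP[u0 ur]|_]; last by rewrite mul0r.
    exfalso; have t0 : 0 < t by lra.
    rewrite norm2_scaleR ?(ltW t0)// in u0.
    have z2 : norm2 z <= 2.
      rewrite leNgt; apply/negP => z2.
      have : 1 / 2 * 2 <= t * norm2 z by apply: ler_pM => //; lra.
      lra.
    have := norm2D ((t%:C)%C *: z - y) ((1 - t)%:C%C *: z).
    rewrite addrAC -scalerDl (_ : _ + _ = 1) ?scale1r; last first.
      by apply/eqP; rewrite eq_complex/= addrC subrK addr0 !eqxx.
    rewrite norm2_scaleR ?subr_ge0//.
    have : (1 - t) * norm2 z <= r / 16 * 2.
      by apply: ler_pM => //; rewrite ?norm2_ge0//; lra.
    by lra.
  rewrite /ball_fn zy mulr1; apply: le_trans (HK r (norm2 z) r0 r8 (norm2_ge0 _)).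
  apply: ge0_le_integral => //.
  - apply/measurable_EFinP; apply: measurable_funM => //.
    apply: (mvec_comp (F := F)) => //; apply: mvecZ; last exact: mvec_cst.
      exact: measurable_id.
    exact: measurable_cst.
  - apply/measurable_EFinP; apply: measurable_funM => //.
    apply: (measurableT_comp (measurable_pw c r)).
    by apply: measurable_funB => //; apply: measurable_funM.
  - move=> t _; rewrite lee_fin /b; case: (boolP (_ <= t <= 1)) => [/andP[t1 t2]|_]; last by rewrite !mul0r.
    have t0 : 0 <= t by lra.
    rewrite !mul1r /F norm2_scaleR// ler_piMl ?pw_ge0//.
    by rewrite /ball_fn lern1 leq_b1.
have rn : 0 < r ^+ (2 * n) by rewrite exprn_gt0.
have KK : 0 <= K * r `^ (c + 1) by rewrite mulr_ge0 ?powR_ge0// ltW.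
have I2 : ((r / 16)%:E * mI (fun x => (F x)%:E) <=
    (K * r `^ (c + 1) * ((2 * r) ^+ (2 * n) * (@vol R n)))%:E)%E.
  apply: (le_trans I1); rewrite (EFinM (K * _)) -(mI_ball y) ?mulr_gt0// -mI_Z//; last 2 first.
  - exact: rmeas_emeas (rmeas_ball_fn _ _).
  - by move=> z; rewrite lee_fin ball_fn_ge0.
  apply: mI_le.
  - exact: (measurable_fun_fubini_tonelli_G (m1 := leb)
      (fun p : MR * X => H p.1 (@of_coords R n p.2)) mH (fun p => H0 _ _)).
  - by apply: emeasurable_funM => //; exact: rmeas_emeas (rmeas_ball_fn _ _).
  - by move=> z; apply: integral_ge0 => t _; exact: H0.
  - by move=> z; rewrite -EFinM; exact: pt.
have r16 : 0 < r / 16 by rewrite divr_gt0.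
case E : (mI (fun x => (F x)%:E)) IF0 I2 => [J| |]// _.
  rewrite -EFinM !lee_fin -ler_pdivlMl// => h; apply: (le_trans h).
  rewrite powRD ?(gt_eqF r0) ?implybT// powRr1 ?(ltW r0)// exprMn.
  rewrite le_eqVlt; apply/orP; left; apply/eqP; field.
  by rewrite gt_eqF.
by rewrite gt0_muley ?lte_fin// leye_eq.
Qed.

Lemma wt_integrable (c : R) : -1 < c -> (mI (fun x : Cn => (wt c x)%:E) < +oo)%E.
Proof.
move=> c1; have [K K0 HK] := boundary_weight c1.
have h2 : 0 < 2 :> R by [].
apply: le_lt_trans (ltry (K * (2 ^+ (2 * n) * 2 `^ c))).
apply: (le_trans _ (HK 2 0 h2 _)); last by lra.
apply: mI_le.
- exact: rmeas_emeas (rmeas_wt c).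
- by apply: rmeas_emeas; apply: rmeasM; [exact: rmeas_ball_fn|exact: rmeas_pw].
- by move=> x; rewrite lee_fin wt_ge0.
move=> x; rewrite lee_fin /wt /ext; case: ltP => x1; last by rewrite mulr_ge0 ?ball_fn_ge0 ?pw_ge0.
rewrite /ball_fn subr0 (_ : norm2 x < 2); last by lra.
have := norm2_ge0 x => x0.
rewrite mul1r /pw (_ : 0 < 1 - norm2 x <= 2) ?mul1r//; apply/andP; split; lra.
Qed.

(** After Tonelli w is fixed. The points x with w within k (1 - N w) of s x + b lie within r = ((1 +
    k) / s) (1 - N w) of (w - b) / s, and the assumption on b gives 1 - N x <= r; [boundary_weight]
    then yields r^(2n) r^c, and the exponents g - 2n, 2n and c add up to c + g. It serves with s =
    1, k = 3 in the upper bound and with s = 1 / 2, k = 1 in the lower one. *)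
Lemma carleson (c g k s : R) : -1 < c -> 0 < s -> 0 <= k -> (1 + k) / s <= 8 ->
  exists2 K : R, 0 < K & forall (b : Cn) (psi : Cn -> R),
    (forall x, norm2 x < 1 -> s * (1 - norm2 x) <= 1 - norm2 ((s%:C)%C *: x + b)) ->
    rmeas psi -> (forall w, 0 <= psi w) ->
  (mI (fun x => (wt c x)%:E * mI (fun w =>
     (ball_fn (k * (1 - norm2 w)) ((s%:C)%C *: x + b)%R w *
      (psi w * wt (g - (2 * n)%:R) w))%:E)) <=
   K%:E * mI (fun w => (psi w * wt (c + g) w)%:E))%E.
Proof.
move=> c1 s0 k0 ks; have [K K0 HK] := boundary_weight c1.
have k1 : 0 < 1 + k by lra.
have q0 : 0 < (1 + k) / s by rewrite divr_gt0.
exists (K * (((1 + k) / s) ^+ (2 * n) * ((1 + k) / s) `^ c)).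
  by rewrite !mulr_gt0 ?powR_gt0 ?exprn_gt0.
move=> b psi Yb mpsi psi0.
pose Y x := (s%:C)%C *: x + b.
pose Q w := psi w * wt (g - (2 * n)%:R) w.
have Q0 w : 0 <= Q w by rewrite mulr_ge0 ?wt_ge0.
have mQ : rmeas Q by exact: (rmeasM mpsi (rmeas_wt _)).
pose H x w : R := wt c x * (ball_fn (k * (1 - norm2 w)) (Y x) w * Q w).
have H0 x w : 0 <= H x w by rewrite !mulr_ge0 ?wt_ge0 ?ball_fn_ge0.
have H0e x w : (0 <= (H x w)%:E)%E by rewrite lee_fin.
have mY : mvec (fun p : X * X => Y (@of_coords R n p.1)).
  apply: mvecD; last exact: mvec_cst.
  by apply: mvecZ; [exact: measurable_cst|exact: measurable_cst|exact: mvec_of_coords].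
have mB : measurable_fun setT (fun p : X * X =>
    ball_fn (k * (1 - norm2 (@of_coords R n p.2))) (Y (of_coords p.1)) (of_coords p.2)).
  apply: measurable_ball_fn => //; last exact: mvec_of_coords.
  apply: measurable_funM => //; apply: measurable_funB => //.
  exact: (measurableT_comp mvec_norm2 measurable_snd).
have mQ2 : measurable_fun setT (fun p : X * X => Q (@of_coords R n p.2)).
  exact: (measurableT_comp mQ measurable_snd).
have mH : measurable_fun setT (fun p : X * X => (H (@of_coords R n p.1) (@of_coords R n p.2))%:E).
  apply/measurable_EFinP; apply: measurable_funM.
    exact: (measurableT_comp (rmeas_wt c) measurable_fst).
  exact: measurable_funM.
rewrite (eq_mI (G := fun x => mI (fun w => (H x w)%:E))); last first.
  move=> x; rewrite -mI_Z ?wt_ge0//; last first.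
    by move=> w; rewrite lee_fin; exact: mulr_ge0 (ball_fn_ge0 _ _ _) (Q0 w).
  apply: rmeas_emeas; apply: rmeasM => //.
  apply: (@measurable_ball_fn _ _ _ _ (fun t => k * (1 - norm2 (@of_coords R n t))) (fun=> Y x)).
  - by apply: measurable_funM => //; apply: measurable_funB => //; exact: mvec_norm2.
  - exact: mvec_cst.
  - exact: mvec_id.
rewrite (@mI_tonelli R n (fun x w => (H x w)%:E) mH); last by move=> x w; rewrite lee_fin.
have mpw : emeas (fun w => (psi w * wt (c + g) w)%:E).
  by apply: rmeas_emeas; apply: rmeasM => //; exact: rmeas_wt.
rewrite -mI_Z//; last 2 first.
- by rewrite !mulr_ge0 ?powR_ge0 ?exprn_ge0 ?(ltW K0) ?(ltW q0).
- by move=> w; rewrite lee_fin mulr_ge0 ?wt_ge0.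
apply: mI_le.
- exact: (measurable_fun_fubini_tonelli_G (m1 := lebesgueC R n)
    (fun p : X * X => (H (@of_coords R n p.1) (@of_coords R n p.2))%:E) mH (fun p => H0e _ _)).
- exact: emeasurable_funM.
- by move=> w; apply: mI_ge0 => x; rewrite lee_fin.
move=> w; have [w1|w1] := ltP (norm2 w) 1; last first.
  have wt0 c' : wt c' w = 0 by rewrite /wt /ext ltNge w1.
  rewrite wt0 mulr0 mule0 (eq_mI (G := fun=> 0%E)); first by rewrite /mI integral0.
  by move=> x; rewrite /H /Q wt0 !mulr0.
set sg := 1 - norm2 w; have sg0 : 0 < sg by rewrite subr_gt0.
have sg1 : sg <= 1 by rewrite gerBl norm2_ge0.
pose r := (1 + k) / s * sg.
have r0 : 0 < r by rewrite mulr_gt0.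
have r8 : r <= 8 by rewrite (le_trans _ ks)// ler_piMr// ltW.
pose y := (s^-1%:C)%C *: (w - b).
apply: (@le_trans _ _ ((Q w)%:E * mI (fun x => (ball_fn r y x * pw c r (1 - norm2 x))%:E))%E).
  have mW : emeas (fun x => (ball_fn r y x * pw c r (1 - norm2 x))%:E).
    by apply: rmeas_emeas; apply: rmeasM; [exact: rmeas_ball_fn|exact: rmeas_pw].
  have W0 x : (0 <= (ball_fn r y x * pw c r (1 - norm2 x))%:E)%E.
    by rewrite lee_fin mulr_ge0 ?ball_fn_ge0 ?pw_ge0.
  rewrite -mI_Z//; apply: mI_le.
  - apply: rmeas_emeas; apply: (rmeasM (rmeas_wt c)).
    apply: measurable_funM; last exact: measurable_cst.
    apply: (@measurable_ball_fn _ _ _ _ (fun=> k * (1 - norm2 w)) _ (fun=> w)).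
    + exact: measurable_cst.
    + apply: mvecD; last exact: mvec_cst.
      by apply: mvecZ; [exact: measurable_cst|exact: measurable_cst|exact: mvec_id].
    + exact: mvec_cst.
  - exact: emeasurable_funM.
  - by move=> x; rewrite lee_fin.
  move=> x; rewrite -EFinM lee_fin /H mulrA mulrC ler_wpM2l//.
  rewrite /wt /ext; case: ltP => x1; last by rewrite mul0r mulr_ge0 ?ball_fn_ge0 ?pw_ge0.
  rewrite {1}/ball_fn; case: ltP => wY; last by rewrite mulr0 mulr_ge0 ?ball_fn_ge0 ?pw_ge0.
  rewrite mulr1.
  have xy : norm2 (x - y) < r.
    have E : x - y = ((- s^-1)%:C)%C *: (w - Y x).
      rewrite /y /Y opprD [in RHS]addrA [in RHS]addrAC [RHS]scalerBr scalerA.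
      have -> : ((- s^-1)%:C)%C * (s%:C)%C = -1 :> C R.
        by apply/eqP; rewrite eq_complex/=; apply/andP; split; apply/eqP; field; rewrite gt_eqF.
      rewrite scaleN1r opprK [RHS]addrC; congr (_ + _).
      rewrite -scaleNr; congr (_ *: _).
      by apply/eqP; rewrite eq_complex/= oppr0 !eqxx.
    rewrite E norm2Z ncR normrN gtr0_norm ?invr_gt0// mulrC ltr_pdivrMr//.
    rewrite (lt_le_trans wY)// /r (_ : _ * _ * s = (1 + k) * sg); last by field; rewrite gt_eqF.
    by rewrite ler_wpM2r ?(ltW sg0)//; lra.
  rewrite /ball_fn xy mul1r /pw (_ : 0 < 1 - norm2 x <= r) ?mul1r//.
  apply/andP; split; first by rewrite subr_gt0.
  have := Yb x x1; have := norm2D (w - Y x) (Y x); rewrite subrK => h1 h2.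
  rewrite (_ : r = (1 + k) * sg / s); last by rewrite /r; ring.
  rewrite ler_pdivlMr// mulrC (le_trans h2)//.
  by rewrite /sg in wY *; rewrite -/(Y x); lra.
apply: (@le_trans _ _ ((Q w)%:E * (K * (r ^+ (2 * n) * r `^ c))%:E)%E).
  by apply: lee_wpmul2l; [rewrite lee_fin|exact: HK].
rewrite -!EFinM lee_fin /Q /wt /ext w1 -/sg /r exprMn powRM ?(ltW q0) ?(ltW sg0)//.
rewrite powRB ?(gt_eqF sg0) ?implybT// powR_mulrn ?(ltW sg0)//.
rewrite (powRD (r := c)) ?(gt_eqF sg0) ?implybT//.
have sgn : sg ^+ (2 * n) != 0 by rewrite gt_eqF ?exprn_gt0.
by rewrite le_eqVlt; apply/orP; left; apply/eqP; field.
Qed.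

End averaging.

(** * Upper bound *)

Section ray_kernel.
Context {R : realType}.
Local Notation leb := (@lebesgue_measure R).
Local Notation MR := (measurableTypeR R).
Local Notation I01 := (`[(0 : R), (1 : R)]%classic).

Lemma ray_kernel_integrable (e rho : R) : 0 < rho ->
  leb.-integrable I01 (EFin \o (fun t => (1 + rho - t) `^ (- 1 - e))).
Proof.
move=> r0; apply: (@bounded01_integrable _ _ (rho `^ (-1 - e) + (1 + rho) `^ (-1 - e))).
  apply: measurable_funTS; apply: (measurableT_comp (measurable_powR _)).
  exact: measurable_funB.
move=> t /andP[t0 t1]; rewrite ger0_norm ?powR_ge0//.
have [h|h] := leP 0 (- 1 - e).
  rewrite -[leLHS]add0r lerD ?powR_ge0//; apply: ge0_ler_powR; rewrite ?nnegrE//; lra.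
rewrite -[leLHS]addr0 lerD ?powR_ge0//.
have P (u : R) : 0 < u -> u `^ (-1 - e) = (u `^ (1 + e))^-1.
  by move=> u0; rewrite -powRN; congr (_ `^ _); ring.
rewrite !P; [|lra|lra]; rewrite lef_pV2 ?posrE ?powR_gt0//; last lra.
apply: ge0_ler_powR; rewrite ?nnegrE; lra.
Qed.

(** The kernel stands for (1 - t N z)^(-1 - e) with rho = 1 - N z. It has the same size but slope 1
    in t, so the substitution u = 1 + rho - t involves no division by N z. *)
Lemma ray_kernel_integral (e rho : R) : 0 < e -> 0 < rho -> rho <= 1 ->
  Rintegral leb I01 (fun t => (1 + rho - t) `^ (- 1 - e)) <= rho `^ (- e) / e.
Proof.
move=> e0 r0 r1; rewrite /Rintegral -lee_fin fineK; last first.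
  by apply: integrable_fin_num => //; exact: ray_kernel_integrable.
pose F (u : MR) : \bar R := ((rho <= u <= 2)%R%:R * u `^ (- 1 - e))%:E.
have mF : measurable_fun setT F.
  apply/measurable_EFinP; apply: measurable_funM; last exact: measurable_powR.
  by apply: measurable_bool_fn; apply: measurable_and; apply: measurable_fun_ler.
have F0 u : (0 <= F u)%E by rewrite lee_fin mulr_ge0 ?powR_ge0.
apply: (@le_trans _ _ (\int[leb]_t F (affine (- 1) (1 + rho) t))%E).
  rewrite integral_mkcond; apply: ge0_le_integral => //.
  - move=> t _; rewrite patchE mem_setE; case: ifP => // _.
    by rewrite lee_fin powR_ge0.
  - apply/(measurable_restrictT _ _).1; first exact: measurable_itv.
    apply/measurable_EFinP; apply: measurable_funTS; apply: (measurableT_comp (measurable_powR _)).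
    exact: measurable_funB.
  - by apply: (measurableT_comp mF); exact: measurable_affine.
  - move=> t _; rewrite patchE mem_setE; case: ifP => // t01; rewrite /F /affine.
    move: t01; rewrite in_itv/= => /andP[t0 t1].
    have -> : - 1 * t + (1 + rho) = 1 + rho - t by ring.
    by rewrite (_ : rho <= 1 + rho - t <= 2) ?mul1r//; apply/andP; split; lra.
have := @integral_affine R (- 1) (1 + rho) F; rewrite oppr_eq0 oner_eq0 normrN1 mul1e.
move=> /(_ isT mF F0) <-.
have -> : (\int[leb]_u F u = \int[leb]_(u in `[rho, (2%R : R)]%classic) (u `^ (- 1 - e))%:E)%E.
  rewrite [RHS]integral_mkcond.
  apply: eq_integral => t _; rewrite patchE mem_setE in_itv/= /F; case: ifP => _.
    by rewrite mul1r.
  by rewrite mul0r.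
have e1 : - 1 - e + 1 != 0 by rewrite addrAC addNr add0r oppr_eq0 gt_eqF.
rewrite integral_powR//; last lra.
rewrite lee_fin (_ : - 1 - e + 1 = - e); last by ring.
rewrite invrN mulrN -mulNr opprB ler_pM2r ?invr_gt0//.
by rewrite gerBl powR_ge0.
Qed.

End ray_kernel.

Section pointwise.
Context {R : realType} {n : nat}.
Local Notation nc := (@Normc.normc R).
Local Notation Cn := 'rV[C R]_n.
Implicit Types (x y z w : Cn) (f g : Cn -> C R).

Definition bloch_bound g (M : R) := forall x, norm2 x < 1 -> (1 - norm2 x) * nc (radial g x) <= M.

(** For t >= 1 / 4 the division costs a factor 4. For smaller t, Rg(0) = 0 and [ray_lipschitz],
    applied to z / 4 with parameter 4 t and the bound 2 M on the ball of radius 1 / 2, give |Rg(t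
    z)| <= 32 M t. *)
Lemma bloch_ray g M z t : holomorphic g -> bloch_bound g M -> norm2 z < 1 -> 0 < t <= 1 ->
  nc (radial g ((t%:C)%C *: z)) / t <= 32 * M / (1 - t * norm2 z).
Proof.
move=> hg gM z1 /andP[t0 t1]; have z0 := norm2_ge0 z.
have M0 : 0 <= M.
  by have := gM 0; rewrite norm20 subr0 mul1r radial0 nc0; apply.
have tz : t * norm2 z <= norm2 z by rewrite ler_piMl.
have tz0 : 0 <= t * norm2 z by rewrite mulr_ge0 ?(ltW t0).
have d0 : 0 < 1 - t * norm2 z by lra.
rewrite ler_pdivrMr//; have [t4|t4] := leP (1 / 4) t.
  have := gM ((t%:C)%C *: z); rewrite norm2_scaleR ?(ltW t0)// => /(_ _) h.
  have {}h : (1 - t * norm2 z) * nc (radial g (t%:C%C *: z)) <= M by apply: h; lra.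
  rewrite mulrAC ler_pdivlMr// mulrC (le_trans h)// -mulrA mulrC -mulrA ler_peMr//; lra.
have h4 : 0 < 1 / 4 :> R by lra.
have h2 : 0 < 1 / 2 :> R by lra.
pose x := ((4^-1)%:C)%C *: z.
have x4 : norm2 x <= 1 / 4 by rewrite /x norm2_scaleR ?invr_ge0//; lra.
have := @ray_lipschitz R n (radial g) x (1 / 4) (1 / 4) (2 * M) (1 / 2) (4 * t).
rewrite radial0 subr0 /x scalerA.
have -> : ((4 * t)%:C)%C * ((4^-1)%:C)%C = (t%:C)%C :> C R.
  by apply/eqP; rewrite eq_complex/=; apply/andP; split; apply/eqP; field.
move=> H; have {}H : nc (radial g (t%:C%C *: z)) <= 2 * (2 * M) / (1 / 2) * (4 * t).
  apply: H => //.
  - by move=> y y2; have /holomorphicE := radial_holomorphic hg; apply; lra.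
  - move=> y y2; have y1 : norm2 y < 1 by lra.
    have := gM y y1; have := nc_ge0 (radial g y); nra.
  - by have := norm2_ge0 x; rewrite -/x; lra.
  - by apply/andP; split; lra.
apply: (le_trans H); rewrite (_ : 2 * (2 * M) / (1 / 2) * (4 * t) = 32 * M * t); last by field.
rewrite ler_wpM2r ?(ltW t0)// ler_pdivlMr// ler_piMr ?mulr_ge0//; lra.
Qed.

Definition ray_growth (e : R) f z (t : R) : R :=
  nc (f ((t%:C)%C *: z)) * ((1 - t * norm2 z) / (1 - norm2 z)) `^ e.

Lemma ray_growth_ge0 e f z t : 0 <= ray_growth e f z t.
Proof. by rewrite mulr_ge0 ?nc_ge0 ?powR_ge0. Qed.

Lemma ray_growth_bounded (e : R) f z : 0 < e -> holomorphic f -> norm2 z < 1 ->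
  exists2 A : R, 0 <= A & forall t, 0 <= t <= 1 -> ray_growth e f z t <= A.
Proof.
move=> e0 /holomorphicE hf z1.
have [A A0 fA] : exists2 A, 0 <= A & forall y, norm2 y <= norm2 z -> nc (f y) <= A.
  by apply: holomorphic_bounded => y yz; apply: hf; exact: le_lt_trans z1.
have r0 : 0 < 1 - norm2 z by rewrite subr_gt0.
exists (A * (1 / (1 - norm2 z)) `^ e); first by rewrite mulr_ge0 ?powR_ge0.
move=> t /andP[t0 t1]; have z0 := norm2_ge0 z.
have tz : t * norm2 z <= norm2 z by rewrite ler_piMl.
have tz0 : 0 <= t * norm2 z by rewrite mulr_ge0.
apply: ler_pM; rewrite ?nc_ge0 ?powR_ge0//; first by apply: fA; rewrite norm2_scaleR.
apply: ge0_ler_powR; rewrite ?nnegrE ?(ltW e0)//.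
- by rewrite divr_ge0 ?(ltW r0)//; lra.
- by rewrite divr_ge0 ?(ltW r0).
- by rewrite ler_pM2r ?invr_gt0//; lra.
Qed.

(** Put rho = 1 - N z and d = 1 - t N z; the hypothesis reads |f(t z)| <= B (rho / d)^e. The
    integral of 1 / d alone grows like log(1 / rho), and this factor makes it bounded. In the
    constant, 32 comes from [bloch_ray], 4^(1 + e) from d >= (1 + rho - t) / 4, and 1 / e from the
    kernel. *)
Lemma Tg_ray_bound (e : R) : 0 < e -> exists2 K : R, 0 < K &
  forall f g M z (B : R), holomorphic f -> holomorphic g -> bloch_bound g M -> norm2 z < 1 ->
    (forall t, 0 <= t <= 1 -> ray_growth e f z t <= B) -> nc (Tg g f z) <= K * M * B.
Proof.
move=> e0; exists (32 * 4 `^ (1 + e) / e); first by rewrite divr_gt0// mulr_gt0// powR_gt0.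
move=> f g M z B hf hg gM z1 fB; have z0 := norm2_ge0 z.
have M0 : 0 <= M.
  by have := gM 0; rewrite norm20 subr0 mul1r radial0 nc0; apply.
have B0 : 0 <= B.
  by apply: le_trans (fB 0 _); [exact: ray_growth_ge0|rewrite lexx ler01].
set rho := 1 - norm2 z; have r0 : 0 < rho by rewrite subr_gt0.
have r1 : rho <= 1 by rewrite gerBl.
pose A := 32 * M * B * rho `^ e * 4 `^ (1 + e).
have A0 : 0 <= A by rewrite !mulr_ge0 ?powR_ge0.
have ik := @ray_kernel_integrable R e rho r0.
have := @nc_IC_le_int R _ (fun t => A * (1 + rho - t) `^ (- 1 - e)) (bmeas_Tg hf hg z1).
move=> H; have {}H : nc (Tg g f z) <= Rintegral (@lebesgue_measure R) `[0, 1]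
    (fun t => A * (1 + rho - t) `^ (- 1 - e)).
  apply: H.
    by rewrite (_ : _ \o _ = fun t => (A%:E * ((1 + rho - t) `^ (- 1 - e))%:E)%E)//; exact: integrableZl.
  move=> t /andP[t0 t1].
  have [->|tn0] := eqVneq t 0.
    by rewrite scale0r radial0 mulr0 mul0r nc0 mulr_ge0 ?powR_ge0.
  have tp : 0 < t by rewrite lt_def tn0.
  have tz : t * norm2 z <= norm2 z by rewrite ler_piMl.
  have tz0 : 0 <= t * norm2 z by rewrite mulr_ge0.
  set d := 1 - t * norm2 z.
  have d0 : 0 < d by rewrite /d; lra.
  have d4 : (1 + rho - t) / 4 <= d by rewrite /d /rho in r0 *; nra.
  have q0 : 0 < 1 + rho - t by lra.
  rewrite ncM ncV ncR gtr0_norm// ncM -mulrA.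
  have h1 : nc (f (t%:C%C *: z)) <= B * (rho / d) `^ e.
    have := fB t; rewrite t0 t1 => /(_ isT); rewrite /ray_growth -/d -/rho.
    have -> : rho / d = (d / rho)^-1 by rewrite invf_div.
    have dr : 0 < d / rho by rewrite divr_gt0.
    rewrite -[(d / rho)^-1]powR_inv1 ?(ltW dr)// -powRrM mulN1r powRN.
    by rewrite ler_pdivlMr ?powR_gt0.
  have h2 := bloch_ray hg gM z1 (t := t); rewrite tp t1 in h2.
  have {}h2 := h2 isT.
  apply: (le_trans (ler_pM _ _ h1 h2)); rewrite ?nc_ge0 ?divr_ge0 ?nc_ge0//.
  rewrite -/d.
  have h3 : (rho / d) `^ e / d <= rho `^ e * 4 `^ (1 + e) * (1 + rho - t) `^ (- 1 - e).
    rewrite powRM ?invr_ge0 ?(ltW r0) ?(ltW d0)// -!mulrA ler_wpM2l ?powR_ge0//.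
    have -> : d^-1 `^ e / d = (d `^ (1 + e))^-1.
      rewrite -[in LHS](powR_inv1 (ltW d0)) -powRrM -powRD; last by rewrite (gt_eqF d0) implybT.
      by rewrite -powRN; congr (_ `^ _); ring.
    have -> : (1 + rho - t) `^ (- 1 - e) = ((1 + rho - t) `^ (1 + e))^-1.
      by rewrite -powRN; congr (_ `^ _); ring.
    rewrite ler_pdivlMr ?powR_gt0// mulrC ler_pdivrMr ?powR_gt0//.
    rewrite -powRM//; last exact: ltW.
    by apply: ge0_ler_powR; rewrite ?nnegrE; lra.
  rewrite (_ : B * (rho / d) `^ e * (32 * M / d) = 32 * M * B * ((rho / d) `^ e / d)); last by ring.
  by rewrite /A -!mulrA; do 3!(apply: ler_wpM2l => //); rewrite !mulrA.
apply: (le_trans H); rewrite RintegralZl//.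
apply: (@le_trans _ _ (A * (rho `^ (- e) / e))).
  by apply: ler_wpM2l => //; exact: ray_kernel_integral.
rewrite /A powRN le_eqVlt; apply/orP; left; apply/eqP; field.
by rewrite !gt_eqF ?powR_gt0.
Qed.

End pointwise.

Section upper.
Context {R : realType}.
Local Notation nc := (@Normc.normc R).
Variable Phi : R -> R.
Hypothesis Phi_ge0 : forall t, 0 <= t -> 0 <= Phi t.
Hypothesis Phi_cont : forall t, 0 <= t -> forall e : R, 0 < e ->
  exists2 d : R, 0 < d & forall s, 0 <= s -> `|s - t| < d -> `|Phi s - Phi t| <= e.
Hypothesis Phi_mono : forall s t, 0 <= s -> s <= t -> Phi s <= Phi t.
Hypothesis Phi0 : Phi 0 = 0.
Variable n : nat.
Hypothesis submean : submean_property Phi n.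
Local Notation Cn := 'rV[C R]_n.
Implicit Types (x y z w : Cn) (f g : Cn -> C R).

Lemma emeas_kernel f (k c : R) y : holomorphic f ->
  emeas (fun w => (ball_fn (k * (1 - norm2 w)) y w * (orlicz Phi f w * wt c w))%:E).
Proof.
move=> hf; apply: rmeas_emeas; apply: rmeasM.
  apply: (@measurable_ball_fn _ _ _ _ (fun t => k * (1 - norm2 (@of_coords R n t))) (fun=> y)).
  - by apply: measurable_funM => //; apply: measurable_funB => //; exact: mvec_norm2.
  - exact: mvec_cst.
  - exact: mvec_id.
by apply: rmeasM; [exact: rmeas_orlicz|exact: rmeas_wt].
Qed.

Lemma kernel_ge0 f (d c : R) y w : (0 <= (ball_fn d y w * (orlicz Phi f w * wt c w))%:E)%E.
Proof. by rewrite lee_fin !mulr_ge0 ?ball_fn_ge0 ?wt_ge0// orlicz_ge0. Qed.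

Lemma emeas_kernel_mI f (k c s : R) b : holomorphic f ->
  emeas (fun x => mI (fun w => (ball_fn (k * (1 - norm2 w)) ((s%:C)%C *: x + b)%R w *
    (orlicz Phi f w * wt c w))%:E)).
Proof.
move=> hf; have mo := rmeas_orlicz Phi_cont hf.
have mk : measurable_fun setT (fun p : n.-tuple (measurableTypeR R * measurableTypeR R) *
    n.-tuple (measurableTypeR R * measurableTypeR R) =>
    (ball_fn (k * (1 - norm2 (of_coords p.2))) ((s%:C)%C *: of_coords p.1 + b)%R (of_coords p.2) *
     (orlicz Phi f (of_coords p.2) * wt c (of_coords p.2)))%:E).
  apply/measurable_EFinP; apply: measurable_funM.
    apply: measurable_ball_fn; last exact: mvec_of_coords.
      apply: measurable_funM => //; apply: measurable_funB => //.
      exact: (measurableT_comp mvec_norm2 measurable_snd).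
    apply: mvecD; last exact: mvec_cst.
    by apply: mvecZ; [exact: measurable_cst|exact: measurable_cst|exact: mvec_of_coords].
  apply: measurable_funM; first exact: (measurableT_comp mo measurable_snd).
  exact: (measurableT_comp (rmeas_wt _) measurable_snd).
exact: (measurable_fun_fubini_tonelli_F (m2 := lebesgueC R n) _ mk (fun p => kernel_ge0 _ _ _ _ _)).
Qed.

(** With d = (1 - N y) / 2, every w within d of y satisfies d < 1 - N w <= 3 d, so that N (w - y) <
    1 - N w. The ball around y is thus replaced by a condition whose radius depends on w, the form
    [carleson] expects. *)
Lemma submean_kernel (g : R) : 0 <= g -> exists2 K : R, 0 < K &
  forall f y, holomorphic f -> norm2 y < 1 ->
  (((1 - norm2 y) `^ g * Phi (nc (f y)))%:E <=
   K%:E * mI (fun w => (ball_fn (1 * (1 - norm2 w)) y w *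
     (orlicz Phi f w * wt (g - (2 * n)%:R) w))%:E))%E.
Proof.
move=> g0; have [K K0 HK] := submean.
exists (K * (2 `^ g * 3 ^+ (2 * n))).
  by rewrite !mulr_gt0 ?powR_gt0 ?exprn_gt0.
move=> f y hf y1; pose d := (1 - norm2 y) / 2.
have d0 : 0 < d by rewrite divr_gt0// subr_gt0.
have yd : norm2 y + d < 1 by rewrite /d in d0 *; lra.
have dn : 0 < d ^+ (2 * n) by rewrite exprn_gt0.
have := HK f y d hf d0 yd => H.
have ml := emeas_local Phi_cont d y hf.
have l0 w := local_ge0 Phi_ge0 f d y w.
have k0 : 0 <= (1 - norm2 y) `^ g / d ^+ (2 * n).
  by rewrite divr_ge0 ?powR_ge0// ltW.
have c0 : 0 <= 2 `^ g * 3 ^+ (2 * n) :> R by rewrite mulr_ge0 ?powR_ge0 ?exprn_ge0.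
have mk := emeas_kernel 1 (g - (2 * n)%:R) y hf.
have k_ge0 w := kernel_ge0 f (1 * (1 - norm2 w)) (g - (2 * n)%:R) y w.
have H1 : (((1 - norm2 y) `^ g * Phi (nc (f y)))%:E <=
    K%:E * (((1 - norm2 y) `^ g / d ^+ (2 * n))%:E * local_int Phi f d y))%E.
  rewrite (_ : (1 - norm2 y) `^ g * Phi (nc (f y)) =
    (1 - norm2 y) `^ g / d ^+ (2 * n) * (d ^+ (2 * n) * Phi (nc (f y)))); last first.
    by field; rewrite gt_eqF.
  by rewrite EFinM muleCA; apply: lee_wpmul2l.
apply: (le_trans H1); rewrite [(K * _)%:E]EFinM -muleA; apply: lee_wpmul2l; first by rewrite lee_fin ltW.
rewrite -mI_Z// -mI_Z//; apply: mI_le.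
- by apply: (@emeasurable_funM _ _ _ _ (fun=> _%:E)).
- by apply: (@emeasurable_funM _ _ _ _ (fun=> _%:E)).
- by move=> w; rewrite mule_ge0.
move=> w; rewrite -!EFinM lee_fin; have := k_ge0 w; rewrite lee_fin /ball_fn mul1r.
case: (ltP (norm2 (w - y)) d) => wy h; last by rewrite mul0r mulr0 mulr_ge0.
have h1 := norm2D (w - y) y; rewrite subrK in h1.
have h2 := norm2D (y - w) w; rewrite subrK -[y - w]opprB norm2N in h2.
have wy' : norm2 (w - y) < 1 - norm2 w by rewrite /d in wy; lra.
have w1 : norm2 w < 1 by lra.
rewrite wy' !mul1r [leLHS]mulrC [leRHS]mulrCA ler_wpM2l//; first exact: orlicz_ge0.
rewrite /wt /ext w1; set sg := 1 - norm2 w in wy' *.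
have sg0 : 0 < sg by rewrite subr_gt0.
have sgn : 0 < sg ^+ (2 * n) by rewrite exprn_gt0.
rewrite powRB ?(gt_eqF sg0) ?implybT// powR_mulrn ?(ltW sg0)//.
have h3 : (1 - norm2 y) `^ g <= 2 `^ g * sg `^ g.
  rewrite -powRM ?(ltW sg0)//; apply: ge0_ler_powR; rewrite ?nnegrE ?mulr_ge0 ?(ltW sg0)//; first by lra.
  by rewrite /sg /d in wy *; lra.
have h4 : sg ^+ (2 * n) <= 3 ^+ (2 * n) * d ^+ (2 * n).
  have sd : sg <= 3 * d by rewrite /sg /d in wy *; lra.
  have d3 : 0 <= 3 * d by rewrite mulr_ge0 ?(ltW d0).
  by rewrite -exprMn; apply: lerXn2r => //; rewrite nnegrE ltW.
rewrite (ler_pdivrMr _ _ dn); apply: (le_trans h3).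
rewrite (_ : 2 `^ g * 3 ^+ (2 * n) * (sg `^ g / sg ^+ (2 * n)) * d ^+ (2 * n) =
  2 `^ g * sg `^ g * (3 ^+ (2 * n) * d ^+ (2 * n) / sg ^+ (2 * n))); last by ring.
by rewrite ler_peMr ?mulr_ge0 ?powR_ge0// ler_pdivlMr// mul1r.
Qed.

Variables (q Kq : R).
Hypothesis q1 : 1 <= q.
Hypothesis Kq0 : 0 < Kq.
Hypothesis upper : forall s t, 0 < s -> 1 <= t -> Phi (s * t) <= Kq * t `^ q * Phi s.

(** At a t where [ray_growth] exceeds half its supremum B, |Tg f(z)| / M is at most |f(t z)| times a
    constant and ((1 - t N z) / (1 - N z))^e, a factor at least 1 that upper type takes out of
    Phi. *)
Lemma Tg_pointwise (e : R) : 0 < e -> exists2 K : R, 0 < K &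
  forall f g M z, holomorphic f -> holomorphic g -> 0 < M -> bloch_bound g M -> norm2 z < 1 ->
  exists2 t : R, 0 <= t <= 1 &
  (1 - norm2 z) `^ (e * q) * Phi (nc (Tg g f z) / M) <=
  K * ((1 - t * norm2 z) `^ (e * q) * Phi (nc (f ((t%:C)%C *: z)))).
Proof.
move=> e0; have [K K0 HK] := @Tg_ray_bound R n e e0.
(* The 2 pays for near-maximality of t; L >= 1 because upper type concerns factors at least 1. *)
pose L := Num.max 1 (2 * K); have L1 : 1 <= L by rewrite le_max lexx.
have LK : 2 * K <= L by rewrite le_max lexx orbT.
clearbody L; exists (Kq * L `^ q); first by rewrite mulr_gt0// powR_gt0; lra.
move=> f g M z hf hg M0 gM z1.
have [A A0 fA] := ray_growth_bounded e0 hf z1.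
pose S := [set ray_growth e f z t | t in [set t : R | 0 <= t <= 1]].
have S0 : S (ray_growth e f z 0) by exists 0 => //=; rewrite lexx ler01.
have hS : has_sup S.
  by split; [exists (ray_growth e f z 0)|exists A => _ [t /= t01 <-]; exact: fA].
pose B := sup S.
have fB t : 0 <= t <= 1 -> ray_growth e f z t <= B.
  by move=> t01; apply: ub_le_sup; [case: hS|exists t].
have TB : nc (Tg g f z) / M <= K * B.
  by rewrite ler_pdivrMr// mulrAC; exact: HK.
have B0 : 0 <= B by apply: le_trans (fB 0 _); [exact: ray_growth_ge0|rewrite lexx ler01].
have r0 : 0 < 1 - norm2 z by rewrite subr_gt0.
have z0 := norm2_ge0 z.
have T0 : 0 <= nc (Tg g f z) / M by rewrite divr_ge0 ?nc_ge0 ?(ltW M0).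
have [B00|Bn0] := eqVneq B 0.
  have -> : nc (Tg g f z) / M = 0.
    by apply/eqP; rewrite eq_le T0 andbT (le_trans TB)// B00 mulr0.
  exists 0; first by rewrite lexx ler01.
  by rewrite Phi0 mulr0 !mulr_ge0 ?powR_ge0 ?(ltW Kq0)// Phi_ge0 ?nc_ge0.
have Bp : 0 < B by rewrite lt_def Bn0.
have [_ [t /= t01 <-] Bt] : exists2 s, S s & B - B / 2 < s.
  by apply: sup_adherent => //; rewrite divr_gt0.
exists t => //; have /andP[t0 t1] := t01.
have tz : t * norm2 z <= norm2 z by rewrite ler_piMl.
have tz0 : 0 <= t * norm2 z by rewrite mulr_ge0.
rewrite /ray_growth in Bt; set h := nc _ in Bt *; set l := (_ / _) `^ e in Bt *.
have q0 : 0 <= (1 - t * norm2 z) / (1 - norm2 z) by rewrite divr_ge0 ?(ltW r0)//; lra.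
have l1 : 1 <= l.
  have -> : 1 = 1 `^ e :> R by rewrite powR1.
  apply: ge0_ler_powR; rewrite ?nnegrE ?(ltW e0)//.
  by rewrite ler_pdivlMr//; lra.
have h0 : 0 < h.
  rewrite lt_def nc_ge0 andbT; apply/eqP => h0; move: Bt; rewrite h0 mul0r; lra.
have Tl : nc (Tg g f z) / M <= h * (L * l).
  apply: (le_trans TB); rewrite (_ : h * (L * l) = L * (h * l)); last by ring.
  have hl : 0 <= h * l by rewrite mulr_ge0 ?(ltW h0)//; lra.
  apply: (@le_trans _ _ (2 * K * (h * l))); last by rewrite ler_wpM2r.
  rewrite (_ : 2 * K * (h * l) = K * (2 * (h * l))); last by ring.
  by rewrite ler_pM2l//; lra.
have Ll : 1 <= L * l by rewrite -[leLHS]mulr1 ler_pM//; lra.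
have HP := upper h0 Ll.
have lq : l `^ q = (1 - t * norm2 z) `^ (e * q) / (1 - norm2 z) `^ (e * q).
  have ri : 0 <= (1 - norm2 z)^-1 by rewrite invr_ge0 ltW.
  rewrite /l -powRrM powRM//; last by lra.
  by rewrite -(powR_inv1 (ltW r0)) -powRrM mulN1r powRN.
have rq : 0 < (1 - norm2 z) `^ (e * q) by rewrite powR_gt0.
apply: (@le_trans _ _ ((1 - norm2 z) `^ (e * q) * Phi (h * (L * l)))).
  by rewrite ler_pM2l// Phi_mono.
apply: (@le_trans _ _ ((1 - norm2 z) `^ (e * q) * (Kq * (L * l) `^ q * Phi h))).
  by rewrite ler_pM2l.
rewrite powRM; [|lra|lra]; rewrite lq le_eqVlt; apply/orP; left; apply/eqP; field.
by rewrite gt_eqF.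
Qed.

Lemma Tg_modular (alpha : R) : -1 < alpha -> exists2 K : R, 0 < K &
  forall f g M, holomorphic f -> holomorphic g -> 0 < M -> bloch_bound g M ->
  (mI (fun z : Cn => (ext (fun z => Phi (nc (Tg g f z) / M)) z * wt alpha z)%:E) <=
   K%:E * mI (fun z => (orlicz Phi f z * wt alpha z)%:E))%E.
Proof.
(* Then e q = (alpha + 1) / 2 is positive and alpha - e q = (alpha - 1) / 2 is still above -1, as
   [carleson] demands of its exponent. *)
move=> a1; pose e : R := (alpha + 1) / (2 * q).
have qp : 0 < q by exact: lt_le_trans ltr01 q1.
have e0 : 0 < e by rewrite divr_gt0//; lra.
pose g := e * q; have g0 : 0 < g by rewrite mulr_gt0.
have ga : g = (alpha + 1) / 2 by rewrite /g /e; field; rewrite gt_eqF.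
have [K1 K10 H1] := Tg_pointwise e0.
have [K2 K20 H2] := submean_kernel (ltW g0).
have c1 : -1 < alpha - g by rewrite ga; lra.
have k8 : (1 + 3) / 1 <= 8 :> R by lra.
have [K3 K30 H3] := @carleson R n (alpha - g) g 3 1 c1 ltr01 (ler0n _ _) k8.
exists (K1 * K2 * K3); first by rewrite !mulr_gt0.
move=> f h M hf hh M0 hM.
have mo := rmeas_orlicz Phi_cont hf.
have o0 w : 0 <= orlicz Phi f w by exact: orlicz_ge0.
pose J x := mI (fun w => (ball_fn (3 * (1 - norm2 w)) (((1:R)%:C)%C *: x + 0)%R w *
     (orlicz Phi f w * wt (g - (2 * n)%:R) w))%:E).
have b1 x : norm2 x < 1 -> 1 * (1 - norm2 x) <= 1 - norm2 (((1:R)%:C)%C *: x + 0).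
  by rewrite addr0 norm2_scaleR// !mul1r.
have {}H3 := H3 0 (orlicz Phi f) b1 mo o0.
have mJ : emeas J by exact: emeas_kernel_mI.
have J0 x : (0 <= J x)%E by apply: mI_ge0 => w; exact: kernel_ge0.
have mT : rmeas (ext (fun z => Phi (nc (Tg h f z) / M))).
  have := @holomorphic_nc_measurable R n (Tg h f) (fun u => Phi (u / M)) (Tg_holomorphic hf hh).
  apply=> t t0 d d0; have [r r0 rP] := Phi_cont (divr_ge0 t0 (ltW M0)) d0.
  exists (r * M); first by rewrite mulr_gt0.
  move=> s s0 st; apply: rP; first by rewrite divr_ge0// ltW.
  by rewrite -mulrBl normrM normfV (gtr0_norm M0) ltr_pdivrMr.
have T0 z : 0 <= ext (fun z => Phi (nc (Tg h f z) / M)) z.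
  by apply: ext_ge0 => y; apply: Phi_ge0; rewrite divr_ge0 ?nc_ge0 ?(ltW M0).
have mw : emeas (fun z : Cn => (wt (alpha - g) z)%:E) by exact: rmeas_emeas (rmeas_wt _).
have mwJ : emeas (fun z => ((wt (alpha - g) z)%:E * J z)%E) by exact: emeasurable_funM.
have K12 : 0 <= K1 * K2 by rewrite mulr_ge0 ?(ltW K10) ?(ltW K20).
have wJ0 z : (0 <= (wt (alpha - g) z)%:E * J z)%E by rewrite mule_ge0// lee_fin wt_ge0.
apply: (@le_trans _ _ ((K1 * K2)%:E * mI (fun z => ((wt (alpha - g) z)%:E * J z)%E))%E); last first.
  rewrite [(K1 * K2 * K3)%:E]EFinM -muleA; apply: lee_wpmul2l; first by rewrite lee_fin.
  by move: H3; rewrite subrK.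
rewrite -mI_Z//; apply: mI_le.
- by apply: rmeas_emeas; apply: rmeasM => //; exact: rmeas_wt.
- by apply: (@emeasurable_funM _ _ _ _ (fun=> _%:E)).
- by move=> z; rewrite lee_fin mulr_ge0 ?wt_ge0.
move=> z; have [z1|z1] := ltP (norm2 z) 1; last first.
  by rewrite {1}/wt {2}/ext ltNge z1 mulr0 mule_ge0.
have z0 := norm2_ge0 z; have r0 : 0 < 1 - norm2 z by rewrite subr_gt0.
have [t t01 Ht] := H1 f h M z hf hh M0 hM z1; have /andP[t0 t1] := t01.
have tz : t * norm2 z <= norm2 z by rewrite ler_piMl.
have tz0 : 0 <= t * norm2 z by rewrite mulr_ge0.
pose y := (t%:C)%C *: z; have Ny : norm2 y = t * norm2 z by rewrite norm2_scaleR.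
have y1 : norm2 y < 1 by rewrite Ny; lra.
have Hy := H2 f y hf y1.
(* For w with N (w - y) < 1 - N w, where y = t z, one has N (y - z) = N z - N y < 1 - N y < 2 (1 - N
   w), so w is within 3 (1 - N w) of z. The bound J z no longer involves t, which depends on z. *)
have yJ : (mI (fun w => (ball_fn (1 * (1 - norm2 w)) y w * (orlicz Phi f w * wt (g - (2 * n)%:R) w))%:E) <= J z)%E.
  apply: mI_le; [exact: emeas_kernel|exact: emeas_kernel|move=> w; exact: kernel_ge0|].
  move=> w; rewrite lee_fin ler_wpM2r ?mulr_ge0 ?wt_ge0//.
  rewrite addr0 scale1r /ball_fn mul1r; case: ltP => // wy.
  rewrite (_ : norm2 (w - z) < 3 * (1 - norm2 w))//.
  have h1 := norm2D (w - y) (y - z); rewrite addrA subrK in h1.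
  have h3 := norm2D (y - w) w; rewrite subrK -[y - w]opprB norm2N in h3.
  have h2 := norm2D (w - y) y; rewrite subrK in h2.
  have yz : norm2 (y - z) = (1 - t) * norm2 z.
    rewrite -norm2N opprB -norm2_scaleR ?subr_ge0//; congr norm2.
    rewrite /y -{1}[z]scale1r -scalerBl; congr (_ *: _).
    by apply/eqP; rewrite eq_complex/= subr0 !eqxx.
  by rewrite Ny in h3 h2; rewrite yz in h1; lra.
have P0 : 0 <= Phi (nc (Tg h f z) / M) by apply: Phi_ge0; rewrite divr_ge0 ?nc_ge0 ?(ltW M0).
rewrite {1}/ext {1}/wt {1}/ext z1.
apply: (@le_trans _ _ ((1 - norm2 z) `^ (alpha - g) *
    (K1 * ((1 - norm2 y) `^ g * Phi (nc (f y)))))%:E).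
  rewrite lee_fin powRB ?(gt_eqF r0) ?implybT//.
  rewrite mulrC -mulrA ler_wpM2l ?powR_ge0// ler_pdivlMl ?powR_gt0//.
  by rewrite Ny.
rewrite EFinM [leRHS]muleCA {1}/wt /ext z1; apply: lee_wpmul2l; first by rewrite lee_fin powR_ge0.
rewrite !EFinM -muleA; apply: lee_wpmul2l; first by rewrite lee_fin ltW.
rewrite -EFinM; apply: (le_trans Hy); apply: lee_wpmul2l => //.
by rewrite lee_fin ltW.
Qed.

End upper.

(** * Lower bound *)

Section affine_composition.
Context {R : realType} {n : nat}.
Local Notation nc := (@Normc.normc R).
Local Notation Cn := 'rV[C R]_n.
Implicit Types (x y z w a b : Cn) (f g : Cn -> C R).

Lemma holomorphic_affine f (c : C R) b : holomorphic f ->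
  (forall x, norm2 x < 1 -> norm2 (c *: x + b) < 1) -> holomorphic (fun x => f (c *: x + b)).
Proof.
move=> /holomorphicE hf cb; apply/holomorphicE => z z1.
exact: differentiable_affine (hf _ (cb z z1)).
Qed.

Lemma holomorphic_cst (c : C R) : holomorphic (fun _ : Cn => c).
Proof. by move=> z _; exact: differentiable_cst. Qed.

Lemma holomorphic_scale (c : C R) f : holomorphic f -> holomorphic (fun x => c * f x).
Proof.
move=> hf z z1; exact: (differentiableM (differentiable_cst c z) (hf z z1)).
Qed.

(** RF(a) is the derivative of l |-> F(l a) at l = 1. *)
Lemma radial_circle_estimate F a (r M : R) : 0 < r -> holomorphic F ->
  (forall l : C R, nc (l - 1) <= r -> norm2 (l *: a) < 1) ->
  (forall l : C R, nc (l - 1) <= r -> nc (F (l *: a)) <= M) ->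
  nc (radial F a) <= 2 * M / r.
Proof.
move=> r0 /holomorphicE hF lb lM.
have d (l : C R) : nc (l - 1) <= r -> differentiable F (0 + l *: a : Cn).
  by move=> h; rewrite add0r; exact/hF/lb.
have r1 : nc (1 - 1) <= r by rewrite subrr nc0 ltW.
suff : nc (lform (grad F (0 + (1 : C R) *: a)) a) <= 2 * M / r.
  by rewrite add0r scale1r radial_grad.
rewrite -(slice_deriv (d 1 r1)); apply: (cauchy_estimate r0) => l h.
  exact: differentiable_slice (d l h).
by rewrite add0r; exact: lM.
Qed.

End affine_composition.

Section lower.
Context {R : realType}.
Local Notation nc := (@Normc.normc R).
Variable Phi : R -> R.
Hypothesis Phi_ge0 : forall t, 0 <= t -> 0 <= Phi t.
Hypothesis Phi_cont : forall t, 0 <= t -> forall e : R, 0 < e ->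
  exists2 d : R, 0 < d & forall s, 0 <= s -> `|s - t| < d -> `|Phi s - Phi t| <= e.
Hypothesis Phi_mono : forall s t, 0 <= s -> s <= t -> Phi s <= Phi t.
Hypothesis Phi0 : Phi 0 = 0.
Hypothesis Phi_unbounded : forall A : R, exists2 T : R, 0 < T & A < Phi T.
Variables (p Kp : R).
Hypothesis p0 : 0 < p.
Hypothesis Kp0 : 0 < Kp.
Hypothesis lower : forall s t, 0 < s -> 0 < t -> t <= 1 -> Phi (s * t) <= Kp * t `^ p * Phi s.
Variable n : nat.
Hypothesis submean : submean_property Phi n.
Variable alpha : R.
Hypothesis alpha1 : -1 < alpha.
Local Notation Cn := 'rV[C R]_n.
Implicit Types (x y z w a b : Cn) (f g : Cn -> C R).

Definition modular f : \bar R := mI (fun z => (orlicz Phi f z * wt alpha z)%:E).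

Lemma emeas_modular f : holomorphic f -> emeas (fun z => (orlicz Phi f z * wt alpha z)%:E).
Proof.
move=> hf; apply: rmeas_emeas; apply: rmeasM; [exact: rmeas_orlicz|exact: rmeas_wt].
Qed.

Lemma modular_fn_ge0 f z : (0 <= (orlicz Phi f z * wt alpha z)%:E)%E.
Proof. by rewrite lee_fin mulr_ge0 ?wt_ge0// orlicz_ge0. Qed.

Lemma modular_ge0 f : (0 <= modular f)%E.
Proof. by apply: mI_ge0 => z; exact: modular_fn_ge0. Qed.

Lemma modular_le (K : R) f g : 0 <= K -> holomorphic f -> holomorphic g ->
  (forall z, norm2 z < 1 -> Phi (nc (f z)) <= K * Phi (nc (g z))) ->
  (modular f <= K%:E * modular g)%E.
Proof.
move=> K0 hf hg fg; have mg := emeas_modular hg; have g0 := modular_fn_ge0 g.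
rewrite /modular -mI_Z//; apply: mI_le.
- exact: emeas_modular.
- by apply: (@emeasurable_funM _ _ _ _ (fun=> _%:E)).
- exact: modular_fn_ge0.
- move=> z; rewrite -EFinM lee_fin mulrA ler_wpM2r ?wt_ge0//.
  by rewrite /orlicz /ext; case: ltP => z1; [exact: fg|rewrite mulr0].
Qed.

(** Uniformly in b: [submean_kernel] with exponent 0 at the image point, then [carleson] with s = 1
    / 2, whose hypothesis on b is the one made here. *)
Lemma modular_half : exists2 K : R, 0 < K & forall f b, holomorphic f ->
  (forall x, norm2 x < 1 -> 2^-1 * (1 - norm2 x) <= 1 - norm2 (((2^-1 : R)%:C)%C *: x + b)) ->
  (modular (fun x => f (((2^-1 : R)%:C)%C *: x + b)%R) <= K%:E * modular f)%E.
Proof.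
have [K1 K10 H1] := submean_kernel Phi_ge0 Phi_cont submean (lexx 0).
have h2 : 0 < 2^-1 :> R by rewrite invr_gt0.
have k8 : (1 + 1) / 2^-1 <= 8 :> R by rewrite invrK; lra.
have [K2 K20 H2] := @carleson R n alpha 0 1 2^-1 alpha1 h2 ler01 k8.
exists (K1 * K2); first by rewrite mulr_gt0.
move=> f b hf hb; have mo := rmeas_orlicz Phi_cont hf.
have o0 w : 0 <= orlicz Phi f w by exact: orlicz_ge0.
have {}H2 := H2 b (orlicz Phi f) hb mo o0.
have cb x : norm2 x < 1 -> norm2 (((2^-1 : R)%:C)%C *: x + b) < 1.
  move=> x1; rewrite -subr_gt0 (lt_le_trans _ (hb x x1))// mulr_gt0// subr_gt0.
  by [].
have hF := holomorphic_affine hf cb.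
pose J x := mI (fun w => (ball_fn (1 * (1 - norm2 w)) (((2^-1 : R)%:C)%C *: x + b)%R w *
     (orlicz Phi f w * wt (0 - (2 * n)%:R) w))%:E).
have mJ : emeas J by exact: emeas_kernel_mI.
have J0 x : (0 <= J x)%E by apply: mI_ge0 => w; exact: kernel_ge0.
have mw : emeas (fun z : Cn => (wt alpha z)%:E) by exact: rmeas_emeas (rmeas_wt _).
have mwJ : emeas (fun z => ((wt alpha z)%:E * J z)%E) by exact: emeasurable_funM.
have wJ0 z : (0 <= (wt alpha z)%:E * J z)%E by rewrite mule_ge0// lee_fin wt_ge0.
apply: (@le_trans _ _ (K1%:E * mI (fun z => ((wt alpha z)%:E * J z)%E))%E); last first.
  rewrite [(K1 * K2)%:E]EFinM -muleA; apply: lee_wpmul2l; first by rewrite lee_fin ltW.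
  by move: H2; rewrite addr0.
rewrite -mI_Z ?(ltW K10)//; apply: mI_le.
- exact: emeas_modular.
- by apply: (@emeasurable_funM _ _ _ _ (fun=> _%:E)).
- exact: modular_fn_ge0.
move=> z; have [z1|z1] := ltP (norm2 z) 1; last first.
  rewrite {1}/wt /ext ltNge z1 mulr0 mule_ge0//.
  by rewrite lee_fin ltW.
have := H1 f _ hf (cb z z1); rewrite powRr0 mul1r => H.
rewrite muleCA mulrC EFinM; apply: lee_wpmul2l; first by rewrite lee_fin wt_ge0.
by rewrite /orlicz {1}/ext z1; exact: H.
Qed.

Variables (m : (Cn -> C R) -> \bar R) (c1 c2 : R).
Hypothesis c10 : 0 < c1.
Hypothesis c20 : 0 < c2.
Hypothesis m_lower : forall f, holomorphic f -> (c1%:E * modular f <= m f)%E.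
Hypothesis m_upper : forall f, holomorphic f -> (m f <= c2%:E * modular f)%E.

(** Here m will be the integral against the normalized measure with weight (1 - |z|^2)^alpha; only
    its comparability with [modular], weighted by a power of 1 - N z, enters. *)
Definition unit_values a := [set nc (f a) | f in [set f | holomorphic f /\ (m f <= 1)%E]].

Definition extremal a := sup (unit_values a).

Lemma modular_unit f : holomorphic f -> (m f <= 1)%E -> (modular f <= (c1^-1)%:E)%E.
Proof.
move=> hf mf; have := le_trans (m_lower hf) mf.
have := modular_ge0 f; case: (modular f) => [s| |]// _.
  by rewrite -EFinM !lee_fin -ler_pdivlMl// mulr1.
by rewrite gt0_muley ?lte_fin// leye_eq.
Qed.

(** The sub-mean value property on the ball of radius (1 - N a) / 2 bounds Phi(|f(a)|), and
    unboundedness of Phi turns this into a bound of |f(a)|. *)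
Lemma extremal_bounded a : norm2 a < 1 -> exists A : R, forall f, holomorphic f ->
  (m f <= 1)%E -> nc (f a) <= A.
Proof.
move=> a1; have [K K0 HK] := submean; pose d := (1 - norm2 a) / 2.
have d0 : 0 < d by rewrite divr_gt0// subr_gt0.
have ad : norm2 a + d < 1 by rewrite /d in d0 *; lra.
have d1 : d <= 1 by have := norm2_ge0 a; rewrite /d; lra.
(* A lower bound of the weight on the ball: there d <= 1 - N w <= 1, and the sign of alpha decides
   which term of the minimum serves. *)
pose k := Num.min 1 (d `^ alpha); have k0 : 0 < k by rewrite lt_min ltr01 powR_gt0.
have [T T0 HT] := Phi_unbounded (K * (k^-1 * c1^-1) / d ^+ (2 * n)).
exists T => f hf mf; rewrite leNgt; apply/negP => fT.
have dn : 0 < d ^+ (2 * n) by rewrite exprn_gt0.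
have L1 : (local_int Phi f d a <= (k^-1 * c1^-1)%:E)%E.
  rewrite EFinM; apply: (@le_trans _ _ ((k^-1)%:E * modular f)%E); last first.
    by apply: lee_wpmul2l; [rewrite lee_fin invr_ge0 ltW|exact: modular_unit].
  rewrite /modular -mI_Z ?invr_ge0 ?(ltW k0)//; [|exact: emeas_modular|exact: modular_fn_ge0].
  apply: mI_le.
  - exact: emeas_local.
  - by apply: (@emeasurable_funM _ _ _ _ (fun=> _%:E)) => //; exact: emeas_modular.
  - exact: local_ge0.
  move=> w; rewrite -EFinM lee_fin /ball_fn; case: ltP => wa; last first.
    by rewrite mul0r mulr_ge0 ?invr_ge0 ?(ltW k0)// mulr_ge0 ?wt_ge0// orlicz_ge0.
  rewrite mul1r mulrCA ler_peMr//; first exact: orlicz_ge0.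
  rewrite ler_pdivlMl// mulr1.
  have := norm2D (w - a) a; rewrite subrK => h.
  have w1 : norm2 w < 1 by lra.
  have w0 := norm2_ge0 w.
  rewrite /wt /ext w1 ge_min; apply/orP.
  have dw : d <= 1 - norm2 w by rewrite /d in wa d0 *; lra.
  have [al|al] := leP 0 alpha.
    by right; apply: ge0_ler_powR; rewrite ?nnegrE ?(ltW d0)//; lra.
  left; rewrite -[leLHS](powRr0 (1 - norm2 w)); apply: ger_powR; last exact: ltW.
  by apply/andP; split; lra.
have := HK f a d hf d0 ad.
move=> /le_trans /(_ (lee_wpmul2l _ L1)); rewrite lee_fin (ltW K0) => /(_ isT).
rewrite -EFinM lee_fin -ler_pdivlMl// mulrC => H.
have : Phi T <= Phi (nc (f a)) by apply: Phi_mono; exact: ltW.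
by move: H; lra.
Qed.

(** The total weight is finite, and Phi is continuous at 0 with Phi(0) = 0. This makes the sets of
    unit values nonempty and their suprema positive. *)
Lemma small_constant : exists2 c : R, 0 < c & (m (fun _ : Cn => (c%:C)%C) <= 1)%E.
Proof.
have I1 := @wt_integrable R n alpha alpha1.
have I0 : (0 <= mI (fun x : Cn => (wt alpha x)%:E))%E.
  by apply: mI_ge0 => z; rewrite lee_fin wt_ge0.
case E : (mI (fun x : Cn => (wt alpha x)%:E)) I0 I1 => [I| |]// I0 _; rewrite lee_fin in I0.
have i0 : 0 < c2 * (I + 1) by rewrite mulr_gt0//; lra.
have e0 : 0 < (c2 * (I + 1))^-1 by rewrite invr_gt0.
have [d d0 dP] := Phi_cont (lexx 0) e0.
have c0 : 0 < d / 2 by rewrite divr_gt0.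
exists (d / 2) => //; apply: (le_trans (m_upper (@holomorphic_cst R n _))).
have Pd : Phi (d / 2) <= (c2 * (I + 1))^-1.
  have := dP (d / 2) (ltW c0); rewrite Phi0 !subr0 ger0_norm ?(ltW c0)// ger0_norm ?Phi_ge0 ?(ltW c0)//.
  by apply; lra.
rewrite /modular (eq_mI (G := fun z => ((Phi (d / 2))%:E * (wt alpha z)%:E)%E)); last first.
  move=> z; rewrite -EFinM /orlicz /wt /ext; case: ifP => _; last by rewrite !mulr0.
  by rewrite ncR gtr0_norm.
rewrite mI_Z ?Phi_ge0 ?(ltW c0)//; last 2 first.
- exact: rmeas_emeas (rmeas_wt _).
- by move=> z; rewrite lee_fin wt_ge0.
rewrite E -!EFinM lee_fin.
apply: (@le_trans _ _ (c2 * ((c2 * (I + 1))^-1 * (I + 1)))).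
  rewrite ler_pM2l//; apply: ler_pM => //; last by lra.
  by rewrite Phi_ge0// ltW.
rewrite mulrCA mulVf ?gt_eqF//.
Qed.

Lemma unit_values_sup a : norm2 a < 1 -> has_sup (unit_values a).
Proof.
move=> a1; split.
  have [c c0 hc] := small_constant.
  by exists (nc (c%:C)%C), (fun=> (c%:C)%C) => //; split => //; exact: holomorphic_cst.
have [A HA] := extremal_bounded a1.
by exists A => _ [f [hf mf] <-]; exact: HA.
Qed.

Lemma le_extremal a f : norm2 a < 1 -> holomorphic f -> (m f <= 1)%E -> nc (f a) <= extremal a.
Proof.
move=> a1 hf mf; apply: ub_le_sup; first by have [] := unit_values_sup a1.
by exists f.
Qed.

Lemma extremal_gt0 a : norm2 a < 1 -> 0 < extremal a.
Proof.
move=> a1; have [c c0 hc] := small_constant.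
apply: (lt_le_trans c0); have := le_extremal a1 (@holomorphic_cst R n _) hc.
by rewrite ncR gtr0_norm.
Qed.

Lemma dilation_in_ball a (l : C R) : norm2 a < 1 -> nc (l - 1) <= (1 - norm2 a) / 2 ->
  norm2 (l *: a) < 1.
Proof.
move=> a1 l1; rewrite norm2Z; have a0 := norm2_ge0 a.
have : nc l <= 1 + (1 - norm2 a) / 2 by have := ncD (l - 1) 1; rewrite subrK nc1; lra.
by nra.
Qed.

(* The map x |-> x / 2 + (l - 1 / 2) a sends the ball into itself and a to l *: a, and composing with it changes the modular by a bounded factor. *)
Lemma extremal_doubling : exists2 K : R, 0 < K & forall a (l : C R), norm2 a < 1 ->
  nc (l - 1) <= (1 - norm2 a) / 2 -> extremal (l *: a) <= K * extremal a.
Proof.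
have [K K0 HK] := modular_half.
(* X collects the comparison of m with [modular], lower type and [modular_half]. The factor c
   satisfies X c^p <= 1, so c f(x / 2 + b) is again admissible in the extremal problem. *)
pose X := c2 * Kp * K / c1; have X0 : 0 < X by rewrite divr_gt0// !mulr_gt0.
pose c := Num.min 1 (X^-1 `^ p^-1).
have c0 : 0 < c by rewrite lt_min ltr01 powR_gt0// invr_gt0.
have c1' : c <= 1 by rewrite ge_min lexx.
have cX : c `^ p <= X^-1.
  have -> : X^-1 = (X^-1 `^ p^-1) `^ p.
    by rewrite -powRrM mulVf ?gt_eqF// powRr1// invr_ge0 ltW.
  apply: ge0_ler_powR; rewrite ?nnegrE ?powR_ge0 ?(ltW p0) ?(ltW c0)//.
  by rewrite ge_min lexx orbT.
clearbody c; exists c^-1; first by rewrite invr_gt0.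
move=> a l a1 l1; have la1 := dilation_in_ball a1 l1.
apply: ge_sup; first by have [] := unit_values_sup la1.
move=> _ [f [hf mf] <-]; rewrite ler_pdivlMl//.
pose b := (l - ((2^-1 : R)%:C)%C) *: a.
have a0 := norm2_ge0 a.
have Yb x : norm2 x < 1 -> 2^-1 * (1 - norm2 x) <= 1 - norm2 (((2^-1 : R)%:C)%C *: x + b).
  move=> x1; have h2 : 0 <= 2^-1 :> R by rewrite invr_ge0.
  have := norm2D (((2^-1 : R)%:C)%C *: x) b; rewrite norm2_scaleR// /b norm2Z.
  have : nc (l - ((2^-1 : R)%:C)%C) <= (1 - norm2 a) / 2 + 2^-1.
    have := ncD (l - 1) (1 - ((2^-1 : R)%:C)%C); rewrite addrA subrK.
    have -> : (1 : C R) - ((2^-1 : R)%:C)%C = ((2^-1 : R)%:C)%C.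
      by apply/eqP; rewrite eq_complex/=; apply/andP; split; apply/eqP; field.
    by rewrite ncR ger0_norm//; lra.
  by have x0 := norm2_ge0 x; nra.
have cb x : norm2 x < 1 -> norm2 (((2^-1 : R)%:C)%C *: x + b) < 1.
  move=> x1; have := Yb x x1; lra.
have hY := holomorphic_affine hf cb.
pose F x := (c%:C)%C * f (((2^-1 : R)%:C)%C *: x + b)%R.
have hF : holomorphic F by exact: holomorphic_scale.
have Fa : nc (F a) = c * nc (f (l *: a)).
  rewrite ncM ncR gtr0_norm//; congr (_ * nc (f _)).
  by rewrite /b -scalerDl addrC subrK.
rewrite -Fa; apply: le_extremal => //.
apply: (le_trans (m_upper hF)).
have h1 : (modular F <= (Kp * c `^ p)%:E * modular (fun x => f (((2^-1 : R)%:C)%C *: x + b)%R))%E.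
  apply: modular_le => //; first by rewrite mulr_ge0 ?powR_ge0// ltW.
  move=> z z1; rewrite ncM ncR (gtr0_norm c0); set s := nc _.
  have [->|s0] := eqVneq s 0; first by rewrite mulr0 Phi0 mulr0.
  by rewrite mulrC lower// lt_def s0 nc_ge0.
have h2 := le_trans (HK f b hf Yb) (lee_wpmul2l _ (modular_unit hf mf)).
have {}h2 := h2 ltac:(by rewrite lee_fin ltW).
have kc : 0 <= Kp * c `^ p by rewrite mulr_ge0 ?powR_ge0// ltW.
apply: (@le_trans _ _ (c2%:E * ((Kp * c `^ p)%:E * (K%:E * (c1^-1)%:E)))%E).
  apply: lee_wpmul2l; first by rewrite lee_fin ltW.
  by apply: (le_trans h1); apply: lee_wpmul2l.
rewrite -!EFinM lee_fin (_ : c2 * _ = X * c `^ p); last by rewrite /X; ring.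
by rewrite -ler_pdivlMl// mulr1.
Qed.

Lemma radial_symbol_bound : exists2 K : R, 0 < K & forall g (L : R), holomorphic g -> 0 < L ->
  (forall f, holomorphic f -> (m f <= 1)%E -> (m (fun x => (L^-1)%:C%C * Tg g f x)%R <= 1)%E) ->
  forall a, norm2 a < 1 -> (1 - norm2 a) * nc (radial g a) <= K * L.
Proof.
(* In 8, one factor 2 is that of Cauchy's estimate, one comes from |f(a)| > E / 2, and one from 1 -
   N a = 2 r. *)
have [K K0 HK] := extremal_doubling; exists (8 * K); first by rewrite mulr_gt0.
move=> g L hg L0 HL a a1; have E0 := extremal_gt0 a1; set E := extremal a in E0 *.
have [_ [f [hf mf] <-] fE] : exists2 s, unit_values a s & E - E / 2 < s.
  by apply: sup_adherent; [rewrite divr_gt0|exact: unit_values_sup].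
have hT := Tg_holomorphic hf hg.
set r := (1 - norm2 a) / 2; have r0 : 0 < r by rewrite divr_gt0// subr_gt0.
have H : nc (radial (Tg g f) a) <= 2 * (L * (K * E)) / r.
  apply: radial_circle_estimate => // l lr; first exact: dilation_in_ball.
  have la := dilation_in_ball a1 lr.
  have := le_extremal la (holomorphic_scale _ hT) (HL f hf mf).
  rewrite ncM ncR ger0_norm ?invr_ge0 ?(ltW L0)// ler_pdivrMl// => /le_trans; apply.
  by rewrite ler_pM2l//; exact: HK.
rewrite radial_Tg// ncM ler_pdivlMr// in H.
have -> : 1 - norm2 a = 2 * r by rewrite /r; field.
have g0 := nc_ge0 (radial g a).
have H2 : E / 2 * nc (radial g a) * r <= 2 * (L * (K * E)).
  apply: le_trans H; rewrite ler_wpM2r ?(ltW r0)// ler_wpM2r//; lra.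
rewrite -(ler_pM2l E0); lra.
Qed.

End lower.

(** * Weights and growth functions *)

Section weighted_integral.
Context {R : realType} {n : nat}.
Local Notation nc := (@Normc.normc R).
Local Notation Cn := 'rV[C R]_n.
Implicit Types (x y z w : Cn) (u v : Cn -> R).

Definition sqwt (c : R) z : R := ext (fun z => (1 - sqnorm z) `^ c) z.

(** The quotient of the weights is (1 + N z)^c with 1 <= 1 + N z < 2; minimum and maximum with 1
    cover both signs of c. *)
Lemma sqwt_comparable (c : R) : exists k1 k2 : R, [/\ 0 < k1, 0 < k2 &
  forall z, k1 * wt c z <= sqwt c z <= k2 * wt c z].
Proof.
exists (Num.min 1 (2 `^ c)), (Num.max 1 (2 `^ c)); split.
- by rewrite lt_min ltr01 powR_gt0.
- by rewrite lt_max ltr01.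
move=> z; rewrite /sqwt /wt /ext; case: ltP => z1; last by rewrite !mulr0 lexx.
have z0 := norm2_ge0 z.
rewrite -norm2_sqr (_ : 1 - norm2 z ^+ 2 = (1 + norm2 z) * (1 - norm2 z)); last by ring.
have r0 : 0 <= 1 - norm2 z by lra.
have u0 : 0 <= 1 + norm2 z by lra.
rewrite powRM//.
rewrite !ler_wpM2r ?powR_ge0//.
- have [c0|c0] := leP 0 c.
    rewrite le_max; apply/orP; right; apply: ge0_ler_powR; rewrite ?nnegrE//; lra.
  rewrite le_max; apply/orP; left; rewrite -[leRHS](powRr0 (1 + norm2 z)).
  by apply: ler_powR; [lra|exact: ltW].
- have [c0|c0] := leP 0 c.
    rewrite ge_min; apply/orP; left; rewrite -[leLHS](powRr0 (1 + norm2 z)).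
    by apply: ler_powR; [lra|].
  rewrite ge_min; apply/orP; right; rewrite -(opprK c) powRN [leRHS]powRN.
  rewrite lef_pV2 ?posrE ?powR_gt0//; last by lra.
  apply: ge0_ler_powR; rewrite ?nnegrE//; lra.
Qed.

Lemma sqwt_ge0 c z : 0 <= sqwt c z.
Proof. by apply: ext_ge0 => y; exact: powR_ge0. Qed.

Lemma rmeas_sqwt c : rmeas (sqwt c).
Proof.
apply: rmeas_ext; apply: (measurableT_comp (measurable_powR c)).
apply: measurable_funB => //.
rewrite (_ : (fun t => _) = fun t => norm2 (@of_coords R n t) ^+ 2).
  by apply: measurable_funX; exact: mvec_norm2.
by apply/funext => t; rewrite norm2_sqr.
Qed.

Lemma integral_BnE u : integral_Bn u = mI (fun z => (ext u z)%:E).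
Proof.
rewrite /integral_Bn integral_mkcond; apply: eq_integral => t _.
rewrite patchE /ext; case: (ltP (norm2 (of_coords t)) 1) => h.
  by rewrite mem_set//=; exact/BnE.
by rewrite memNset//= => /BnE; rewrite ltNge h.
Qed.

Variable alpha : R.
Hypothesis alpha1 : -1 < alpha.

(** The normalizing integral must be finite and positive, otherwise [fine] and the inverse would
    give 0. Finiteness is [wt_integrable]; positivity comes from the ball of radius 1 / 2. *)
Lemma calpha_gt0 : 0 < @calpha R n alpha.
Proof.
have [k1 [k2 [k10 k20 k12]]] := sqwt_comparable alpha.
have mw := rmeas_emeas (rmeas_wt (n := n) alpha).
have ms := rmeas_emeas (rmeas_sqwt alpha).
have s0 z : (0 <= (sqwt alpha z)%:E)%E by rewrite lee_fin sqwt_ge0.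
have w0 z : (0 <= (wt alpha z : R)%:E)%E by rewrite lee_fin wt_ge0.
rewrite /calpha invr_gt0 integral_BnE -/(sqwt alpha).
have up : (mI (fun z => (sqwt alpha z)%:E) < +oo)%E.
  apply: (@le_lt_trans _ _ (k2%:E * mI (fun z : Cn => (wt alpha z)%:E))%E).
    rewrite -mI_Z ?(ltW k20)//; apply: mI_le => //.
      by apply: (@emeasurable_funM _ _ _ _ (fun=> _%:E)).
    by move=> z; rewrite -EFinM lee_fin; have /andP[] := k12 z.
  have := @wt_integrable R n alpha alpha1.
  have : (0 <= mI (fun z : Cn => (wt alpha z)%:E))%E by exact: mI_ge0.
  by case: (mI _) => [s| |]// _ _; rewrite -EFinM ltry.
pose k := k1 * Num.min 1 ((2^-1) `^ alpha).
have k0 : 0 < k by rewrite mulr_gt0// lt_min ltr01 powR_gt0// invr_gt0.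
have h2 : 0 < 2^-1 :> R by rewrite invr_gt0.
have lo : ((k * ((2^-1) ^+ (2 * n) * (@vol R n)))%:E <= mI (fun z => (sqwt alpha z)%:E))%E.
  have mb := rmeas_emeas (rmeas_ball_fn (n := n) 2^-1 0).
  rewrite EFinM -(mI_ball 0 h2) -mI_Z ?(ltW k0)//; last by move=> z; rewrite lee_fin ball_fn_ge0.
  apply: mI_le => //.
  - apply: (@emeasurable_funM _ _ _ _ (fun=> k%:E)) => //; exact: mb.
  - by move=> z; rewrite -EFinM lee_fin mulr_ge0 ?ball_fn_ge0 ?(ltW k0).
  move=> z; rewrite -EFinM lee_fin /ball_fn subr0; case: ltP => z2; last by rewrite mulr0 sqwt_ge0.
  have z1 : norm2 z < 1 by lra.
  have z0 := norm2_ge0 z.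
  have /andP[h _] := k12 z; apply: le_trans h; rewrite mulr1 /k ler_pM2l// /wt /ext z1.
  rewrite ge_min; apply/orP; have [al|al] := leP 0 alpha.
    by right; apply: ge0_ler_powR; rewrite ?nnegrE; lra.
  left; rewrite -[leLHS](powRr0 (1 - norm2 z)); apply: ger_powR; last exact: ltW.
  by apply/andP; split; lra.
have q0 : 0 < k * ((2^-1) ^+ (2 * n) * (@vol R n)).
  by rewrite mulr_gt0// mulr_gt0 ?vol_gt0// exprn_gt0.
have fin : mI (fun z => (sqwt alpha z)%:E) \is a fin_num.
  by rewrite ge0_fin_numE//; exact: mI_ge0.
by rewrite -lte_fin fineK// (lt_le_trans _ lo)// lte_fin.
Qed.

Lemma integral_alphaE u : integral_alpha alpha u =
  mI (fun z => (@calpha R n alpha * (sqwt alpha z * ext u z))%:E).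
Proof.
rewrite /integral_alpha integral_BnE; apply: eq_mI => z; congr EFin.
by rewrite /sqwt /ext; case: ifP => _; rewrite ?mulrA// !mulr0.
Qed.

Lemma integral_alpha_le u v : rmeas (ext u) -> rmeas (ext v) ->
  (forall z, norm2 z < 1 -> 0 <= u z <= v z) ->
  (integral_alpha alpha u <= integral_alpha alpha v)%E.
Proof.
move=> mu mv uv; rewrite !integral_alphaE; have c0 := ltW calpha_gt0.
have m0 : rmeas (fun _ : Cn => @calpha R n alpha) by exact: measurable_cst.
apply: mI_le.
- by apply: rmeas_emeas; apply: (rmeasM m0); apply: rmeasM => //; exact: rmeas_sqwt.
- by apply: rmeas_emeas; apply: (rmeasM m0); apply: rmeasM => //; exact: rmeas_sqwt.
- move=> z; rewrite lee_fin !mulr_ge0 ?sqwt_ge0// /ext; case: ltP => // z1.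
  by have /andP[] := uv z z1.
move=> z; rewrite lee_fin !ler_wpM2l ?sqwt_ge0// /ext; case: ltP => // z1.
by have /andP[] := uv z z1.
Qed.

Lemma integral_alpha_comparable : exists c1 c2 : R, [/\ 0 < c1, 0 < c2 &
  forall u, rmeas (ext u) -> (forall z, 0 <= ext u z) ->
  (c1%:E * mI (fun z => (ext u z * wt alpha z)%:E) <= integral_alpha alpha u)%E /\
  (integral_alpha alpha u <= c2%:E * mI (fun z => (ext u z * wt alpha z)%:E))%E].
Proof.
have [k1 [k2 [k10 k20 k12]]] := sqwt_comparable alpha; have c0 := calpha_gt0.
exists (@calpha R n alpha * k1), (@calpha R n alpha * k2); split; [exact: mulr_gt0|exact: mulr_gt0|].
move=> u mu u0; rewrite integral_alphaE.
have m0 : rmeas (fun _ : Cn => @calpha R n alpha) by exact: measurable_cst.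
have mw : emeas (fun z => (ext u z * wt alpha z)%:E).
  by apply: rmeas_emeas; apply: rmeasM => //; exact: rmeas_wt.
have ms : emeas (fun z => (@calpha R n alpha * (sqwt alpha z * ext u z))%:E).
  by apply: rmeas_emeas; apply: (rmeasM m0); apply: rmeasM => //; exact: rmeas_sqwt.
have w0 z : (0 <= (ext u z * wt alpha z)%:E)%E by rewrite lee_fin mulr_ge0 ?wt_ge0.
rewrite -!mI_Z ?mulr_ge0 ?(ltW c0) ?(ltW k10) ?(ltW k20)//; split; apply: mI_le => //.
- by apply: (@emeasurable_funM _ _ _ _ (fun=> _%:E)).
- by move=> z; rewrite mule_ge0// lee_fin mulr_ge0// ltW.
- move=> z; rewrite -EFinM lee_fin -mulrA ler_pM2l// mulrCA mulrC ler_wpM2r//.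
  by have /andP[] := k12 z.
- by apply: (@emeasurable_funM _ _ _ _ (fun=> _%:E)).
- by move=> z; rewrite lee_fin !mulr_ge0 ?sqwt_ge0// ltW.
- move=> z; rewrite -EFinM lee_fin -mulrA ler_pM2l// [leRHS]mulrCA [leRHS]mulrC ler_wpM2r//.
  by have /andP[] := k12 z.
Qed.

End weighted_integral.

(** * Consequences of the types for the growth function *)

Section growth.
Context {R : realType}.
Variables (p q : R) (Phi : R -> R).
Hypothesis p0 : 0 < p.
Hypothesis p1 : p <= 1.
Hypothesis q1 : 1 <= q.

Lemma growth_continuous : growth_function Phi ->
  forall t, 0 <= t -> forall e : R, 0 < e ->
  exists2 d : R, 0 < d & forall s, 0 <= s -> `|s - t| < d -> `|Phi s - Phi t| <= e.
Proof.
move=> [_ cP _] t t0 e e0.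
have /subspace_continuousP/(_ t) := cP.
rewrite /= in_itv/= t0 => /(_ isT)/cvgrPdist_le/(_ e e0).
rewrite near_withinE => /nbhs_ballP[d /= d0 dP]; exists d => // s s0 st.
by rewrite distrC; apply: dP; rewrite /= ?in_itv/= ?s0//= /ball/= distrC.
Qed.

(** Monotonicity of Phi(t) / t gives Phi(s t) <= t Phi(s) for t >= 1 in this class and for t <= 1 in
    the other: each class acquires the type missing from its definition. *)
Lemma classL_upper : classL p Phi -> forall s t, 0 < s -> 1 <= t ->
  Phi (s * t) <= 1 * t `^ q * Phi s.
Proof.
move=> [[Pge0 _ _] _ decr] s t s0 t1; have t0 : 0 < t by lra.
have := decr s (s * t) s0; rewrite ler_peMr ?(ltW s0)// => /(_ isT).
rewrite ler_pdivrMr ?mulr_gt0// mulrA divfK ?gt_eqF// => h; apply: (le_trans h).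
rewrite mul1r mulrC ler_wpM2r ?Pge0 ?(ltW s0)//.
by rewrite -[leLHS]powRr1 ?(ltW t0)// ler_powR.
Qed.

Lemma classU_lower : classU q Phi -> forall s t, 0 < s -> 0 < t -> t <= 1 ->
  Phi (s * t) <= 1 * t `^ p * Phi s.
Proof.
move=> [[Pge0 _ _] _ incr] s t s0 t0 t1.
have := incr (s * t) s; rewrite mulr_gt0// ler_piMr ?(ltW s0)// => /(_ isT isT).
rewrite ler_pdivrMr ?mulr_gt0// mulrA divfK ?gt_eqF// => h; apply: (le_trans h).
rewrite mul1r mulrC ler_wpM2r ?Pge0 ?(ltW s0)//.
by rewrite -[leLHS]powRr1 ?(ltW t0)//; apply: ger_powR => //; rewrite t0.
Qed.

Variable K : R.
Hypothesis K0 : 0 < K.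
Hypothesis Phi_ge0 : forall t, 0 <= t -> 0 <= Phi t.
Hypothesis Phi_mono : forall s t, 0 <= s -> s <= t -> Phi s <= Phi t.
Hypothesis low : forall s t, 0 < s -> 0 < t -> t <= 1 -> Phi (s * t) <= K * t `^ p * Phi s.

(** Phi(0) <= Phi(t) <= K t^p Phi(1) for 0 < t <= 1. If Phi(0) were positive, the t with t^p = x
    below would make the right-hand side at most Phi(0) / 2. *)
Lemma growth_at_0 : Phi 0 = 0.
Proof.
apply/eqP; rewrite eq_le Phi_ge0// andbT leNgt; apply/negP => P0.
have P1 : 0 < Phi 1 by apply: (lt_le_trans P0); exact: Phi_mono.
pose x := Num.min 1 (Phi 0 / (2 * K * Phi 1)).
have x0 : 0 < x by rewrite lt_min ltr01 divr_gt0// !mulr_gt0.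
have x1 : x <= 1 by rewrite ge_min lexx.
have xx : x <= Phi 0 / (2 * K * Phi 1) by rewrite ge_min lexx orbT.
pose t := x `^ p^-1; have t0 : 0 < t by rewrite powR_gt0.
have t1 : t <= 1.
  rewrite [leRHS](_ : 1 = 1 `^ p^-1); last by rewrite powR1.
  by apply: ge0_ler_powR; rewrite ?nnegrE ?invr_ge0 ?(ltW p0) ?(ltW x0).
have := low ltr01 t0 t1; rewrite mul1r /t -powRrM mulVf ?gt_eqF// powRr1 ?(ltW x0)// -/t => h.
have h1 : Phi 0 <= Phi t by apply: Phi_mono => //; exact: ltW.
have : K * x * Phi 1 <= Phi 0 / 2.
  move: xx; rewrite ler_pdivlMr ?mulr_gt0//; lra.
lra.
Qed.

(** Lower type read backwards: Phi(T) <= K y^(-p) Phi(T y), so Phi(T y) grows at least like y^p. *)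
Lemma growth_unbounded : (exists2 t : R, 0 <= t & Phi t != 0) ->
  forall A : R, exists2 T : R, 0 < T & A < Phi T.
Proof.
move=> [T t0 PT] A.
have T0 : 0 < T.
  rewrite lt_def t0 andbT; apply: contraNneq PT => ->; by rewrite growth_at_0.
have P0 : 0 < Phi T by rewrite lt_def PT Phi_ge0.
pose x := 1 + `|A| * K / Phi T.
have x1 : 1 <= x by rewrite lerDl divr_ge0 ?mulr_ge0 ?(ltW K0) ?(ltW P0).
pose y := x `^ p^-1.
have y1 : 1 <= y.
  rewrite [leLHS](_ : 1 = 1 `^ p^-1); last by rewrite powR1.
  by apply: ge0_ler_powR; rewrite ?nnegrE ?invr_ge0 ?(ltW p0)//; lra.
have y0 : 0 < y by lra.
exists (T * y); first by rewrite mulr_gt0.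
have yi : y^-1 <= 1 by rewrite invf_le1.
have Ty : 0 < T * y by rewrite mulr_gt0.
have y'0 : 0 < y^-1 by rewrite invr_gt0.
have := low Ty y'0 yi; rewrite mulfK ?gt_eqF//.
have -> : y^-1 `^ p = x^-1.
  rewrite -(powR_inv1 (ltW y0)) -powRrM mulN1r powRN; congr (_^-1).
  by rewrite /y -powRrM mulVf ?gt_eqF// powRr1//; lra.
rewrite mulrAC ler_pdivlMr; last by lra.
rewrite /x mulrDr mulr1 mulrCA mulfV ?gt_eqF// mulr1 => h.
have : K * A < K * Phi (T * y).
  apply: lt_le_trans h; rewrite mulrC.
  have : A * K <= `|A| * K by rewrite ler_wpM2r ?(ltW K0)// ler_norm.
  lra.
by rewrite ltr_pM2l.
Qed.

End growth.

(** * Luxemburg norms *)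

Section bloch.
Context {R : realType} {n : nat}.
Local Notation nc := (@Normc.normc R).
Local Notation Cn := 'rV[C R]_n.
Implicit Types (z : Cn) (f g : Cn -> C R).

Lemma bloch_seminorm_bound g (M : R) : (bloch_seminorm g <= M%:E)%E -> bloch_bound g M.
Proof.
move=> gM z z1.
have : (((1 - sqnorm z) * nc (radial g z))%:E <= M%:E)%E.
  by apply: le_trans gM; apply: ereal_sup_ubound; exists z => //; exact/BnE.
rewrite lee_fin; apply: le_trans; rewrite ler_wpM2r ?nc_ge0// -norm2_sqr.
by have := norm2_ge0 z; nra.
Qed.

Lemma bloch_seminorm_le g (M : R) : bloch_bound g M -> (bloch_seminorm g <= (2 * M)%:E)%E.
Proof.
move=> gM; apply: ge_ereal_sup => _ [z /BnE z1 <-]; rewrite lee_fin -norm2_sqr.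
set X := nc _.
have h := gM z z1; rewrite -/X in h.
have a0 : 0 <= (1 - norm2 z) * X by rewrite mulr_ge0 ?nc_ge0//; lra.
have : norm2 z * ((1 - norm2 z) * X) <= (1 - norm2 z) * X by rewrite ler_piMl// ltW.
by rewrite (_ : (1 - norm2 z ^+ 2) * X = (1 - norm2 z) * X + norm2 z * ((1 - norm2 z) * X)); [lra|ring].
Qed.

Lemma bloch_seminorm_ge0 g : (0 <= bloch_seminorm g)%E.
Proof.
apply: ereal_sup_ubound; exists 0; first by apply/BnE; rewrite norm20.
by rewrite radial0 nc0 mulr0.
Qed.

Lemma Tg_scale f g (c : C R) z : holomorphic f -> holomorphic g -> norm2 z < 1 ->
  Tg g (fun x => c * f x) z = c * Tg g f z.
Proof.
move=> hf hg z1; rewrite /Tg -ICZ; last exact: bmeas_Tg.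
by apply: eq_IC => t _; rewrite !mulrA.
Qed.

Lemma Tg_vanish f g z : (forall x, norm2 x < 1 -> f x = 0) -> norm2 z < 1 -> Tg g f z = 0.
Proof.
move=> f0 z1; rewrite -[RHS]IC_cst; apply: eq_IC => t /andP[t0 t1].
by rewrite /= f0 ?mul0r// norm2_scaleR// (le_lt_trans _ z1)// ler_piMl// norm2_ge0.
Qed.

End bloch.

Section luxemburg.
Context {R : realType}.
Local Notation nc := (@Normc.normc R).
Variable Phi : R -> R.
Hypothesis Phi_ge0 : forall t, 0 <= t -> 0 <= Phi t.
Hypothesis Phi_cont : forall t, 0 <= t -> forall e : R, 0 < e ->
  exists2 d : R, 0 < d & forall s, 0 <= s -> `|s - t| < d -> `|Phi s - Phi t| <= e.
Hypothesis Phi_mono : forall s t, 0 <= s -> s <= t -> Phi s <= Phi t.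
Hypothesis Phi0 : Phi 0 = 0.
Hypothesis Phi_unbounded : forall A : R, exists2 T : R, 0 < T & A < Phi T.
Variables (p Kp : R).
Hypothesis p0 : 0 < p.
Hypothesis Kp0 : 0 < Kp.
Hypothesis lower : forall s t, 0 < s -> 0 < t -> t <= 1 -> Phi (s * t) <= Kp * t `^ p * Phi s.
Variables (q Kq : R).
Hypothesis q1 : 1 <= q.
Hypothesis Kq0 : 0 < Kq.
Hypothesis upper : forall s t, 0 < s -> 1 <= t -> Phi (s * t) <= Kq * t `^ q * Phi s.
Variable n : nat.
Hypothesis submean : submean_property Phi n.
Variable alpha : R.
Hypothesis alpha1 : -1 < alpha.
Local Notation Cn := 'rV[C R]_n.
Local Notation modular := (modular Phi alpha).
Implicit Types (x y z w a : Cn) (f g : Cn -> C R).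

Definition mass f : \bar R := integral_alpha alpha (fun z => Phi (nc (f z))).

Definition rescale (l : R) f x : C R := ((l^-1)%:C)%C * f x.

Lemma rescale_holomorphic l f : holomorphic f -> holomorphic (rescale l f).
Proof. exact: holomorphic_scale. Qed.

Lemma nc_rescale l f x : 0 < l -> nc (rescale l f x) = nc (f x) / l.
Proof. by move=> l0; rewrite ncM ncR gtr0_norm ?invr_gt0// mulrC. Qed.

Lemma mass_rescale l f : 0 < l ->
  integral_alpha alpha (fun z => Phi (nc (f z) / l)) = mass (rescale l f).
Proof.
by move=> l0; congr integral_alpha; apply/funext => z; rewrite nc_rescale.
Qed.

Lemma mass_comparable : exists c1 c2 : R, [/\ 0 < c1, 0 < c2,
  forall f, holomorphic f -> (c1%:E * modular f <= mass f)%E &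
  forall f, holomorphic f -> (mass f <= c2%:E * modular f)%E].
Proof.
have [c1 [c2 [c10 c20 H]]] := @integral_alpha_comparable R n alpha alpha1.
exists c1, c2; split => // f hf; have mo := rmeas_orlicz Phi_cont hf.
  by have [] := H (fun z => Phi (nc (f z))) mo (orlicz_ge0 Phi_ge0 f).
by have [] := H (fun z => Phi (nc (f z))) mo (orlicz_ge0 Phi_ge0 f).
Qed.

Lemma mass_le f g : holomorphic f -> holomorphic g ->
  (forall z, norm2 z < 1 -> nc (f z) <= nc (g z)) -> (mass f <= mass g)%E.
Proof.
move=> hf hg fg; apply: integral_alpha_le => //.
- exact: (rmeas_orlicz Phi_cont hf).
- exact: (rmeas_orlicz Phi_cont hg).
- by move=> z z1; rewrite Phi_ge0 ?nc_ge0//= Phi_mono ?nc_ge0// fg.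
Qed.

Lemma mass_vanish f : (forall z, norm2 z < 1 -> f z = 0) -> mass f = 0%E.
Proof.
move=> f0; rewrite /mass integral_alphaE (eq_mI (G := fun=> 0%E)); first by rewrite /mI integral0.
by move=> z; rewrite /ext; case: ltP => z1; rewrite ?f0// ?nc0 ?Phi0 !mulr0.
Qed.

Lemma lux_le f (l : R) : 0 < l -> (mass (rescale l f) <= 1)%E -> (lux alpha Phi f <= l%:E)%E.
Proof.
by move=> l0 h; apply: ereal_inf_lbound; exists l => //; split => //; rewrite mass_rescale.
Qed.

(** A strict inequality provides an admissible r below l, and f / l is dominated by f / r. *)
Lemma lux_lt f (l : R) : holomorphic f -> (lux alpha Phi f < l%:E)%E ->
  0 < l /\ (mass (rescale l f) <= 1)%E.
Proof.
move=> hf /ereal_inf_lt[_ [r [r0 h] <-]]; rewrite lte_fin => rl.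
have l0 := lt_trans r0 rl; split => //; rewrite mass_rescale// in h.
apply: le_trans h; apply: mass_le; [exact: rescale_holomorphic|exact: rescale_holomorphic|].
by move=> z _; rewrite !nc_rescale// ler_wpM2l ?nc_ge0// lef_pV2 ?posrE// ltW.
Qed.

Lemma lux_ge0 f : (0 <= lux alpha Phi f)%E.
Proof. by apply: le_ereal_inf_tmp => _ [l [l0 _] <-]; rewrite lee_fin ltW. Qed.

(** Dividing a function by k multiplies its modular by at most Kp k^(-p); this is how a constant X
    in modular estimates becomes a factor k in norm estimates. *)
Lemma shrinking_factor (X : R) : 0 < X -> exists2 k : R, 1 <= k & Kp * k^-1 `^ p * X <= 1.
Proof.
move=> X0; have KX : 0 < Kp * X by rewrite mulr_gt0.
pose k := Num.max 1 ((Kp * X) `^ p^-1).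
have k1 : 1 <= k by rewrite le_max lexx.
have k0 : 0 < k by exact: lt_le_trans k1.
exists k => //; rewrite mulrAC -(powR_inv1 (ltW k0)) -powRrM mulN1r powRN.
rewrite ler_pdivrMr ?powR_gt0// mul1r.
have -> : Kp * X = ((Kp * X) `^ p^-1) `^ p by rewrite -powRrM mulVf ?gt_eqF// powRr1// ltW.
apply: ge0_ler_powR; rewrite ?nnegrE ?powR_ge0 ?(ltW p0) ?(ltW k0)//.
by rewrite le_max lexx orbT.
Qed.

Lemma modular_shrink f (k : R) : holomorphic f -> 1 <= k ->
  (modular (rescale k f) <= (Kp * k^-1 `^ p)%:E * modular f)%E.
Proof.
move=> hf k1; have k0 : 0 < k by lra.
apply: (modular_le Phi_ge0 Phi_cont) => //.
- by rewrite mulr_ge0 ?powR_ge0// ltW.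
- exact: rescale_holomorphic.
move=> z _; rewrite nc_rescale//; set s := nc _.
have [->|s0] := eqVneq s 0; first by rewrite mul0r Phi0 mulr0.
apply: lower; rewrite ?invr_gt0 ?invf_le1//.
by rewrite lt_def s0 nc_ge0.
Qed.

Lemma lux_finite f : bergman_orlicz alpha Phi f ->
  exists2 l : R, 0 < l & (mass (rescale l f) <= 1)%E.
Proof.
move=> [hf mf]; have [c1 [c2 [c10 c20 lo up]]] := mass_comparable.
have [r r0 fr] : exists2 r : R, 0 < r & (modular f <= r%:E)%E.
  have := lo f hf; have := modular_ge0 Phi_ge0 alpha f.
  case: (modular f) => [s| |]// s0.
    by exists (s + 1); rewrite ?lee_fin ?lerDl// ltr_wpDl.
  rewrite gt0_muley ?lte_fin// leye_eq => /eqP E.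
  by move: mf; rewrite -/(mass f) E.
have [k k1 hk] := shrinking_factor (mulr_gt0 c20 r0).
exists k; first by lra.
apply: (le_trans (up _ (rescale_holomorphic k hf))).
apply: (@le_trans _ _ (c2%:E * ((Kp * k^-1 `^ p)%:E * r%:E))%E).
  apply: lee_wpmul2l; first by rewrite lee_fin ltW.
  apply: (le_trans (modular_shrink hf k1)); apply: lee_wpmul2l => //.
  by rewrite lee_fin mulr_ge0 ?powR_ge0// ltW.
by rewrite -!EFinM lee_fin mulrCA.
Qed.

(** Upper type undoes the division by l, at the cost of Kq k^q with k = max 1 l. *)
Lemma lux_in_space f (l : R) : holomorphic f -> 0 < l -> (mass (rescale l f) <= 1)%E ->
  bergman_orlicz alpha Phi f.
Proof.
move=> hf l0 h; split => //; have [c1 [c2 [c10 c20 lo up]]] := mass_comparable.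
rewrite -/(mass f); apply: (le_lt_trans (up f hf)).
have hr := rescale_holomorphic l hf.
pose k := Num.max 1 l; have k1 : 1 <= k by rewrite le_max lexx.
have kl : l <= k by rewrite le_max lexx orbT.
have Kk : 0 <= Kq * k `^ q by rewrite mulr_ge0 ?powR_ge0// ltW.
have h1 : (modular f <= (Kq * k `^ q)%:E * modular (rescale l f))%E.
  apply: (modular_le Phi_ge0 Phi_cont) => // z _; rewrite nc_rescale//; set s := nc _.
  have [->|s0] := eqVneq s 0; first by rewrite mul0r Phi0 mulr0.
  have sp : 0 < s by rewrite lt_def s0 nc_ge0.
  have sl : 0 < s / l by rewrite divr_gt0.
  apply: le_trans (upper sl k1); apply: Phi_mono; first exact: ltW.
  by rewrite mulrAC ler_pdivlMr// ler_pM2l.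
have h2 := modular_unit Phi_ge0 (m := mass) c10 lo hr h.
apply: (@le_lt_trans _ _ (c2%:E * ((Kq * k `^ q)%:E * (c1^-1)%:E))%E).
  apply: lee_wpmul2l; first by rewrite lee_fin ltW.
  by apply: (le_trans h1); apply: lee_wpmul2l.
by rewrite -!EFinM ltry.
Qed.

Lemma lux_gt0 f z : holomorphic f -> norm2 z < 1 -> f z != 0 -> (0 < lux alpha Phi f)%E.
Proof.
move=> hf z1 fz; rewrite lt_def lux_ge0 andbT; apply/eqP => l0.
have [c1 [c2 [c10 c20 lo up]]] := mass_comparable.
have [A HA] := extremal_bounded Phi_ge0 Phi_cont Phi_mono Phi_unbounded submean (m := mass) c10 lo z1.
have fp : 0 < nc (f z) by rewrite nc_gt0.
have A1 : 0 < `|A| + 1 by rewrite ltr_wpDl.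
(* Divided by this number, f takes at z a value of modulus |A| + 1, which exceeds the bound A for
   functions of mass at most 1. *)
have lp : 0 < nc (f z) / (`|A| + 1) by rewrite divr_gt0.
have [_ h] := @lux_lt f (nc (f z) / (`|A| + 1)) hf (ltac:(by rewrite l0 lte_fin)).
have := HA _ (rescale_holomorphic _ hf) h; rewrite nc_rescale// invf_div mulrCA divff ?gt_eqF// mulr1.
by have := ler_norm A; lra.
Qed.

(** [Tg_modular], applied to f / l, leaves a constant, which [shrinking_factor] converts into the
    factor k; linearity of [Tg g] on the ball reassembles k M l. *)
Lemma mass_Tg : exists2 K : R, 0 < K & forall f g (M l : R), holomorphic f -> holomorphic g ->
  0 < M -> bloch_bound g M -> 0 < l -> (mass (rescale l f) <= 1)%E ->
  (mass (rescale (K * M * l) (Tg g f)) <= 1)%E.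
Proof.
have [c1 [c2 [c10 c20 lo up]]] := mass_comparable.
have [K K0 HK] := Tg_modular Phi_ge0 Phi_cont Phi_mono Phi0 submean q1 Kq0 upper alpha1.
have X0 : 0 < c2 * (K * c1^-1) by rewrite !mulr_gt0// invr_gt0.
have [k k1 hk] := shrinking_factor X0; have k0 : 0 < k by lra.
exists k => // f g M l hf hg M0 gM l0 h.
have hr := rescale_holomorphic l hf.
have hT := Tg_holomorphic hr hg.
have H1 : (modular (rescale M (Tg g (rescale l f))) <= (K * c1^-1)%:E)%E.
  rewrite /modular (eq_mI (G := fun z => (ext (fun z => Phi (nc (Tg g (rescale l f) z) / M)) z * wt alpha z)%:E)).
    apply: (le_trans (HK _ _ _ hr hg M0 gM)); rewrite EFinM; apply: lee_wpmul2l.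
      by rewrite lee_fin ltW.
    exact: (modular_unit Phi_ge0 (m := mass) c10 lo hr h).
  by move=> z; rewrite /orlicz /ext; case: ifP => //; rewrite nc_rescale.
have hF := rescale_holomorphic k (rescale_holomorphic M hT).
apply: (@le_trans _ _ (mass (rescale k (rescale M (Tg g (rescale l f)))))).
  apply: mass_le => //; first by apply: rescale_holomorphic; exact: Tg_holomorphic.
  move=> z z1; rewrite !nc_rescale ?mulr_gt0// /rescale Tg_scale// ncM ncR gtr0_norm ?invr_gt0//.
  by rewrite le_eqVlt; apply/orP; left; apply/eqP; field; rewrite !gt_eqF.
apply: (le_trans (up _ hF)).
apply: (@le_trans _ _ (c2%:E * ((Kp * k^-1 `^ p)%:E * (K * c1^-1)%:E))%E).
  apply: lee_wpmul2l; first by rewrite lee_fin ltW.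
  apply: (le_trans (modular_shrink (rescale_holomorphic M hT) k1)); apply: lee_wpmul2l => //.
  by rewrite lee_fin mulr_ge0 ?powR_ge0// ltW.
by rewrite -!EFinM lee_fin mulrCA.
Qed.

Lemma lux_Tg : exists2 K : R, 0 < K & forall f g (M : R), holomorphic f -> holomorphic g ->
  0 < M -> bloch_bound g M ->
  (bergman_orlicz alpha Phi f -> bergman_orlicz alpha Phi (Tg g f)) /\
  (lux alpha Phi (Tg g f) <= (K * M)%:E * lux alpha Phi f)%E.
Proof.
have [K K0 HK] := mass_Tg; exists K => // f g M hf hg M0 gM; split.
  move=> /lux_finite[l l0 h].
  by apply: (lux_in_space (Tg_holomorphic hf hg) _ (HK _ _ _ _ hf hg M0 gM l0 h)); rewrite !mulr_gt0.
have KM : 0 < K * M by rewrite mulr_gt0.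
rewrite -lee_pdivrMl//; apply: le_ereal_inf_tmp => _ [l [l0 h] <-].
rewrite lee_pdivrMl// -EFinM; apply: lux_le; first by rewrite mulr_gt0.
by apply: HK => //; rewrite -mass_rescale.
Qed.

(** The hypothesis is restricted to f not vanishing on the ball, as in [op_norm], and is strict so
    that [lux_lt] applies to Tg f. An f that vanishes on the ball is handled by [Tg_vanish]. *)
Lemma bloch_of_lux : exists2 K : R, 0 < K & forall g (L : R), holomorphic g -> 0 < L ->
  (forall f, bergman_orlicz alpha Phi f -> (exists2 z, Bn z & f z != 0) ->
     (lux alpha Phi f <= 1)%E -> (lux alpha Phi (Tg g f) < L%:E)%E) ->
  (bloch_seminorm g <= (K * L)%:E)%E.
Proof.
have [c1 [c2 [c10 c20 lo up]]] := mass_comparable.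
have [K K0 HK] := radial_symbol_bound Phi_ge0 Phi_cont Phi_mono Phi0 Phi_unbounded p0 Kp0 lower
  submean alpha1 (m := mass) c10 c20 lo up.
exists (2 * K); first by rewrite mulr_gt0.
move=> g L hg L0 HL; rewrite -mulrA; apply: bloch_seminorm_le; apply: HK => // f hf mf.
rewrite -/(rescale L (Tg g f)).
have [f0|] := pselect (exists2 z, Bn z & f z != 0); last first.
  move=> nf; rewrite mass_vanish// => z z1; rewrite /rescale Tg_vanish ?mulr0// => x x1.
  by apply/eqP; apply: contrapT => /negP fx; apply: nf; exists x => //; exact/BnE.
have m1 : (mass (rescale 1 f) <= 1)%E.
  apply: le_trans mf; apply: mass_le => //; first exact: rescale_holomorphic.
  by move=> z _; rewrite nc_rescale// divr1.
have bf : bergman_orlicz alpha Phi f by exact: lux_in_space m1.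
by have [] := lux_lt (Tg_holomorphic hf hg) (HL f bf f0 (lux_le ltr01 m1)).
Qed.

Theorem Tg_bounded_bloch g : holomorphic g ->
  bounded_op alpha Phi (Tg g) <-> (bloch_seminorm g < +oo)%E.
Proof.
move=> hg; split.
  have [K K0 HK] := bloch_of_lux; move=> [_ [B HB]].
  (* B may be negative, and [bloch_of_lux] asks for a strict bound. *)
  pose L := Num.max 0 B + 1; have L0 : 0 < L by rewrite ltr_wpDl// le_max lexx.
  apply: (le_lt_trans (HK g L hg L0 _)); last by rewrite ltry.
  move=> f bf _ f1; apply: (le_lt_trans (HB f bf)).
  apply: (@le_lt_trans _ _ ((Num.max 0 B)%:E)); last by rewrite lte_fin ltrDl.
  apply: (@le_trans _ _ ((Num.max 0 B)%:E * lux alpha Phi f)%E).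
    by apply: lee_wpmul2r; [exact: lux_ge0|rewrite lee_fin le_max lexx orbT].
  by rewrite -[leRHS]mule1; apply: lee_wpmul2l => //; rewrite lee_fin le_max lexx.
have [K K0 HK] := lux_Tg.
have := bloch_seminorm_ge0 g; case E : (bloch_seminorm g) => [S| |]// S0 _.
(* [lux_Tg] asks for a positive M, while S may be 0. *)
rewrite lee_fin in S0; have M0 : 0 < S + 1 by rewrite ltr_wpDl.
have gM : bloch_bound g (S + 1) by apply: bloch_seminorm_bound; rewrite E lee_fin lerDl.
split; first by move=> f bf; have [hf _] := bf; have [+ _] := HK f g _ hf hg M0 gM; exact.
by exists (K * (S + 1)) => f [hf _]; have [] := HK f g _ hf hg M0 gM.
Qed.

Lemma op_norm_ge_bloch : exists2 c : R, 0 < c & forall g, holomorphic g ->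
  (c%:E * bloch_seminorm g <= op_norm alpha Phi (Tg g))%E.
Proof.
have [K K0 HK] := bloch_of_lux; exists K^-1; first by rewrite invr_gt0.
move=> g hg; rewrite lee_pdivrMl//.
have HU f : bergman_orlicz alpha Phi f -> (exists2 z, Bn z & f z != 0) ->
    (lux alpha Phi (Tg g f) / lux alpha Phi f <= op_norm alpha Phi (Tg g))%E.
  by move=> bf f0; apply: ereal_sup_ubound; exists f.
have pos f : bergman_orlicz alpha Phi f -> (exists2 z, Bn z & f z != 0) ->
    exists2 r : R, 0 < r & lux alpha Phi f = r%:E.
  move=> bf [z /BnE z1 fz]; have [hf _] := bf; have := lux_gt0 hf z1 fz.
  have [l l0 h] := lux_finite bf; have := lux_le l0 h.
  by case: (lux alpha Phi f) => [r| |]// _; rewrite lte_fin; exists r.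
have [c1 [c2 [c10 c20 lo up]]] := mass_comparable.
(* A non-zero constant in the space keeps the supremum [op_norm] from running over the empty set,
   where it would be -oo, and shows N >= 0 below. *)
have [c c0 hc] := small_constant Phi_ge0 Phi_cont Phi0 alpha1 (m := mass) c20 up.
have m1 : (mass (rescale 1 (fun=> (c%:C)%C)) <= 1)%E.
  apply: le_trans hc; apply: mass_le; [|exact: holomorphic_cst|].
    by apply: rescale_holomorphic; exact: holomorphic_cst.
  by move=> z _; rewrite nc_rescale// divr1.
have bc := lux_in_space (@holomorphic_cst R n _) ltr01 m1.
have c0' : exists2 z : Cn, Bn z & (c%:C)%C != 0 :> C R.
  by exists 0; [apply/BnE; rewrite norm20|rewrite -nc_eq0 ncR normr_eq0 gt_eqF].
case E : (op_norm alpha Phi (Tg g)) => [N| |].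
- apply/lee_addgt0Pr => e e0; have eK : 0 < e / K by rewrite divr_gt0.
  (* The surplus e / K provides the strict inequality for [bloch_of_lux] and becomes e after
     multiplication by K. *)
  pose L := Num.max 0 N + e / K; have L0 : 0 < L by rewrite ltr_wpDl// le_max lexx.
  have HN f : bergman_orlicz alpha Phi f -> (exists2 z, Bn z & f z != 0) ->
      exists2 r : R, 0 < r & lux alpha Phi f = r%:E /\ (lux alpha Phi (Tg g f) <= (N * r)%:E)%E.
    move=> bf f0; have [r r0 fr] := pos f bf f0; exists r => //; split => //.
    by have := HU f bf f0; rewrite E fr inver gt_eqF// lee_pdivrMr// EFinM.
  have := HK g L hg L0 => H; have {}H : (bloch_seminorm g <= (K * L)%:E)%E.
    apply: H => f bf f0 f1; have [r r0 [fr Tr]] := HN f bf f0.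
    rewrite fr lee_fin in f1; apply: (le_lt_trans Tr); rewrite lte_fin /L.
    apply: (@le_lt_trans _ _ (Num.max 0 N)); last by rewrite ltrDl.
    apply: (@le_trans _ _ (Num.max 0 N * r)).
      by rewrite ler_wpM2r ?(ltW r0)// le_max lexx orbT.
    by rewrite ler_piMr// le_max lexx.
  apply: (le_trans H); rewrite -EFinM -EFinD lee_fin /L mulrDr mulrCA divff ?gt_eqF// mulr1.
  rewrite lerD2r ler_pM2l//.
  have N0 : 0 <= N; last by rewrite ge_max N0 lexx.
  have [r r0 [_ Tr]] := HN _ bc c0'.
  have := le_trans (lux_ge0 _) Tr; rewrite lee_fin => h.
  by rewrite -(ler_pM2r r0) mul0r.
- by rewrite gt0_muley ?lte_fin// leey.
- have [r r0 fr] := pos _ bc c0'; have := HU _ bc c0'; rewrite E fr inver gt_eqF// lee_pdivrMr//.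
  by rewrite gt0_mulNye ?lte_fin// leeNy_eq => /eqP h; have := lux_ge0 (Tg g (fun=> (c%:C)%C)); rewrite h.
Qed.

Lemma op_norm_le_bloch : exists2 K : R, 0 < K & forall g, holomorphic g ->
  (op_norm alpha Phi (Tg g) <= K%:E * bloch_seminorm g)%E.
Proof.
have [K K0 HK] := lux_Tg; exists K => // g hg.
have := bloch_seminorm_ge0 g; case E : (bloch_seminorm g) => [S| |]// S0; last first.
  by rewrite gt0_muley ?lte_fin// leey.
rewrite lee_fin in S0; apply: ge_ereal_sup => _ [f [bf [z /BnE z1 fz]] <-].
have [hf _] := bf; have f0 := lux_gt0 hf z1 fz.
have [l l0 h] := lux_finite bf; have := lux_le l0 h.
have HM (M : R) : 0 < M -> S <= M -> (lux alpha Phi (Tg g f) <= (K * M)%:E * lux alpha Phi f)%E.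
  move=> M0 SM; have gM : bloch_bound g M by apply: bloch_seminorm_bound; rewrite E lee_fin.
  by have [] := HK f g M hf hg M0 gM.
case F : (lux alpha Phi f) f0 HM => [r| |]// r0 HM _; rewrite lte_fin in r0.
rewrite inver gt_eqF// lee_pdivrMr//; apply/lee_addgt0Pr => e e0.
(* M = S + e / (K r) is positive even for S = 0, and its excess over S contributes exactly e. *)
have k0 : 0 < e / (K * r) by rewrite divr_gt0// mulr_gt0.
apply: (le_trans (HM (S + e / (K * r)) _ _)); first by rewrite ltr_wpDl.
  by rewrite lerDl ltW.
rewrite -!EFinM -EFinD lee_fin le_eqVlt; apply/orP; left; apply/eqP; field.
by rewrite !gt_eqF.
Qed.

End luxemburg.

Theorem theorem4p9 (R : realType) (n : nat) (alpha p q : R) (Phi : R -> R)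
    (hn : (1 <= n)%N) (halpha : -1 < alpha)
    (hp0 : 0 < p) (hp1 : p <= 1) (hq : 1 <= q)
    (hPhi : (classL p `|` classU q) Phi)
    (hPhi0 : exists2 t : R, 0 <= t & Phi t != 0) :
  (forall g : 'rV[C R]_n -> C R, holomorphic g -> g 0 = 0 ->
     (bounded_op alpha Phi (Tg g) <-> (bloch_seminorm g < +oo)%E)) /\
  (exists c K : R, [/\ 0 < c, 0 < K &
     forall g : 'rV[C R]_n -> C R, holomorphic g -> g 0 = 0 ->
       (c%:E * bloch_seminorm g <= op_norm alpha Phi (Tg g))%E /\
       (op_norm alpha Phi (Tg g) <= K%:E * bloch_seminorm g)%E]).
Proof.
have gr : growth_function Phi by case: hPhi => -[].
have [Pge0 _ Pmono] := gr; have Pcont := growth_continuous gr.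
have [Kp Kp0 low] : lower_type p Phi.
  by case: hPhi => h; [case: h|exists 1; [|exact: classU_lower hp1 h]].
have [Kq Kq0 up] : upper_type q Phi.
  by case: hPhi => h; [exists 1; [|exact: classL_upper hq h]|case: h].
have P0 := growth_at_0 hp0 Kp0 Pge0 Pmono low.
have Punb := growth_unbounded hp0 Kp0 Pge0 Pmono low hPhi0.
(* The last point at which the two classes are distinguished; in the second one, upper type at t = 2
   supplies the doubling constant Kq 2^q. *)
have sub : submean_property Phi n.
  case: hPhi => -[_ _ mon].
    exact: (@submean_nonincreasing R Phi Pge0 Pcont Pmono n p Kp hp0 Kp0 mon low P0).
  apply: (@submean_nondecreasing R Phi Pge0 Pcont n (Kq * 2 `^ q) _ mon _ P0).
    by rewrite mulr_gt0// powR_gt0.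
  by move=> s s0; apply: up => //; rewrite ler1n.
split.
  move=> g hg _.
  exact: (Tg_bounded_bloch Pge0 Pcont Pmono P0 Punb hp0 Kp0 low hq Kq0 up sub halpha hg).
have [c c0 hc] := op_norm_ge_bloch Pge0 Pcont Pmono P0 Punb hp0 Kp0 low Kq0 up sub halpha.
have [K K0 hK] := op_norm_le_bloch Pge0 Pcont Pmono P0 Punb hp0 Kp0 low hq Kq0 up sub halpha.
by exists c, K; split => // g hg _; split; [exact: hc|exact: hK].
Qed.
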